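(* Let $\rho_1>0$, $\rho_2>1$ and let $s>0$, $t>\rho_1+\rho_2$, $\tau_1>\rho_1$ and $\tau_2>\rho_2-1$. Then the mapping $$\mathcal{W}:(\mathcal{S}^{\rho_1}_{\rho_2})_0(\mathbb{R}^n)\times\left(\mathcal{S}^{\min\{s,\,\tau_2-\rho_2+1\}}_{1-\rho_1+\min\{t-\rho_2,\,\tau_1\}}\right)_0(\mathbb{R}^n)\to\mathcal{S}^{s}_{t,\tau_1,\tau_2}(\mathbb{H}^{n+1}),$$ given by $\mathcal{W}:(\psi,\varphi)\mapsto\mathcal{W}_\psi\varphi$, is continuous.
   Context: Notation: $\mathbb{N}=\{0,1,2,\dots\}$, $\mathbb{R}_+=(0,\infty)$, $\mathbb{H}^{n+1}=\mathbb{R}^n\times\mathbb{R}_+$ with points $(b,a)$, $\langle x\rangle=(1+|x|^2)^{1/2}$, and for a multi-index $\beta\in\mathbb{N}^n$, $|\beta|=\beta_1+\dots+\beta_n$, $\beta!=\beta_1!\cdots\beta_n!$; $\beta!^{s}$ means $(\beta!)^s$. Gelfand-Shilov spaces: for $\rho_1,\rho_2>0$, $\mathcal{S}^{\rho_1}_{\rho_2}(\mathbb{R}^n)$ consists of all $\varphi$ in the Schwartz space $\mathcal{S}(\mathbb{R}^n)$ such that for some $h>0$ $$p_h^{\rho_1,\rho_2}(\varphi)=\sup_{x\in\mathbb{R}^n,\ \alpha,\beta\in\mathbb{N}^n}\frac{h^{|\alpha+\beta|}}{\alpha!^{\rho_2}\beta!^{\rho_1}}|x^\alpha\varphi^{(\beta)}(x)|<\infty,$$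 with the inductive limit topology (in $h>0$) defined by these norms. Its closed subspace, with the relative topology, is $$(\mathcal{S}^{\rho_1}_{\rho_2})_0(\mathbb{R}^n)=\left\{\varphi\in\mathcal{S}^{\rho_1}_{\rho_2}(\mathbb{R}^n):\int_{\mathbb{R}^n}x^m\varphi(x)\,dx=0\ \ \forall m\in\mathbb{N}^n\right\}.$$ Spaces on the upper half-space: for $s,t,\tau_1,\tau_2>0$, $\mathcal{S}^{s}_{t,\tau_1,\tau_2}(\mathbb{H}^{n+1})$ consists of all smooth functions $\Phi$ on $\mathbb{H}^{n+1}$ such that for every $\alpha\in\mathbb{N}$ there exists $h>0$ with $$p_{\alpha,h}^{s,t,\tau_1,\tau_2}(\Phi)=\sup\frac{h^{|\beta|+k+l_1+l_2}}{\beta!^{s}k!^{t}l_1!^{\tau_1}l_2!^{\tau_2}}\left(a^{l_1}+\frac{1}{a^{l_2}}\right)\langle b\rangle^k\left|\partial_a^\alpha\partial_b^\beta\Phi(b,a)\right|<\infty,$$ the supremum being over $(b,a)\in\mathbb{H}^{n+1}$, $(k,l_1,l_2)\in\mathbb{N}^3$, $\beta\in\mathbb{N}^n$. Its topology is defined by these seminorms as inductive limit with respect to $h$ and projective limit with respect to $\alpha$. Wavelet transform: $$\mathcal{W}_\psi\varphi(b,a)=\frac{1}{a^n}\int_{\mathbb{R}^n}\varphi(x)\,\overline{\psi}\left(\frac{x-b}{a}\right)dx,\qquad(b,a)\in\mathbb{H}^{n+1}.$$ *)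

(* Defs.v *)
From HB Require Import structures.
From mathcomp Require Import all_boot all_order all_algebra.
From mathcomp Require Import all_classical all_reals all_analysis.
From mathcomp Require Export complex.
Set Implicit Arguments.
Unset Strict Implicit.
Unset Printing Implicit Defensive.
Import Order.TTheory GRing.Theory Num.Theory.
Import numFieldNormedType.Exports.
Import Normc.
Local Open Scope classical_set_scope.
Local Open Scope ring_scope.
Local Open Scope complex_scope.

Section lebesgue_product_step.
Context {R : realType} (n : nat).
Let RT := measurableTypeR R.
Variable mu : {sigma_finite_measure set (n.-tuple RT) -> \bar R}.

Definition tcons (p : RT * n.-tuple RT) : n.+1.-tuple RT :=
  [the n.+1.-tuple RT of p.1 :: p.2].

Lemma measurable_tcons : measurable_fun [set: RT * n.-tuple RT] tcons.
Proof. exact: (@measurable_cons _ _ _ RT fst n snd). Qed.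

Definition lebesgue_cons : set (n.+1.-tuple RT) -> \bar R :=
  pushforward (@lebesgue_measure R \x mu)%E tcons.

Let lc0 : lebesgue_cons set0 = 0%E.
Proof. by rewrite /lebesgue_cons /pushforward preimage_set0 measure0. Qed.

Let lc_ge0 A : (0 <= lebesgue_cons A)%E.
Proof. by rewrite /lebesgue_cons /pushforward measure_ge0. Qed.

Let lc_sigma_additive : semi_sigma_additive lebesgue_cons.
Proof.
move=> F mF tF mUF; rewrite /lebesgue_cons /pushforward preimage_bigcup.
apply: measure_semi_sigma_additive.
- by move=> k; rewrite -[X in measurable X]setTI; exact: measurable_tcons.
- apply/trivIsetP => /= i j _ _ ij; rewrite -preimage_setI.
  by move/trivIsetP : tF => /(_ _ _ _ _ ij) ->//; rewrite preimage_set0.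
- by rewrite -preimage_bigcup -[X in measurable X]setTI; exact: measurable_tcons.
Qed.

HB.instance Definition _ := isMeasure.Build _ _ _ lebesgue_cons
  lc0 lc_ge0 lc_sigma_additive.

Let lc_sigma_finite : sigma_finite setT lebesgue_cons.
Proof.
have /sigma_finiteP[F [TF ndF Foo]] := sigma_finiteT (@lebesgue_measure R).
have /sigma_finiteP[G [TG ndG Goo]] := sigma_finiteT mu.
pose u (x : n.+1.-tuple RT) : RT * n.-tuple RT := (thead x, [tuple of behead x]).
have mu_ : measurable_fun setT u.
  apply/measurable_fun_pairP; split; first exact: measurable_tnth.
  exact: measurable_behead.
have uK p : u (tcons p) = p.
  by case: p => a t; rewrite /u /tcons /= theadE; congr (_, _); apply/val_inj.
exists (fun k => u @^-1` (F k `*` G k)).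
  rewrite -preimage_bigcup; apply/esym/seteqP; split=> // x _.
  have [i _ Fi] : (\bigcup_k F k) (u x).1 by rewrite -TF.
  have [j _ Gj] : (\bigcup_k G k) (u x).2 by rewrite -TG.
  exists (maxn i j) => //; split.
    by apply: (subsetPset _ _ (ndF _ _ (leq_maxl i j))).
  by apply: (subsetPset _ _ (ndG _ _ (leq_maxr i j))).
move=> k; have [mFk Fk] := Foo k; have [mGk Gk] := Goo k; split.
  by rewrite -[X in measurable X]setTI; apply: mu_ => //; exact: measurableX.
rewrite /lebesgue_cons /pushforward -comp_preimage.
rewrite (_ : u \o tcons = id); last by apply/funext => p; exact: uK.
by rewrite preimage_id product_measure1E// lte_mul_pinfty// ge0_fin_numE.
Qed.

HB.instance Definition _ := Measure_isSigmaFinite.Build _ _ _ lebesgue_cons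
  lc_sigma_finite.

End lebesgue_product_step.

(* n-dimensional Lebesgue measure, on n-tuples since these (and not row
   vectors) carry the product sigma-algebra. *)
Fixpoint lebesgue_tuple (R : realType) (n : nat) :
    {sigma_finite_measure set (n.-tuple (measurableTypeR R)) -> \bar R} :=
  match n with
  | 0 => \d_ [tuple]
  | m.+1 => lebesgue_cons (lebesgue_tuple R m)
  end.

(* Re and Im are integrated separately, and Rintegral is 0 when its integrand
   is not integrable; all the integrals below are absolutely convergent. *)
Definition cintegral (R : realType) (n : nat) (f : 'rV[R]_n -> R[i]) : R[i] :=
  Complex (\int[lebesgue_tuple R n]_x complex.Re (f (\row_i tnth x i)))
          (\int[lebesgue_tuple R n]_x complex.Im (f (\row_i tnth x i))).

Section multi_indices.
Context {R : realType} {n : nat}.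

Definition mabs (a : 'I_n -> nat) : nat := (\sum_i a i)%N.
Definition mfact (a : 'I_n -> nat) : nat := (\prod_i (a i)`!)%N.
Definition mpow (x : 'rV[R]_n) (a : 'I_n -> nat) : R :=
  \prod_i x ord0 i ^+ a i.

(* The word 0...0 1...1 ... in which the letter i occurs a i times. *)
Definition mword (a : 'I_n -> nat) : seq 'I_n :=
  flatten [seq nseq (a i) i | i <- enum 'I_n].

(* <x> with the Euclidean norm; `|x| on row vectors is the sup norm. *)
Definition japanese (x : 'rV[R]_n) : R :=
  Num.sqrt (1 + \sum_i x ord0 i ^+ 2).

End multi_indices.

Section smooth.
Context {R : realType} {V : normedModType R} {I : Type}.
Variable e : I -> V.

Definition cpartial (i : I) (f : V -> R[i]) : V -> R[i] :=
  fun x => Complex ('D_(e i) (@complex.Re R \o f) x) ('D_(e i) (@complex.Im R \o f) x).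

(* The head of the word is the derivative applied last. *)
Definition cpartials (w : seq I) (f : V -> R[i]) : V -> R[i] :=
  foldr cpartial f w.

(* C^oo on the open set D: all the iterated partial derivatives along the
   coordinate directions e exist and are continuous at every point of D. *)
Definition smooth_on (D : set V) (f : V -> R[i]) : Prop :=
  forall (w : seq I) (x : V), D x ->
    [/\ {for x, continuous (@complex.Re R \o cpartials w f)},
        {for x, continuous (@complex.Im R \o cpartials w f)} &
        forall i, derivable (@complex.Re R \o cpartials w f) x (e i) /\
                  derivable (@complex.Im R \o cpartials w f) x (e i)].

End smooth.

(* The locally convex inductive limit, for h > 0, of the seminormed spaces
   E_h = { f | A f /\ p h f < +oo } with seminorm p h. *)
Section inductive_limit.
Context {R : realType} {T : Type}.
Variables (A : set (T -> R[i])) (p : R -> (T -> R[i]) -> \bar R).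

Definition step (h : R) : set (T -> R[i]) :=
  [set f | A f /\ (p h f < +oo)%E].

Definition steps : set (T -> R[i]) :=
  [set f | exists2 h, 0 < h & step h f].

Definition absolutely_convex (V : set (T -> R[i])) : Prop :=
  forall f g, V f -> V g -> forall c d : R[i], normc c + normc d <= 1 ->
    V (fun x => c * f x + d * g x).

(* Absolutely convex sets meeting every E_h in a neighbourhood of 0: they form
   a base of neighbourhoods of 0 for the finest locally convex topology making
   all the inclusions of the E_h continuous. *)
Definition indlim_nbhs0 (V : set (T -> R[i])) : Prop :=
  absolutely_convex V /\
  forall h, 0 < h ->
    exists2 r, 0 < r & forall f, step h f -> (p h f <= r%:E)%E -> V f.

Definition indlim : Type := set_type steps.

HB.instance Definition _ := Choice.copy indlim (set_type steps).

Definition indlim_open (U : set indlim) : Prop :=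
  forall f, U f -> exists2 V, indlim_nbhs0 V &
    forall g : indlim, V (fun x => \val g x - \val f x) -> U g.

Let indlim_openT : indlim_open setT.
Proof. by move=> f _; exists setT => //; split=> // h _; exists 1. Qed.

Let indlim_openI : setI_closed indlim_open.
Proof.
move=> U U' oU oU' f [/oU[V [cV nV] VU] /oU'[V' [cV' nV'] VU']].
exists (V `&` V'); last by move=> g [/VU ? /VU' ?].
split=> [g k [Vg V'g] [Vk V'k] c d cd|h h0].
  by split; [exact: cV|exact: cV'].
have [r r0 rV] := nV _ h0; have [r' r'0 rV'] := nV' _ h0.
exists (Num.min r r'); first by rewrite lt_min r0.
move=> g sg pg; split; [apply: rV|apply: rV'] => //; apply: (le_trans pg);
  by rewrite lee_fin ge_min lexx ?orbT.
Qed.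

Let indlim_open_bigU (I : Type) (U : I -> set indlim) :
  (forall i, indlim_open (U i)) -> indlim_open (\bigcup_i U i).
Proof.
move=> oU f [i _ /oU[V nV VU]]; exists V => // g /VU Ug; by exists i.
Qed.

HB.instance Definition _ := isOpenTopological.Build indlim
  indlim_openT indlim_openI indlim_open_bigU.

End inductive_limit.

Section gelfand_shilov.
Context {R : realType} (n : nat).

Definition mderiv (b : 'I_n -> nat) (phi : 'rV[R]_n -> R[i]) :
    'rV[R]_n -> R[i] :=
  cpartials (fun i => delta_mx ord0 i : 'rV[R]_n) (mword b) phi.

Definition schwartz : set ('rV[R]_n -> R[i]) :=
  [set phi | smooth_on (fun i => delta_mx ord0 i : 'rV[R]_n) setT phi /\
    forall a b : 'I_n -> nat, exists M : R, forall x,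
      normc ((mpow x a)%:C * mderiv b phi x) <= M].

Definition gs_norm (rho1 rho2 h : R) (phi : 'rV[R]_n -> R[i]) : \bar R :=
  ereal_sup [set y | exists (x : 'rV[R]_n) (a b : 'I_n -> nat), y =
    (h ^+ (mabs a + mabs b) /
       ((mfact a)%:R `^ rho2 * (mfact b)%:R `^ rho1) *
     normc ((mpow x a)%:C * mderiv b phi x))%:E].

Definition GS (rho1 rho2 : R) : Type := indlim schwartz (gs_norm rho1 rho2).

HB.instance Definition _ (rho1 rho2 : R) := Topological.on (GS rho1 rho2).

(* Used as a type below: a set coerces to the corresponding subtype, which
   carries the relative topology. *)
Definition GS0 (rho1 rho2 : R) : set (GS rho1 rho2) :=
  [set phi | forall m : 'I_n -> nat,
    cintegral (fun x => (mpow x m)%:C * \val phi x) = 0].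

Definition gs0_fun (rho1 rho2 : R) (phi : @GS0 rho1 rho2) : 'rV[R]_n -> R[i] :=
  \val (\val phi).

Definition wavelet (psi phi : 'rV[R]_n -> R[i]) (b : 'rV[R]_n) (a : R) : R[i] :=
  (a ^- n)%:C * cintegral (fun x => phi x * conjc (psi (a^-1 *: (x - b)))).

End gelfand_shilov.
Arguments GS0 {R} n%_N (rho1 rho2)%_R.
Arguments wavelet {R n} psi phi b a.

Section half_space.
Context {R : realType} (n : nat).

Definition half_space : set ('rV[R]_n * R) := [set z | 0 < z.2].

(* Some i is the direction of b_i, None that of a. *)
Definition hs_dir (i : option 'I_n) : 'rV[R]_n * R :=
  if i is Some j then (delta_mx ord0 j, 0) else (0, 1).

Definition hs_deriv (alpha : nat) (beta : 'I_n -> nat)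
    (Phi : 'rV[R]_n * R -> R[i]) : 'rV[R]_n * R -> R[i] :=
  cpartials hs_dir (nseq alpha None ++ map Some (mword beta)) Phi.

(* Functions on the half-space are represented by their extension by 0. *)
Definition hs_smooth : set ('rV[R]_n * R -> R[i]) :=
  [set Phi | smooth_on hs_dir half_space Phi /\
             forall z, ~ half_space z -> Phi z = 0].

Definition hs_norm (s t tau1 tau2 : R) (alpha : nat) (h : R)
    (Phi : 'rV[R]_n * R -> R[i]) : \bar R :=
  ereal_sup [set y | exists (b : 'rV[R]_n) (a : R) (k l1 l2 : nat)
      (beta : 'I_n -> nat), 0 < a /\ y =
    (h ^+ (mabs beta + k + l1 + l2) /
       ((mfact beta)%:R `^ s * k`!%:R `^ t *
        l1`!%:R `^ tau1 * l2`!%:R `^ tau2) *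
     (a ^+ l1 + a ^- l2) * japanese b ^+ k *
     normc (hs_deriv alpha beta Phi (b, a)))%:E].

Section space.
Variables s t tau1 tau2 : R.

Definition hs_fun : set ('rV[R]_n * R -> R[i]) :=
  [set Phi | forall alpha, steps hs_smooth (hs_norm s t tau1 tau2 alpha) Phi].

Definition hs_indlim (alpha : nat) : Type :=
  indlim hs_smooth (hs_norm s t tau1 tau2 alpha).

HB.instance Definition _ alpha := Topological.on (hs_indlim alpha).

Definition hs_incl (Phi : set_type hs_fun) :
    prod_topology hs_indlim :=
  fun alpha => SigSub (mem_set (set_mem (valP Phi) alpha)).

(* Projective limit over alpha of the inductive limits over h. *)
Definition SH : Type := initial_topology hs_incl.

HB.instance Definition _ := Topological.on SH.

Definition sh_fun (Phi : SH) : 'rV[R]_n * R -> R[i] := \val Phi.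

End space.
End half_space.
Arguments SH {R} n%_N (s t tau1 tau2)%_R.

(* Main.v *)
Require Import Defs.
From mathcomp Require Import all_boot all_order all_algebra.
From mathcomp Require Import all_classical all_reals all_analysis.
From mathcomp Require Import measurable_realfun ring lra zify.
Set Implicit Arguments.
Unset Strict Implicit.
Unset Printing Implicit Defensive.
Import Order.TTheory GRing.Theory Num.Theory.
Import numFieldNormedType.Exports.
Local Open Scope classical_set_scope.
Local Open Scope ring_scope.

(** The substitution [y = b + a x] turns the wavelet transform into the integral
    of [phi (b + a x)] times the conjugate of [psi x].  Splitting into real and
    imaginary parts, everything is expressed by the correlations
    [corr f g b a], the integral of [f (b + a x) * g x], of real functions.  A
    derivative in [b] falls on [f]; a derivative in [a] falls on [f] as well and
    brings out a coordinate of [x], which is moved to [g] ([corrz_jet]).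

    Decay ([corr_estimate]).  For [a <= 1], [f (b + a x)] is expanded at [b] to
    order [l].  The Taylor polynomial is a polynomial in [x], so it does not see
    [g], all of whose moments vanish, and the remainder gives the factor [a ^ l].
    A power of a coordinate of [b] is distributed by the binomial formula for
    [b = (b + a x) - a x].  The constants are [l!] to the power [sigma] from the
    [l] derivatives of [f], to the power [rho2] from the moment of order [l] of
    [g] and to the power [-1] from Taylor's formula, whence the condition
    [sigma + rho2 - 1 <= tau2].  For [a >= 1] the roles are exchanged through
    [corr f g b a = a^-n corr g f (- b / a) (1 / a)]; as [b] is then [a] times
    the new translation parameter, the order of the expansion is raised to pay
    for these powers of [a], which yields [tau + rho1 - 1 <= tau1] and
    [tau + rho1 - 1 + rho2 <= t].  With [sigma = min (s, tau2 - rho2 + 1)] and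
    [tau = 1 - rho1 + min (t - rho2, tau1)] all these conditions hold, so the
    transform is bounded from each pair of steps of the two inductive limits to
    a step of the target ([wave_bound]).

    Continuity.  A bilinear map that is bounded on steps is continuous on
    inductive limits of normed spaces, but here the domain carries the topology
    induced by the larger space without moment conditions, and a small element
    of the subspace is a sum of small elements of steps which need not satisfy
    these conditions.  Compactness closes this gap.  Bounded sets of a step are
    relatively compact in the larger steps, by Arzela-Ascoli ([gs_compact]).
    In such a scale, a condition on pairs that is stable under convergence in a
    step is open for the inductive limit topologies ([silva_open]): a
    neighbourhood is built as an increasing union of compact sets, each obtained
    from the previous one by adding a ball of the next step; if no radius were
    small enough for the condition to persist, counterexamples of radii tending
    to zero would converge, along an ultrafilter, to a point of the compact set
    already constructed.  This is applied to the condition that a pair either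
    violates the moment conditions or has its transform in a prescribed open set
    ([wave_in_open]); it is stable because moments are continuous on each step
    ([cmoments0_lim]). *)

(** * Directional derivatives and Taylor's formula *)
Section difference_quotients.
Context {R : realType} {V : normedModType R}.
Implicit Types (f g : V -> R) (x y v w : V) (d : R).

Let slope_err (A d t : R) : t != 0 ->
  `|d - t^-1 *: A| * `|t| = `|A - t * d|.
Proof.
move=> t0; rewrite -normrM -normrN; congr (`|_|).
by rewrite /GRing.scale /=; field.
Qed.

(** Clearing the denominator of the difference quotient: the form in which
    derivatives are established and used below. *)
Lemma is_deriveP f x v d : is_derive x v f d <->
  forall e : R, 0 < e -> exists2 r : R, 0 < r &
    forall t : R, `|t| < r -> `|f (x + t *: v) - f x - t * d| <= e * `|t|.
Proof.
split=> [[df <-] e e0|H].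
  have := df; rewrite /derivable -/(derive f x v) => /cvgrPdist_le /(_ e e0).
  rewrite near_withinE => /nbhs_ballP[r /= r0 Hr]; exists r => // t tr.
  have [->|t0] := eqVneq t 0.
    by rewrite scale0r addr0 subrr mul0r subr0 normr0 mulr0.
  have := Hr t; rewrite /ball /= sub0r normrN => /(_ tr t0).
  by rewrite -(ler_pM2r (x := `|t|)) ?normr_gt0 // slope_err // [_ *: _ + x]addrC.
have cv : h^-1 *: (f (h *: v + x) - f x) @[h --> 0^'] --> d.
  apply/cvgrPdist_le => e e0; rewrite near_withinE; apply/nbhs_ballP.
  have [r r0 Hr] := H e e0; exists r => //= t; rewrite /ball /= sub0r normrN => tr t0.
  have Ht := Hr t tr.
  by rewrite -(ler_pM2r (x := `|t|)) ?normr_gt0 // slope_err // [_ *: _ + x]addrC.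
by split; [apply/cvg_ex; exists d|apply/cvg_lim].
Qed.

(** Derivatives under the integral sign and derivatives of limits are obtained
    from this criterion: a quadratic error bound survives integration and
    pointwise limits, whereas mere differentiability does not. *)
Lemma is_derive_quadratic f x v d K :
  (forall t : R, `|t| <= 1 -> `|f (x + t *: v) - f x - t * d| <= K * t ^+ 2) ->
  is_derive x v f d.
Proof.
move=> H; apply/is_deriveP => e e0.
have K1 : 0 < `|K| + 1 by rewrite ltr_pwDr.
exists (Num.min 1 (e / (`|K| + 1))); first by rewrite lt_min ltr01 divr_gt0.
move=> t; rewrite lt_min ltr_pdivlMr // => /andP[/ltW t1 te].
apply: le_trans (H t t1) _; rewrite -real_normK ?num_real // expr2 mulrA.
apply: ler_wpM2r => //; apply: le_trans (ltW te).
rewrite mulrC; apply: ler_wpM2l => //.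
by rewrite (le_trans (ler_norm K)) // lerDl.
Qed.

End difference_quotients.

Lemma is_derive_line {R : realType} {V : normedModType R} (f : V -> R) x v d (t : R) :
  is_derive (x + t *: v) v f d ->
  is_derive t (1 : R) (fun s : R => f (x + s *: v)) d.
Proof.
move=> /is_deriveP H; apply/is_deriveP => e /H[r r0 Hr]; exists r => // h /Hr.
by rewrite [_%:A]mulr1 scalerDl addrA.
Qed.

Section directional_calculus.
Context {R : realType} {V : normedModType R}.
Implicit Types (f g : V -> R) (x y v w : V) (d : R).

Lemma mvt_line f (df : V -> R) x v :
  (forall y, is_derive y v f (df y)) ->
  exists2 c : R, 0 <= c <= 1 & f (x + v) - f x = df (x + c *: v).
Proof.
move=> H.
have D (t : R) : is_derive t (1 : R) (fun s : R => f (x + s *: v)) (df (x + t *: v)).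
  exact: is_derive_line.
have C : {within `[(0 : R), 1], continuous (fun s : R => f (x + s *: v))}.
  apply: continuous_subspaceT => t.
  by apply: differentiable_continuous; apply/derivable1_diffP; have [] := D t.
have [c] := MVT_segment ler01 (fun t _ => D t) C.
rewrite in_itv /= => c01; rewrite scale1r scale0r addr0 subr0 mulr1 => e.
by exists c.
Qed.

Lemma is_derive_scalev f x v d (c : R) : is_derive x v f d ->
  is_derive x (c *: v) f (c * d).
Proof.
have [->|c0] := eqVneq c 0.
  by rewrite scale0r mul0r => _; exact: is_derive0.
move=> /is_deriveP H; apply/is_deriveP => e e0.
have [r r0 Hr] := H (e / `|c|) ltac:(rewrite divr_gt0 ?normr_gt0 //).
exists (r / `|c|); first by rewrite divr_gt0 ?normr_gt0.
move=> t; rewrite ltr_pdivlMr ?normr_gt0 // -normrM => /Hr.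
rewrite scalerA mulrA; congr (_ <= _).
by rewrite normrM; field; rewrite normr_eq0.
Qed.

(** Continuity of one of the two partial derivatives is enough to add the
    directions, by the mean value theorem in the direction [w]. *)
Lemma is_derive_addv f (dw : V -> R) x v w d :
  is_derive x v f d -> (forall y, is_derive y w f (dw y)) ->
  {for x, continuous dw} -> is_derive x (v + w) f (d + dw x).
Proof.
move=> /is_deriveP Hv Hw /cvgrPdist_le cw; apply/is_deriveP => e e0.
have e2 : 0 < e / 2 by rewrite divr_gt0.
have [r r0 Hr] := Hv _ e2; have /nbhs_ballP[q /= q0 Hq] := cw _ e2.
set N := `|v| + `|w| + 1; have N0 : 0 < N by rewrite ltr_wpDl // addr_ge0.
exists (Num.min r (q / N)); first by rewrite lt_min r0 divr_gt0.
move=> t; rewrite lt_min ltr_pdivlMr // => /andP[tr tq].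
have [c /andP[c0 c1] E] := mvt_line (x + t *: v) (fun y => is_derive_scalev t (Hw y)).
have A : `|dw x - dw (x + t *: v + c *: (t *: w))| <= e / 2.
  apply: Hq; rewrite -ball_normE /= -addrA opprD addrA subrr sub0r normrN.
  apply: le_lt_trans tq; apply: le_trans (ler_normD _ _) _.
  rewrite !normrZ mulrCA -mulrDr; apply: ler_wpM2l => //.
  rewrite /N -addrA lerD2l (ger0_norm c0); have : c * `|w| <= `|w| by rewrite ler_piMl.
  lra.
have -> : f (x + t *: (v + w)) - f x - t * (d + dw x) =
  (f (x + t *: v) - f x - t * d) + t * (dw (x + t *: v + c *: (t *: w)) - dw x).
  rewrite mulrBr -E scalerDr addrA; ring.
apply: le_trans (ler_normD _ _) _.
have -> : e * `|t| = e / 2 * `|t| + `|t| * (e / 2) by lra.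
apply: lerD; first exact: Hr.
by rewrite normrM distrC; apply: ler_wpM2l.
Qed.

End directional_calculus.

Section taylor.
Context {R : realType}.

Lemma le_of_derive_le (f g df dg : R -> R) :
  (forall x, is_derive x (1:R) f (df x)) -> (forall x, is_derive x (1:R) g (dg x)) ->
  (forall x : R, 0 <= x <= 1 -> df x <= dg x) -> f 0 <= g 0 ->
  forall x : R, 0 <= x <= 1 -> f x <= g x.
Proof.
move=> Df Dg dfg fg0 x /andP[x0 x1].
have D (y : R) : is_derive y (1:R) (g - f) (dg y - df y) by apply: is_deriveB.
have C : {within `[(0 : R), x], continuous (g - f)}.
  apply: continuous_subspaceT => t.
  by apply: differentiable_continuous; apply/derivable1_diffP; have [] := D t.
have [c] := MVT_segment x0 (fun t _ => D t) C.
rewrite in_itv /= => /andP[c0 cx] E.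
have : 0 <= (g - f) x - (g - f) 0.
  rewrite E subr0 mulr_ge0 // subr_ge0 dfg // c0 (le_trans cx) //.
rewrite /GRing.add /= -/(GRing.add _ _) /GRing.opp /=; move: fg0.
change (f 0 <= g 0 -> 0 <= g x - f x - (g 0 - f 0) -> f x <= g x); lra.
Qed.

Lemma is_derive_Xdivfact (k : nat) (x : R) :
  is_derive x (1:R) (fun y : R => y ^+ k.+1 / k.+1`!%:R) (x ^+ k / k`!%:R).
Proof.
have -> : (fun y : R => y ^+ k.+1 / k.+1`!%:R) = (k.+1`!%:R^-1) \*: ((@id R) ^+ k.+1).
  by apply/funext => y; rewrite exprfctE /= mulrC.
have D := is_deriveZ (k.+1`!%:R^-1 : R) (is_deriveX k.+1 (is_derive_id x (1:R))).
apply: (is_derive_eq D); rewrite /GRing.scale /= mulr1 factS natrM.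
have k0 : k`!%:R != 0 :> R by rewrite pnatr_eq0 -lt0n fact_gt0.
have k1 : k.+1%:R != 0 :> R by rewrite pnatr_eq0.
by field; rewrite k0 addrC natr1 k1.
Qed.

(** Induction on the order, integrating the bound for the derivative; [U m] plays
    the role of the derivative of order [m] of [U 0]. *)
Lemma taylor_line (U : nat -> R -> R) (L : nat) (K : R) :
  (forall m (t : R), is_derive t (1:R) (U m) (U m.+1 t)) ->
  (forall t : R, 0 <= t <= 1 -> `|U L t| <= K) ->
  forall t : R, 0 <= t <= 1 ->
  `|U 0 t - \sum_(m < L) U m 0 * t ^+ m / m`!%:R| <= K * (t ^+ L / L`!%:R).
Proof.
elim: L U => [|L IH] U HU HK t t01.
  by rewrite big_ord0 subr0 expr0 fact0 divr1 mulr1; exact: HK.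
set P := fun t : R => \sum_(m < L.+1) U m 0 * t ^+ m / m`!%:R.
set dP := fun t : R => \sum_(m < L) U m.+1 0 * t ^+ m / m`!%:R.
have DP (x : R) : is_derive x (1:R) P (dP x).
  have -> : P = cst (U 0 0) +
     \sum_(m < L) ((U m.+1 0) \*: (fun y : R => y ^+ m.+1 / m.+1`!%:R)).
    apply/funext => y; rewrite /P big_ord_recl /= expr0 fact0 divr1 mulr1.
    rewrite -[RHS]/(U 0 0 + (\sum_(m < L) ((U m.+1 0) \*: (fun y : R => y ^+ m.+1 / m.+1`!%:R))) y).
    rewrite fct_sumE; congr (_ + _); apply: eq_bigr => i _.
    by rewrite /= /GRing.scale /= mulrA.
  have -> : dP x = 0 + \sum_(m < L) (U m.+1 0) *: (x ^+ m / m`!%:R).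
    by rewrite add0r; apply: eq_bigr => i _; rewrite /GRing.scale /= mulrA.
  apply: is_deriveD; apply: is_derive_sum => i; apply: is_deriveZ.
  exact: is_derive_Xdivfact.
have IHt x (x01 : 0 <= x <= 1) := IH (fun m => U m.+1) (fun m => HU m.+1) HK x x01.
have DK (x : R) : is_derive x (1:R) (fun y => K * (y ^+ L.+1 / L.+1`!%:R)) (K * (x ^+ L / L`!%:R)).
  have := is_deriveZ K (is_derive_Xdivfact L x).
  by rewrite /GRing.scale /=.
rewrite ler_norml; apply/andP; split.
  apply: (@le_of_derive_le (fun y => - (K * (y ^+ L.+1 / L.+1`!%:R))) (U 0 - P)
    (fun y => - (K * (y ^+ L / L`!%:R))) (fun y => U 1%N y - dP y)) => //.
  - by move=> x /IHt; rewrite ler_norml => /andP[].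
  - rewrite -[X in _ <= X]/(U 0 0 - P 0) /P big_ord_recl big1 => [|i _].
      by rewrite expr0n /= mul0r mulr0 oppr0 fact0 divr1 mulr1 addr0 subrr.
    by rewrite exprS mul0r mulr0 mul0r.
apply: (@le_of_derive_le (U 0 - P) (fun y => (K * (y ^+ L.+1 / L.+1`!%:R)))
    (fun y => U 1%N y - dP y) (fun y => (K * (y ^+ L / L`!%:R)))) => //.
- by move=> x /IHt; rewrite ler_norml => /andP[].
- rewrite -[X in X <= _]/(U 0 0 - P 0) /P big_ord_recl big1 => [|i _].
    by rewrite [_ ^+ L.+1]expr0n expr0 /= mul0r mulr0 fact0 divr1 mulr1 addr0 subrr.
  by rewrite exprS mul0r mulr0 mul0r.
Qed.

End taylor.

(** * Iterated partial derivatives and Schwarz's theorem *)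
Section real_partials.
Context {R : realType} {V : normedModType R} {I : eqType} (e : I -> V).
Implicit Types (f g : V -> R) (x y : V) (w : seq I).

Definition rpartials (w : seq I) (f : V -> R) : V -> R :=
  foldr (fun i g x => 'D_(e i) g x) f w.

(** Each partial is required to be a genuine derivative: ['D_v f x]
    has a value even where [f] is not derivable. *)
Definition rsmooth (f : V -> R) : Prop := forall w,
  continuous (rpartials w f) /\
  forall i x, is_derive x (e i) (rpartials w f) (rpartials (i :: w) f x).

Lemma rpartials_cat w1 w2 f : rpartials (w1 ++ w2) f = rpartials w1 (rpartials w2 f).
Proof. by rewrite /rpartials foldr_cat. Qed.

Lemma rpartials_nil f : rpartials [::] f = f. Proof. by []. Qed.

Lemma rsmooth_partials w f : rsmooth f -> rsmooth (rpartials w f).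
Proof.
by move=> sf w'; have [C D] := sf (w' ++ w); split=> [|i x]; rewrite -!rpartials_cat.
Qed.

Lemma rsmooth_continuous f : rsmooth f -> continuous f.
Proof. by move=> sf; have [] := sf [::]. Qed.

(** A function is smooth as soon as a candidate for all its partials is
    exhibited; this is how smoothness is proved throughout. *)
Lemma rsmooth_jet (F : seq I -> V -> R) :
  (forall w, continuous (F w)) ->
  (forall w i x, is_derive x (e i) (F w) (F (i :: w) x)) ->
  rsmooth (F [::]) /\ forall w, rpartials w (F [::]) = F w.
Proof.
move=> cF dF.
have E w : rpartials w (F [::]) = F w.
  elim: w => //= i w ->; apply/funext => x.
  by have [_ <-] := dF w i x.
by split=> // w; rewrite E; split=> // i x; rewrite E.
Qed.

Lemma rpartials_lin (a b : R) f g : rsmooth f -> rsmooth g ->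
  rsmooth (fun x => a * f x + b * g x) /\
  forall w, rpartials w (fun x => a * f x + b * g x) =
            fun x => a * rpartials w f x + b * rpartials w g x.
Proof.
move=> sf sg.
apply: (rsmooth_jet (F := fun w x => a * rpartials w f x + b * rpartials w g x)).
  move=> w x; have [/(_ x) Cf _] := sf w; have [/(_ x) Cg _] := sg w.
  exact: continuousD (continuousM (@cst_continuous _ _ a x) Cf)
                     (continuousM (@cst_continuous _ _ b x) Cg).
move=> w i x; have [_ /(_ i x) Df] := sf w; have [_ /(_ i x) Dg] := sg w.
exact: is_deriveD (is_deriveZ a Df) (is_deriveZ b Dg).
Qed.

Lemma is_derive_shiftr f x y v (d : R) : is_derive (x + y) v f d ->
  is_derive x v (fun z => f (z + y)) d.
Proof.
move=> /is_deriveP H; apply/is_deriveP => eps /H[r r0 Hr]; exists r => // t /Hr.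
by rewrite [x + y + _]addrAC.
Qed.

(** The symmetric second difference is a mixed partial at a nearby point, by two
    applications of the mean value theorem. *)
Let second_difference f (i j : I) x (s : R) : rsmooth f ->
  exists2 z, `|z| <= `|s| * (`|e i| + `|e j|) &
   f (x + s *: e i + s *: e j) - f (x + s *: e i) - (f (x + s *: e j) - f x)
    = s ^+ 2 * rpartials [:: j; i] f (x + z).
Proof.
move=> sf; have [_ Df] := sf [::].
have Dg y : is_derive y (s *: e i) (fun z => f (z + s *: e j) - f z)
    (s * (rpartials [:: i] f (y + s *: e j) - rpartials [:: i] f y)).
  by apply: is_derive_scalev; apply: is_deriveB => //; exact: is_derive_shiftr.
have [c /andP[c0 c1] E] := mvt_line x Dg.
have [_ D2] := sf [:: i].
have [c' /andP[c'0 c'1] E'] :=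
  mvt_line (x + c *: (s *: e i)) (fun y => is_derive_scalev s (D2 j y)).
exists (c *: (s *: e i) + c' *: (s *: e j)).
  apply: le_trans (ler_normD _ _) _; rewrite mulrDr !normrZ.
  by apply: lerD; rewrite ger0_norm // ler_piMl // mulr_ge0.
by rewrite [LHS]E E' !addrA expr2 mulrA.
Qed.

Let near_of_eq (a b c c' eps : R) : c' = c ->
  `|a - c'| <= eps / 2 -> `|b - c| <= eps / 2 -> `|b - a| <= eps.
Proof.
move=> ->; rewrite !ler_norml => /andP[? ?] /andP[? ?]; apply/andP; split; lra.
Qed.

(** Schwarz's theorem: the second difference is symmetric in the two directions,
    so both mixed partials agree at nearby points, and they are continuous. *)
Lemma rpartials_swap f (i j : I) : rsmooth f ->
  rpartials [:: i; j] f = rpartials [:: j; i] f.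
Proof.
move=> sf; apply/funext => x; apply/eqP; rewrite eq_sym -subr_eq0 -normr_le0.
apply/ler_addgt0Pr => eps eps0; rewrite add0r.
have e2 : 0 < eps / 2 by rewrite divr_gt0.
have [/(_ x) /cvgrPdist_le /(_ _ e2) /nbhs_ballP[r /= r0 Hr] _] := sf [:: i; j].
have [/(_ x) /cvgrPdist_le /(_ _ e2) /nbhs_ballP[q /= q0 Hq] _] := sf [:: j; i].
set N := `|e i| + `|e j| + 1; have N0 : 0 < N by rewrite ltr_wpDl // addr_ge0.
set m := Num.min r q; have m0 : 0 < m by rewrite lt_min r0 q0.
set s := m / N / 2.
have s0 : 0 < s by rewrite !divr_gt0.
have sm : `|s| * (`|e i| + `|e j|) < m.
  have : s * N = m / 2 by rewrite /s; field; rewrite gt_eqF.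
  rewrite gtr0_norm // /N mulrDr; lra.
have [z zs E] := second_difference i j x s sf.
have [z' zs' E'] := second_difference j i x s sf.
have {E'} E' : rpartials [:: i; j] f (x + z') = rpartials [:: j; i] f (x + z).
  apply: (mulfI (x := s ^+ 2)); first by rewrite expf_neq0 // gt_eqF.
  apply: (etrans (esym E') (etrans _ E)).
  rewrite [x + s *: e j + _]addrAC !opprB; ring.
have H1 : `|rpartials [:: i; j] f x - rpartials [:: i; j] f (x + z')| <= eps / 2.
  apply: Hr; rewrite -ball_normE /= opprD addrA subrr sub0r normrN.
  apply: le_lt_trans zs' _; rewrite addrC; apply: lt_le_trans sm _.
  by rewrite /m ge_min lexx.
have H2 : `|rpartials [:: j; i] f x - rpartials [:: j; i] f (x + z)| <= eps / 2.
  apply: Hq; rewrite -ball_normE /= opprD addrA subrr sub0r normrN.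
  apply: le_lt_trans zs _; apply: lt_le_trans sm _.
  by rewrite /m ge_min lexx orbT.
exact: near_of_eq E' H1 H2.
Qed.

Lemma rpartials_perm f w w' : rsmooth f -> perm_eq w w' ->
  rpartials w f = rpartials w' f.
Proof.
move=> sf.
have mid w1 i w2 : rpartials (w1 ++ i :: w2) f = rpartials (i :: w1 ++ w2) f.
  elim: w1 => // j w1 IH; rewrite cat_cons.
  rewrite -[LHS]/(rpartials [:: j] (rpartials (w1 ++ i :: w2) f)) IH.
  exact: (@rpartials_swap _ j i (rsmooth_partials (w1 ++ w2) sf)).
elim: w w' => [|i w IH] w' pw.
  by have /perm_nilP -> : perm_eq w' [::] by rewrite perm_sym.
have iw' : i \in w' by rewrite -(perm_mem pw) mem_head.
case/splitPr: iw' pw => w1 w2; rewrite -cat1s.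
rewrite (perm_sym _ (w1 ++ _)) -[i :: w2]cat1s perm_catCA perm_cat2l perm_sym => /IH E.
by rewrite mid -[LHS]/(rpartials [:: i] (rpartials w f)) E.
Qed.

Lemma rsmooth_is_derive f i x : rsmooth f -> is_derive x (e i) f (rpartials [:: i] f x).
Proof. by move=> sf; have [_] := sf [::]. Qed.

Lemma rpartials_consE i w f x : rpartials (i :: w) f x = 'D_(e i) (rpartials w f) x.
Proof. by []. Qed.

Lemma rpartials_rcons w i f : rpartials w (rpartials [:: i] f) = rpartials (rcons w i) f.
Proof. by rewrite -rpartials_cat cats1. Qed.

Lemma rpartials_cons w i f : rpartials [:: i] (rpartials w f) = rpartials (i :: w) f.
Proof. by rewrite -rpartials_cat. Qed.

End real_partials.
Opaque rpartials.

Arguments rpartials : simpl never.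

(** * Words, multi-indices and functions of several variables *)
Section word_of_multiindex.
Context {n : nat}.

Lemma count_mword (a : 'I_n -> nat) i : count_mem i (mword a) = a i.
Proof.
rewrite /mword count_flatten -map_comp sumnE big_map big_enum /= (bigD1 i) //=.
rewrite count_nseq /= eqxx mul1n big1 ?addn0 // => j ji.
by rewrite count_nseq /= (negbTE ji).
Qed.

(** By Schwarz's theorem, words and multi-indices carry the same information;
    words are more convenient for induction. *)
Lemma perm_mword (w : seq 'I_n) : perm_eq w (mword (fun i => count_mem i w)).
Proof. by apply/allP => i _ /=; rewrite count_mword. Qed.

Lemma mabs_count (w : seq 'I_n) : mabs (fun i => count_mem i w) = size w.
Proof.
rewrite /mabs; elim: w => [|j w IH]; first by rewrite big1.
rewrite /= -add1n -IH -[X in (X + _)%N](_ : (\sum_i (j == i))%N = 1%N) ?big_split //.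
by rewrite (bigD1 j) //= eqxx big1 // => i; rewrite eq_sym => /negbTE ->.
Qed.

Lemma size_mword (a : 'I_n -> nat) : size (mword a) = mabs a.
Proof.
rewrite /mword size_flatten /shape -map_comp sumnE big_map big_enum /=.
by apply: eq_bigr => i _; rewrite size_nseq.
Qed.

End word_of_multiindex.

Section row_calculus.
Context {R : realType} {n : nat}.
Implicit Types (f g : 'rV[R]_n -> R) (x v : 'rV[R]_n) (w : seq 'I_n).

Definition unitv (i : 'I_n) : 'rV[R]_n := delta_mx ord0 i.

Definition word_pow (w : seq 'I_n) (x : 'rV[R]_n) : R := \prod_(i <- w) x ord0 i.

Notation "'d_ w f" := (rpartials unitv w f) (at level 10, w at level 8, f at level 9).

Lemma row_normE x : `|x| = \big[Num.max/0]_ij `|x ij.1 ij.2|.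
Proof. by rewrite -mx_normrE. Qed.

Lemma norm_coord x i : `|x ord0 i| <= `|x|.
Proof.
rewrite row_normE.
exact: (@le_bigmax _ _ _ _ (fun ij : 'I_1 * 'I_n => `|x ij.1 ij.2|) (ord0, i)).
Qed.

Lemma row_norm_le x K : 0 <= K -> (forall i, `|x ord0 i| <= K) -> `|x| <= K.
Proof.
by move=> K0 H; rewrite row_normE; apply: bigmax_le => //= -[k j] _ /=; rewrite (ord1 k).
Qed.

Lemma row_norm_attained x : `|x| = 0 \/ exists i, `|x| = `|x ord0 i|.
Proof.
have [x0|x0] := eqVneq (mx_norm x) 0; first by left.
by right; have [[k i] /= E] := mx_norm_neq0 x0; exists i; rewrite (ord1 k) in E.
Qed.

Lemma norm_unitv i : `|unitv i| <= 1.
Proof.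
apply: row_norm_le => // j; rewrite mxE.
by case: (_ && _); rewrite ?normr1 ?normr0.
Qed.

Lemma word_pow_le w x : `|word_pow w x| <= `|x| ^+ size w.
Proof.
rewrite /word_pow; elim: w => [|i w IH]; first by rewrite big_nil normr1.
by rewrite big_cons normrM exprS; apply: ler_pM => //; exact: norm_coord.
Qed.

(** The chain rule along a line, the directions being added one by one. *)
Lemma is_derive_row f x v : rsmooth unitv f ->
  is_derive x v f (\sum_i v ord0 i * 'd_[:: i] f x).
Proof.
move=> sf.
suff H s : is_derive x (\sum_(i <- s) v ord0 i *: unitv i) f
    (\sum_(i <- s) v ord0 i * 'd_[:: i] f x).
  by have := H (index_enum 'I_n); rewrite -(row_sum_delta v).
elim: s => [|i s IH]; first by rewrite !big_nil; exact: is_derive0.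
rewrite !big_cons addrC [X in is_derive _ _ _ X]addrC.
have D y := is_derive_scalev (v ord0 i) (rsmooth_is_derive i y sf).
have [C _] := sf [:: i].
exact: (is_derive_addv IH D (continuousM (@cst_continuous _ _ (v ord0 i) x) (C x))).
Qed.

Lemma lipschitz_row f x v K : rsmooth unitv f ->
  (forall i y, `|'d_[:: i] f y| <= K) -> `|f (x + v) - f x| <= n%:R * K * `|v|.
Proof.
move=> sf HK; have [c _ ->] := mvt_line x (fun y => is_derive_row y v sf).
apply: le_trans (ler_norm_sum _ _ _) _.
have -> : n%:R * K * `|v| = \sum_(i < n) `|v| * K.
  by rewrite sumr_const card_ord -mulr_natl; ring.
by apply: ler_sum => i _; rewrite normrM; apply: ler_pM => //; exact: norm_coord.
Qed.

(** The directional derivative of order [m] along [v], as a polynomial in [v]: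
    this form makes the Taylor polynomial visibly a polynomial in the increment. *)
Fixpoint dirn (m : nat) (f : 'rV[R]_n -> R) (v x : 'rV[R]_n) : R :=
  if m is k.+1 then \sum_i v ord0 i * dirn k ('d_[:: i] f) v x else f x.

Lemma is_derive_dirn m f x v : rsmooth unitv f ->
  is_derive x v (dirn m f v) (dirn m.+1 f v x).
Proof.
elim: m f => [|m IH] f sf; first exact: is_derive_row.
rewrite [dirn m.+1 f v](_ : _ = \sum_i ((v ord0 i) \*: dirn m ('d_[:: i] f) v)).
  rewrite [X in is_derive _ _ _ X](_ : _ = \sum_i v ord0 i *: dirn m.+1 ('d_[:: i] f) v x) //.
  by apply: is_derive_sum => i; apply: is_deriveZ; apply: IH; exact: rsmooth_partials.
by apply/funext => y; rewrite fct_sumE.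
Qed.

Lemma dirn_le m f x v K : (forall w, size w = m -> `|'d_w f x| <= K) ->
  `|dirn m f v x| <= n%:R ^+ m * `|v| ^+ m * K.
Proof.
elim: m f => [|m IH] f H; first by rewrite !expr0 !mul1r; have := H [::] erefl; rewrite rpartials_nil.
rewrite /=; apply: le_trans (ler_norm_sum _ _ _) _.
have -> : n%:R ^+ m.+1 * `|v| ^+ m.+1 * K = \sum_(i < n) `|v| * (n%:R ^+ m * `|v| ^+ m * K).
  by rewrite sumr_const card_ord !exprS -mulr_natl; ring.
apply: ler_sum => i _; rewrite normrM; apply: ler_pM => //; first exact: norm_coord.
by apply: IH => w sw; rewrite rpartials_rcons; apply: H; rewrite size_rcons sw.
Qed.

Lemma taylor_row L f x v K : rsmooth unitv f ->
  (forall w y, size w = L -> `|'d_w f y| <= K) ->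
  `|f (x + v) - \sum_(m < L) dirn m f v x / m`!%:R|
    <= n%:R ^+ L * `|v| ^+ L * K / L`!%:R.
Proof.
move=> sf HK.
have D m (t : R) : is_derive t (1:R) (fun s : R => dirn m f v (x + s *: v)) (dirn m.+1 f v (x + t *: v)).
  by apply: is_derive_line; exact: is_derive_dirn.
have B (t : R) : 0 <= t <= 1 -> `|dirn L f v (x + t *: v)| <= n%:R ^+ L * `|v| ^+ L * K.
  by move=> _; apply: dirn_le => w /HK.
have := taylor_line D B (t := 1); rewrite ler01 lexx => /(_ isT).
rewrite expr1n mul1r scale1r.
rewrite (eq_bigr (fun m : 'I_L => dirn m f v x / m`!%:R)) // => m _.
by rewrite scale0r addr0 expr1n mulr1.
Qed.

End row_calculus.
Notation "'d_ w f" := (rpartials unitv w f) (at level 10, w at level 8, f at level 9).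

Local Notation row_smooth f := (rsmooth unitv f).

(** * Lebesgue measure under dilations and translations *)
Section lebesgue_tuple_affine.
Context {R : realType}.
Notation RT := (measurableTypeR R).
Notation leb := (lebesgue_tuple R).

Definition affine1 (b a : R) (x : RT) : RT := b + a * x.

Definition affine_tuple n (b : 'I_n -> R) (a : R) (t : n.-tuple RT) : n.-tuple RT :=
  [tuple affine1 (b i) a (tnth t i) | i < n].

Lemma measurable_affine1 (b a : R) : measurable_fun [set: RT] (affine1 b a).
Proof.
apply: measurable_funD => //; apply: measurable_funM => //.
Qed.

Lemma measurable_affine_tuple n (b : 'I_n -> R) (a : R) :
  measurable_fun [set: n.-tuple RT] (affine_tuple b a).
Proof.
apply/measurable_fun_tnthP => i.
rewrite (_ : _ \o _ = affine1 (b i) a \o (@tnth _ _ ^~ i)).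
  apply: measurableT_comp; first exact: measurable_affine1.
  exact: measurable_tnth.
by apply/funext => t /=; rewrite tnth_mktuple.
Qed.

(** Lebesgue measure is determined by its values on intervals. *)
Lemma lebesgue_affine1 (b a : R) (a0 : 0 < a) (A : set RT) : measurable A ->
  lebesgue_measure A = (a%:E * lebesgue_measure (affine1 b a @^-1` A))%E.
Proof.
move=> mA.
have a0' : 0 <= a by exact: ltW.
pose mu : {measure set RT -> \bar R} := mscale (NngNum a0')
  (measure_function_pushforward__canonical__measure_function_Measure lebesgue_measure (measurable_affine1 b a)).
have -> : (a%:E * lebesgue_measure (affine1 b a @^-1` A))%E = mu A by [].
apply: lebesgue_measure_unique => //=.
move=> _ [[x y]] _ <-.
rewrite /mu /mscale /pushforward /=.
rewrite [X in (_ * lebesgue_measure X)%E](_ : _ = [set` `](x - b) / a, (y - b) / a]]); last first.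
  apply/seteqP; split=> z /=; rewrite !in_itv /= /affine1 ltr_pdivrMr // ler_pdivlMr //;
  by rewrite ltrBlDl lerBrDl mulrC.
rewrite !lebesgue_measure_itv /= !lte_fin ltr_pM2r ?invr_gt0 // ltrD2r.
case: ifPn => _; last by rewrite mule0.
by rewrite -!EFinB -EFinM -mulrBl mulrC divfK ?gt_eqF //; congr (_%:E); lra.
Qed.

(** Induction on the dimension, a product measure being determined by its values
    on rectangles. *)
Lemma lebesgue_tuple_affine n (b : 'I_n -> R) (a : R) (a0 : 0 < a) (A : set (n.-tuple RT)) :
  measurable A ->
  leb n A = ((a ^+ n)%:E * leb n (affine_tuple b a @^-1` A))%E.
Proof.
elim: n b A => [|n IH] b A mA.
  rewrite expr0 mul1e /= !diracE; congr ((_ : bool)%:R%:E).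
  apply/idP/idP; rewrite !inE /=; by rewrite (tuple0 (affine_tuple _ _ _)).
pose b' (i : 'I_n) := b (lift ord0 i).
pose T (p : RT * n.-tuple RT) := (affine1 (b ord0) a p.1, affine_tuple b' a p.2).
have mT : measurable_fun setT T.
  apply/measurable_fun_pairP; split.
    apply: (measurableT_comp (f := affine1 (b ord0) a) (g := fst)) => //.
    exact: measurable_affine1.
  apply: (measurableT_comp (f := affine_tuple b' a) (g := snd)) => //.
  exact: measurable_affine_tuple.
have TE p : affine_tuple b a (tcons p) = tcons (T p).
  apply/eq_from_tnth => i; rewrite tnth_mktuple.
  have [j ->|->] := unliftP ord0 i; rewrite /tcons /=.
    by rewrite !tnthS tnth_mktuple.
  by rewrite !tnth0.
have mB : measurable (@tcons R n @^-1` A).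
  by rewrite -[X in measurable X]setTI; exact: measurable_tcons.
have an0 : 0 <= a ^+ n.+1 by rewrite exprn_ge0 // ltW.
pose m' : {measure set (RT * n.-tuple RT) -> \bar R} := mscale (NngNum an0)
  (measure_function_pushforward__canonical__measure_function_Measure
     (lebesgue_measure \x leb n)%E mT).
rewrite /= /lebesgue_cons /pushforward.
rewrite (product_measure_unique (m' := m')) //; last first.
  move=> X Y mX mY; rewrite /m' /mscale /pushforward /=.
  transitivity ((a ^+ n.+1)%:E * (lebesgue_measure \x leb n)
    ((affine1 (b ord0) a @^-1` X) `*` (affine_tuple b' a @^-1` Y)))%E => //.
  rewrite product_measure1E //; last first.
  - by rewrite -[X in measurable X]setTI; exact: measurable_affine_tuple.
  - by rewrite -[X in measurable X]setTI; exact: measurable_affine1.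
  rewrite (lebesgue_affine1 (b ord0) a0 mX) exprS EFinM muleACA.
  by congr (_ * _)%E; apply/esym; exact: IH.
rewrite /m' /mscale /pushforward /=; congr (_ * _)%E.
apply: (congr1 (lebesgue_measure \x leb n)%E); apply/seteqP; split=> p /=; by rewrite TE.
Qed.

End lebesgue_tuple_affine.

(** * Integration over row vectors *)
Section row_measurability.
Context {R : realType} {n : nat}.
Notation RT := (measurableTypeR R).

Definition to_row (t : n.-tuple RT) : 'rV[R]_n := \row_i tnth t i.

Lemma measurable_row_ball (x : 'rV[R]_n) (r : R) : 0 < r ->
  measurable (to_row @^-1` ball x r).
Proof.
move=> r0.
rewrite (_ : _ @^-1` _ = \bigcap_(i in [set: 'I_n])
   ((fun t : n.-tuple RT => tnth t i) @^-1` ball (x ord0 i) r)).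
  apply: fin_bigcap_measurable => // i _.
  rewrite -[X in measurable X]setTI; apply: measurable_tnth => //.
  exact: measurable_ball.
apply/seteqP; split=> [t [_ H] i _|t H]; first by have := H ord0 i; rewrite mxE.
split=> // i j; rewrite (ord1 i) mxE; exact: H.
Qed.

(** An open set is the countable union of the balls of rational centre and radius
    [1 / (k + 1)] that it contains; tuples carry the product sigma-algebra, for
    which balls of the sup norm are rectangles. *)
Lemma measurable_row_open (O : set 'rV[R]_n) : open O -> measurable (to_row @^-1` O).
Proof.
move=> oO.
pose F (p : 'rV[rat]_n * nat) : set (n.-tuple RT) :=
  if `[< ball (map_mx (@ratr R) p.1 : 'rV[R]_n) (p.2.+1%:R^-1 : R) `<=` O >]
  then to_row @^-1` ball (map_mx (@ratr R) p.1 : 'rV[R]_n) p.2.+1%:R^-1 else set0.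
rewrite (_ : _ @^-1` _ = \bigcup_p F p).
  apply: countable_bigcupT_measurable => [|p]; first exact: countableP.
  rewrite /F; case: ifPn => // _.
  by apply: measurable_row_ball; rewrite invr_gt0.
apply/seteqP; split=> [t Ot|t [[q k] _]]; last first.
  by rewrite /F; case: ifPn => //= /asboolP; apply.
have /nbhs_ballP[e /= e0 eO] := open_nbhs_nbhs (conj oO Ot : open_nbhs (to_row t) O).
have [k ke] : exists k, k.+1%:R^-1 < e / 2 :> R.
  have e2 : 0 < e / 2 by rewrite divr_gt0.
  have [k _ /(_ k (leqnn k)) ke] := near_infty_natSinv_lt (PosNum e2).
  by exists k.
have K0 : 0 < k.+1%:R^-1 :> R by rewrite invr_gt0.
have Q (x : R) : exists q : rat, `|ratr q - x| < k.+1%:R^-1.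
  move: (k.+1%:R^-1 : R) K0 => K K0.
  have /rat_in_itvoo[q] : x - K < x + K by lra.
  rewrite in_itv /= => /andP[q1 q2]; exists q; rewrite ltr_norml; apply/andP; split; lra.
pose q : 'rV[rat]_n := \row_i projT1 (cid (Q (tnth t i))).
have qE i : `|ratr (q ord0 i) - tnth t i| < k.+1%:R^-1.
  by rewrite mxE; exact: (projT2 (cid (Q (tnth t i)))).
clearbody q; exists (q, k); rewrite /F //=; case: ifPn => [_|/asboolPn[]] /=.
  by split=> // i j; rewrite (ord1 i) /ball /= !mxE; exact: qE.
move=> y [_ yq]; apply: eO; split=> // i j; rewrite (ord1 i) mxE.
have := yq ord0 j; have := qE j; rewrite /ball /= mxE.
move: (ratr _) (tnth t j : R) (y ord0 j) (k.+1%:R^-1 : R) ke => a b c K ke H1 H2.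
have -> : b - c = - (a - b) + (a - c) by lra.
apply: le_lt_trans (ler_normD _ _) _; rewrite normrN; lra.
Qed.

Lemma measurable_row (f : 'rV[R]_n -> R) : continuous f ->
  measurable_fun [set: n.-tuple RT] (f \o to_row).
Proof.
move=> /continuousP cf; apply: (measurability _ (RGenOInfty.measurableE R)) => //.
move=> /= _ [_ [a ->] <-]; rewrite setTI comp_preimage.
apply: measurable_row_open; apply: cf; exact: interval_open.
Qed.

End row_measurability.

Lemma integral_mscaleE d (T : measurableType d) (R : realType)
    (m : {measure set T -> \bar R}) (k : {nonneg R}) (f : T -> \bar R) :
  m.-integrable setT f -> (mscale k m).-integrable setT f /\
  (\int[mscale k m]_x f x = k%:num%:E * \int[m]_x f x)%E.
Proof.
move=> fi; have /integrableP[mf fo] := fi; split.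
  apply/integrableP; split=> //.
  rewrite (ge0_integral_mscale _ measurableT) //; last exact: measurableT_comp.
  exact: lte_mul_pinfty.
rewrite [LHS]integralE [X in _ = (_ * X)%E]integralE.
rewrite (ge0_integral_mscale m measurableT k (measurable_funepos mf)) //.
rewrite (ge0_integral_mscale m measurableT k (measurable_funeneg mf)) //.
rewrite [RHS]muleBr //; apply: fin_num_adde_defl.
by rewrite fin_numN; exact: integrable_neg_fin_num.
Qed.

Section integration.
Context {R : realType}.
Notation RT := (measurableTypeR R).
Notation leb := (lebesgue_tuple R).

Lemma continuous_coord n (i : 'I_n) : continuous (fun x : 'rV[R]_n => x ord0 i).
Proof. exact: coord_continuous. Qed.

Lemma continuous_prod n (I : Type) (s : seq I) (F : I -> 'rV[R]_n -> R) :
  (forall i, continuous (F i)) -> continuous (fun x => \prod_(i <- s) F i x).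
Proof.
move=> cF; elim: s => [|i s IH] x.
  under eq_fun do rewrite big_nil; exact: cst_continuous.
under eq_fun do rewrite big_cons.
exact: continuousM (cF i x) (IH x).
Qed.

(** The integrable envelope against which rapidly decreasing functions are
    compared: a product of Cauchy densities, so that Tonelli reduces its
    integrability to dimension one. *)
Definition envelope n (x : 'rV[R]_n) : R := \prod_i (oneDsqr (x ord0 i))^-1.

Lemma envelope_gt0 n (x : 'rV[R]_n) : 0 < envelope x.
Proof. by apply: prodr_gt0 => i _; rewrite invr_gt0 (lt_le_trans ltr01). Qed.

Lemma continuous_envelope n : continuous (@envelope n).
Proof.
apply: continuous_prod => i x.
by apply: (@continuous_comp _ _ _ (fun x : 'rV[R]_n => x ord0 i) (fun y : R => (oneDsqr y)^-1));
  [exact: continuous_coord | exact: continuous_oneDsqrV].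
Qed.

Lemma integral_oneDsqrV_lty :
  (\int[lebesgue_measure]_(x in [set: RT]) (oneDsqr x)^-1%:E < +oo)%E.
Proof.
have := @ge0_symfun_integralT R (fun x => (oneDsqr x)^-1).
move=> ->.
- rewrite (_ : [set x | _] = `[0%R, +oo[%classic).
    by rewrite integral0y_oneDsqr -EFinM ltry.
  by apply/seteqP; split=> x /=; rewrite in_itv /= andbT.
- by move=> x; rewrite invr_ge0 (le_trans ler01).
- exact: continuous_oneDsqrV.
- by move=> x; rewrite /= /oneDsqr sqrrN.
Qed.

Lemma integral_envelope_lty n :
  (\int[leb n]_x (envelope (to_row x))%:E < +oo)%E.
Proof.
elim: n => [|n IH].
  rewrite (eq_integral (cst 1%E)); first by rewrite integral_cst //= mul1e diracT ltry.
  by move=> x _; rewrite /envelope big_ord0.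
have mw m : measurable_fun [set: m.-tuple RT] (fun x => (envelope (to_row x))%:E).
  apply/measurable_EFinP; exact: (measurable_row (@continuous_envelope m)).
have e0 m (x : 'rV[R]_m) : (0 <= (envelope x)%:E)%E by rewrite lee_fin ltW // envelope_gt0.
rewrite (@eq_measure_integral _ _ _ _
  (measure_function_pushforward__canonical__measure_function_Measure
     (lebesgue_measure \x leb n)%E (@measurable_tcons R n))) //.
rewrite (ge0_integral_pushforward (@measurable_tcons R n) _ measurableT (mw n.+1)) //.
rewrite preimage_setT.
have mc : measurable_fun setT ((fun x => (envelope (to_row x))%:E) \o @tcons R n).
  exact: (measurableT_comp (mw n.+1) (@measurable_tcons R n)).
rewrite fubini_tonelli1 //= /fubini_F /=.
have E (x : RT) (y : n.-tuple RT) : (envelope (to_row (tcons (x, y))))%:E =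
   ((oneDsqr x)^-1%:E * (envelope (to_row y))%:E)%E.
  rewrite -EFinM /envelope big_ord_recl mxE /tcons /= tnth0; congr (_ * _)%:E.
  by apply: eq_bigr => i _; rewrite !mxE tnthS.
under eq_integral => x _.
  under eq_integral do rewrite E.
  rewrite (ge0_integralZl _ measurableT (mw n)) //.
  over.
have mo : measurable_fun [set: RT] (fun x => ((oneDsqr x)^-1)%:E).
  apply/measurable_EFinP; apply: continuous_measurable_fun; exact: continuous_oneDsqrV.
have o0 (x : RT) : (0 <= ((oneDsqr x)^-1)%:E)%E by rewrite lee_fin invr_ge0 (le_trans ler01).
rewrite (ge0_integralZr _ measurableT mo) //; last exact: integral_ge0.
apply: lte_mul_pinfty => //; first by apply: integral_ge0.
by rewrite ge0_fin_numE; [exact: integral_oneDsqrV_lty|apply: integral_ge0].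
Qed.

Section row_integral.
Context {n : nat}.
Implicit Types f g : 'rV[R]_n -> R.

Definition rvint f : R := (\int[leb n]_t f (to_row t))%R.
Definition rvintegrable f : Prop := (leb n).-integrable setT (EFin \o (f \o @to_row R n)).

Lemma rvint_cst0 : rvint (fun=> 0) = 0.
Proof. by rewrite /rvint Rintegral_cst // mul0r. Qed.

Lemma rvintZ (a : R) f : rvintegrable f ->
  rvintegrable (fun x => a * f x) /\ rvint (fun x => a * f x) = a * rvint f.
Proof.
move=> fi; split; last by rewrite /rvint RintegralZl.
exact: (integrableZl measurableT a fi).
Qed.

Lemma rvintD f g : rvintegrable f -> rvintegrable g ->
  rvintegrable (fun x => f x + g x) /\ rvint (fun x => f x + g x) = rvint f + rvint g.
Proof.
move=> fi gi; split; last by rewrite /rvint RintegralD.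
exact: (integrableD measurableT fi gi).
Qed.

Lemma rvint0 : rvintegrable (fun=> 0).
Proof. exact: integrable0. Qed.

Lemma rvint_sum (I : Type) (s : seq I) (F : I -> 'rV[R]_n -> R) :
  (forall i, rvintegrable (F i)) ->
  rvintegrable (fun x => \sum_(i <- s) F i x) /\
  rvint (fun x => \sum_(i <- s) F i x) = \sum_(i <- s) rvint (F i).
Proof.
move=> Fi; elim: s => [|i s [IH1 IH2]].
  rewrite (_ : (fun x => _) = fun=> 0); last by apply/funext => x; rewrite big_nil.
  by rewrite big_nil rvint_cst0; split=> //; exact: rvint0.
rewrite (_ : (fun x => _) = fun x => F i x + \sum_(j <- s) F j x); last first.
  by apply/funext => x; rewrite big_cons.
by have [? ->] := rvintD (Fi i) IH1; rewrite big_cons IH2.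
Qed.

Lemma rvint_norm_le f g : rvintegrable f -> rvintegrable g ->
  (forall x, `|f x| <= g x) -> `|rvint f| <= rvint g.
Proof.
move=> fi gi fg; apply: le_trans (le_normr_Rintegral measurableT fi) _.
apply: le_Rintegral => //; last by move=> t _; exact: fg.
exact: (integrable_abse fi).
Qed.

Lemma rvintegrable_envelope : rvintegrable (@envelope n).
Proof.
apply/integrableP; split.
  by apply/measurable_EFinP; exact: (measurable_row (@continuous_envelope n)).
rewrite (eq_integral (fun x => (envelope (to_row x))%:E)) ?integral_envelope_lty //.
by move=> x _ /=; rewrite ger0_norm // ltW // envelope_gt0.
Qed.

Lemma rvint_dominated f (A : R) : continuous f -> (forall x, `|f x| <= A * envelope x) ->
  rvintegrable f /\ `|rvint f| <= A * rvint (@envelope n).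
Proof.
move=> cf fA.
have [Ei <-] := rvintZ A rvintegrable_envelope.
have fi : rvintegrable f.
  apply: (le_integrable measurableT _ _ Ei).
    by apply/measurable_EFinP; exact: measurable_row.
  move=> t _ /=; rewrite lee_fin; apply: le_trans (fA _) _; exact: ler_norm.
by split=> //; exact: rvint_norm_le.
Qed.

(** The product of the [1 + x_i ^ 2] is at most [(1 + |x| ^ 2) ^ n]. *)
Lemma le_envelope (x : 'rV[R]_n) (y A : R) : 0 <= A -> `|y| <= A -> `|x| ^+ (2 * n) * `|y| <= A ->
  `|y| <= 2 ^+ n * A * envelope x.
Proof.
move=> A0 yA xyA; rewrite /envelope prodfV ler_pdivlMr; last first.
  by apply: prodr_gt0 => i _; exact: (lt_le_trans ltr01).
apply: (le_trans (y := `|y| * (1 + `|x| ^+ 2) ^+ n)).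
  apply: ler_wpM2l => //.
  rewrite -[X in _ ^+ X]card_ord -prodr_const.
  apply: ler_prod => i _; rewrite /oneDsqr addr_ge0 ?sqr_ge0 //= lerD2l.
  rewrite -real_normK ?num_real // ler_pXn2r ?nnegrE //; exact: norm_coord.
rewrite [2 ^+ n * A]mulrC.
have [x1|x1] := leP `|x| 1.
  apply: ler_pM => //.
  apply: lerXn2r; rewrite ?nnegrE ?addr_ge0 ?sqr_ge0 //.
  by rewrite (_ : 2 = 1 + 1) // lerD2l exprn_ile1.
apply: (le_trans (y := `|y| * (2 ^+ n * `|x| ^+ (2 * n)))).
  apply: ler_wpM2l => //; rewrite exprM -exprMn.
  apply: lerXn2r; rewrite ?nnegrE ?addr_ge0 ?mulr_ge0 ?sqr_ge0 //.
  have : 1 <= `|x| ^+ 2 by rewrite exprn_ege1 // ltW.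
  lra.
have -> : `|y| * (2 ^+ n * `|x| ^+ (2 * n)) = 2 ^+ n * (`|x| ^+ (2 * n) * `|y|) by ring.
by rewrite [leRHS]mulrC; apply: ler_wpM2l => //; rewrite exprn_ge0.
Qed.

(** Change of variables: the measure is [a ^ n] times its own image under the
    affine map. *)
Lemma integral_row_affine f (b : 'rV[R]_n) (a : R) : 0 < a -> continuous f ->
  rvintegrable (fun x => f (b + a *: x)) ->
  rvintegrable f /\ rvint f = a ^+ n * rvint (fun x => f (b + a *: x)).
Proof.
move=> a0 cf fi.
have an0 : 0 <= a ^+ n by rewrite exprn_ge0 // ltW.
pose T := affine_tuple (fun i => b ord0 i) a.
have TE t : to_row (T t) = b + a *: to_row t.
  by apply/rowP => i; rewrite !mxE tnth_mktuple.
have mT : measurable_fun setT T := measurable_affine_tuple _ _.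
pose m : {measure set (n.-tuple RT) -> \bar R} :=
  measure_function_pushforward__canonical__measure_function_Measure (leb n) mT.
have E A : measurable A -> A `<=` setT -> leb n A = mscale (NngNum an0) m A.
  by move=> mA _; exact: (lebesgue_tuple_affine _ a0 mA).
have fmi : m.-integrable setT (EFin \o (f \o @to_row R n)).
  apply: integrable_pushforward => //.
    by apply/measurable_EFinP; exact: measurable_row.
  rewrite preimage_setT; apply: (eq_integrable measurableT _ _ _ fi) => // t _ /=.
  by rewrite TE.
have [si sE] := integral_mscaleE (NngNum an0) fmi.
have E2 (g : n.-tuple RT -> \bar R) : (\int[leb n]_x g x = \int[mscale (NngNum an0) m]_x g x)%E.
  by apply: eq_measure_integral => A mA _; exact: E.
have fint : rvintegrable f.
  move: si => /integrableP[mf fo]; apply/integrableP; split=> //.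
  by rewrite E2.
split=> //; rewrite /rvint /Rintegral E2 sE.
rewrite integral_pushforward //; last first.
- by rewrite preimage_setT; apply: (eq_integrable measurableT _ _ _ fi) => // t _ /=; rewrite TE.
- by apply/measurable_EFinP; exact: measurable_row.
rewrite preimage_setT /= fineM //; last first.
  by apply: integrable_fin_num => //; apply: (eq_integrable measurableT _ _ _ fi) => // t _ /=; rewrite TE.
congr (_ * fine _); apply: eq_integral => t _ /=; by rewrite TE.
Qed.

End row_integral.

End integration.

(** * Powers of factorials up to geometric factors *)
Section factorial_powers.
Context {R : realType}.
Implicit Types (s t : R) (m p q : nat).

Definition fpow m s : R := m`!%:R `^ s.

Let fact_ge1 m : 1 <= m`!%:R :> R. Proof. by rewrite ler1n fact_gt0. Qed.
Let fact_gt0 m : 0 < m`!%:R :> R. Proof. by rewrite ltr0n fact_gt0. Qed.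

Let fact_ge0 m : 0 <= m`!%:R :> R. Proof. exact: ltW. Qed.

Lemma fpow_ge0 m s : 0 <= fpow m s. Proof. exact: powR_ge0. Qed.

Lemma fpow0 s : fpow 0 s = 1. Proof. by rewrite /fpow fact0 powR1. Qed.

Lemma fpow_exp m s t : s <= t -> fpow m s <= fpow m t.
Proof. by move=> st; apply: ler_powR. Qed.

Lemma fpow_expD m s t : fpow m (s + t) = fpow m s * fpow m t.
Proof. by rewrite /fpow powRD //; apply/implyP => _; rewrite gt_eqF. Qed.

Lemma fpow_mono m q s : 0 <= s -> (m <= q)%N -> fpow m s <= fpow q s.
Proof.
move=> s0 mq; apply: ge0_ler_powR => //; rewrite ?nnegrE //.
by rewrite ler_nat leq_fact.
Qed.

Lemma fpow_ge1 m s : 0 <= s -> 1 <= fpow m s.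
Proof. by move=> s0; rewrite -(fpow0 s); exact: fpow_mono. Qed.

Let fact_mul_le p q : (p`! * q`! <= (p + q)`!)%N.
Proof.
rewrite -(bin_fact (leq_addr q p)) addKn; apply: leq_pmull.
by rewrite bin_gt0 leq_addr.
Qed.

Let fact_add_le p q : ((p + q)`! <= 2 ^ (p + q) * (p`! * q`!))%N.
Proof.
rewrite -(bin_fact (leq_addr q p)) addKn; apply: leq_mul => //.
have pP : (p < (p + q).+1)%N by rewrite ltnS leq_addr.
rewrite -[2%N]/(1 + 1)%N expnDn (bigD1 (Ordinal pP)) //=.
by rewrite !exp1n !muln1 leq_addr.
Qed.

Lemma fpow_mul_le p q s : 0 <= s -> fpow p s * fpow q s <= fpow (p + q) s.
Proof.
move=> s0; rewrite /fpow -powRM //; apply: ge0_ler_powR => //; rewrite ?nnegrE ?mulr_ge0 //.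
by rewrite -natrM ler_nat fact_mul_le.
Qed.

(** The binomial coefficient [(p + q)! / (p! q!)] lies between [1] and
    [2 ^ (p + q)]; the lower bound serves for negative [s]. *)
Lemma fpow_add_le p q s :
  fpow (p + q) s <= (2 `^ `|s|) ^+ (p + q) * (fpow p s * fpow q s).
Proof.
have [s0|s0] := leP 0 s.
  rewrite ger0_norm //.
  have -> : (2 `^ s) ^+ (p + q) = (2 ^+ (p + q)) `^ s.
    by rewrite -(powR_mulrn _ (powR_ge0 2 s)) -powRrM (mulrC s) powRrM powR_mulrn.
  rewrite /fpow -!powRM ?mulr_ge0 ?exprn_ge0 //.
  apply: ge0_ler_powR; rewrite // ?nnegrE ?mulr_ge0 ?exprn_ge0 //.
  by rewrite -natrX -!natrM ler_nat fact_add_le.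
apply: (@le_trans _ _ (fpow p s * fpow q s)).
  rewrite -[s]opprK /fpow !(powRN _ (- s)) -invfM lef_pV2 ?posrE ?mulr_gt0 ?powR_gt0 //.
  by apply: fpow_mul_le; rewrite oppr_ge0 ltW.
apply: ler_peMl; first by rewrite mulr_ge0 ?fpow_ge0.
by apply: exprn_ege1; apply: (le_trans _ (ler_powR _ (normr_ge0 s))); rewrite ?powRr0 // ler1n.
Qed.

(** This is where the exponent being at least [1] matters: a derivative of a
    monomial of degree [m + 1] is paid by one factorial step. *)
Lemma fpow_succ m s : 1 <= s -> m.+1%:R * fpow m s <= fpow m.+1 s.
Proof.
move=> s1; rewrite /fpow factS natrM powRM //.
by apply: ler_wpM2r; [exact: powR_ge0|apply: le1r_powR => //; rewrite ler1n].
Qed.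

Lemma mabs_fact_le n (b : 'I_n -> nat) : ((mabs b)`! <= (2 ^ n) ^ mabs b * mfact b)%N.
Proof.
suff H (r : seq 'I_n) : ((\sum_(i <- r) b i)`! <= (2 ^ size r) ^ (\sum_(i <- r) b i) * \prod_(i <- r) (b i)`!)%N.
  have := H (index_enum 'I_n).
  by rewrite (_ : size _ = n) // -[RHS](size_enum_ord n) enumT.
elim: r => [|i r IH]; first by rewrite !big_nil.
rewrite !big_cons /=; apply: leq_trans (fact_add_le _ _) _.
set S := (\sum_(j <- r) b j)%N in IH *; set P := (\prod_(j <- r) _)%N in IH *.
rewrite expnS expnMn -mulnA leq_mul2l; apply/orP; right.
rewrite mulnCA leq_mul2l; apply/orP; right.
apply: leq_trans IH _; rewrite leq_mul2r; apply/orP; right.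
by rewrite leq_pexp2l ?expn_gt0 ?leq_addl.
Qed.

End factorial_powers.

Section geometric_domination.
Context {R : realType} {T : Type} (N : T -> nat).
Implicit Types X Y Z : T -> R.

(** The constants of an estimate in a Gelfand-Shilov class only matter up to
    a geometric factor in the total order [N] of the estimate. *)
Definition geo (X Y : T -> R) : Prop :=
  exists c D : R, [/\ 0 <= c, 1 <= D & forall t, X t <= c * D ^+ N t * Y t].

Lemma geo_le X Y : (forall t, X t <= Y t) -> geo X Y.
Proof. by move=> XY; exists 1, 1; split=> // t; rewrite expr1n !mul1r. Qed.

Lemma geo_trans X Y Z : geo X Y -> geo Y Z -> geo X Z.
Proof.
move=> [c [D [c0 D1 H]]] [c' [D' [c'0 D'1 H']]]; exists (c * c'), (D * D').
split=> [||t]; rewrite ?mulr_ge0 //; first exact: mulr_ege1.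
apply: le_trans (H t) _; rewrite exprMn -!mulrA; apply: ler_wpM2l => //.
rewrite mulrCA; apply: ler_wpM2l; first by rewrite exprn_ge0 // (le_trans ler01).
by apply: le_trans (H' t) _; rewrite mulrA.
Qed.

Lemma geo_mul X X' Y Y' : (forall t, 0 <= X t) -> (forall t, 0 <= X' t) ->
  geo X Y -> geo X' Y' -> geo (fun t => X t * X' t) (fun t => Y t * Y' t).
Proof.
move=> X0 X'0 [c [D [c0 D1 H]]] [c' [D' [c'0 D'1 H']]]; exists (c * c'), (D * D').
split=> [||t]; rewrite ?mulr_ge0 //; first exact: mulr_ege1.
apply: le_trans (ler_pM (X0 t) (X'0 t) (H t) (H' t)) _.
by rewrite exprMn le_eqVlt; apply/orP; left; apply/eqP; ring.
Qed.

Lemma geo_exp C (m : T -> nat) (a b : nat) : (forall t, (m t <= a * N t + b)%N) ->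
  geo (fun t => C ^+ m t) (fun=> 1).
Proof.
move=> mN; set E := Num.max 1 `|C|.
have E1 : 1 <= E by rewrite le_max lexx.
exists (E ^+ b), (E ^+ a); split=> [||t]; first by rewrite exprn_ge0 // (le_trans ler01).
  by rewrite exprn_ege1.
rewrite mulr1 -exprM -exprD addnC; apply: le_trans (ler_norm _) _; rewrite normrX.
apply: (@le_trans _ _ (E ^+ m t)); last exact: ler_weXn2l.
by apply: lerXn2r; rewrite ?nnegrE // ?(le_trans ler01) // le_max lexx orbT.
Qed.

Lemma geo_fpow_add (p q : T -> nat) s (a b : nat) : (forall t, (p t + q t <= a * N t + b)%N) ->
  geo (fun t => fpow (p t + q t) s) (fun t => fpow (p t) s * fpow (q t) s).
Proof.
move=> pq; have [c [D [c0 D1 H]]] := geo_exp (2 `^ `|s|) pq.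
exists c, D; split=> // t; apply: le_trans (fpow_add_le _ _ _) _.
by apply: ler_wpM2r; [rewrite mulr_ge0 ?fpow_ge0|have := H t; rewrite mulr1].
Qed.

(** A fixed shift of the index is invisible, so fixed orders of derivatives in
    [a] and the fixed dimension can be dropped. *)
Lemma geo_fpow_shift (p : T -> nat) (e : nat) s (a b : nat) : (forall t, (p t <= a * N t + b)%N) ->
  geo (fun t => fpow (p t + e) s) (fun t => fpow (p t) s).
Proof.
move=> pN; have H : geo (fun t => fpow (p t + e) s) (fun t => fpow (p t) s * fpow e s).
  apply: (@geo_fpow_add p (fun=> e) s a (b + e)) => t.
  by rewrite addnA leq_add2r.
apply: (geo_trans H); exists (fpow e s), 1; split=> //; first exact: fpow_ge0.
by move=> t; rewrite expr1n mulr1 mulrC.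
Qed.

End geometric_domination.

Lemma is_derive_unique {R : realType} {V : normedModType R} (f : V -> R) x v (d d' : R) :
  is_derive x v f d -> is_derive x v f d' -> d = d'.
Proof. by move=> [_ <-] [_ <-]. Qed.

(** * Multiplication by monomials *)
Section leibniz.
Context {R : realType} {n : nat}.
Implicit Types (f g : 'rV[R]_n -> R) (x : 'rV[R]_n) (c w v : seq 'I_n).

Definition wmul c f x : R := word_pow c x * f x.

Lemma word_pow_nil x : word_pow [::] x = 1. Proof. by rewrite /word_pow big_nil. Qed.
Lemma word_pow_cons i c x : word_pow (i :: c) x = x ord0 i * word_pow c x.
Proof. by rewrite /word_pow big_cons. Qed.
Lemma word_pow_cat c w x : word_pow (c ++ w) x = word_pow c x * word_pow w x.
Proof. by rewrite /word_pow big_cat. Qed.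
Lemma word_pow_nseq k i x : word_pow (nseq k i) x = x ord0 i ^+ k.
Proof. by elim: k => [|k IH]; rewrite ?word_pow_nil //= word_pow_cons IH exprS. Qed.

Lemma wmul_nil f : wmul [::] f = f.
Proof. by apply/funext => x; rewrite /wmul word_pow_nil mul1r. Qed.

Lemma wmul_cat c w f : wmul (c ++ w) f = wmul c (wmul w f).
Proof. by apply/funext => x; rewrite /wmul word_pow_cat mulrA. Qed.

Lemma continuous_word_pow c : continuous (@word_pow R n c).
Proof. by apply: continuous_prod => i; exact: continuous_coord. Qed.

Lemma continuous_wmul c f : continuous f -> continuous (wmul c f).
Proof. by move=> cf x; exact: continuousM (@continuous_word_pow c x) (cf x). Qed.

Lemma is_derive_coord x (i j : 'I_n) :
  is_derive x (unitv j) (fun y : 'rV[R]_n => y ord0 i) ((i == j)%:R : R).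
Proof.
apply: (@is_derive_quadratic _ _ _ _ _ _ 0) => t _.
rewrite !mxE eqxx /= mul0r [X in `|X|](_ : _ = 0) ?normr0 //; ring.
Qed.

(** The Leibniz formula for [x_i f]; by symmetry of the partials it does not
    matter which occurrence of [i] is removed from the word. *)
Let dcoord_mul f i w x : R :=
  x ord0 i * 'd_w f x + (count_mem i w)%:R * 'd_(rem i w) f x.

Lemma rpartials_coord_mul f i : row_smooth f ->
  row_smooth (fun x => x ord0 i * f x).
Proof.
move=> sf.
suff [] : row_smooth (dcoord_mul f i [::]) /\
    forall w, 'd_w (dcoord_mul f i [::]) = dcoord_mul f i w.
  rewrite (_ : dcoord_mul f i [::] = fun x => x ord0 i * f x) //.
  by apply/funext => x; rewrite /dcoord_mul /= mul0r addr0 rpartials_nil.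
apply: rsmooth_jet => [w x|w j x].
  have [/(_ x) C1 _] := sf w; have [/(_ x) C2 _] := sf (rem i w).
  have C := continuousD (continuousM (@continuous_coord R n i x) C1)
                     (continuousM (@cst_continuous _ _ ((count_mem i w)%:R : R) x) C2).
  exact: C.
have [_ /(_ j x) D1] := sf w; have [_ /(_ j x) D2] := sf (rem i w).
have := is_deriveD (is_deriveM (is_derive_coord x i j) D1) (is_deriveZ ((count_mem i w)%:R : R) D2).
move=> D; apply: (is_derive_eq D) => {D}.
rewrite /GRing.scale /= /dcoord_mul /= -addrA; congr (_ + _).
have [->|ji] := eqVneq i j; last first.
  by rewrite mulr0 add0r add0n.
rewrite mulr1 natrD mulrDl mul1r; congr (_ + _).
have [jw|jw] := boolP (j \in w); last by rewrite (count_memPn jw) !mul0r.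
by rewrite (rpartials_perm sf (w' := w)) // perm_sym perm_to_rem.
Qed.

Lemma rsmooth_wmul c f : row_smooth f -> row_smooth (wmul c f).
Proof.
move=> sf; elim: c => [|i c IH]; first by rewrite wmul_nil.
rewrite (_ : wmul _ _ = fun x => x ord0 i * wmul c f x).
  exact: rpartials_coord_mul.
by apply/funext => x; rewrite /wmul word_pow_cons mulrA.
Qed.

Lemma is_derive_word_pow c j x :
  is_derive x (unitv j) (@word_pow R n c) ((count_mem j c)%:R * word_pow (rem j c) x).
Proof.
elim: c => [|i c IH].
  rewrite /= mul0r (_ : word_pow [::] = cst 1); first exact: is_derive_cst.
  by apply/funext => y; rewrite word_pow_nil.
rewrite (_ : word_pow (i :: c) = (fun y : 'rV[R]_n => y ord0 i) * word_pow c); last first.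
  by apply/funext => y; rewrite word_pow_cons.
apply: (is_derive_eq (is_deriveM (is_derive_coord x i j) IH)).
rewrite /GRing.scale /=; have [->|ij] := eqVneq i j.
  rewrite mulr1 natrD mulrDl mul1r addrC; congr (_ + _).
  have [jc|jc] := boolP (j \in c); last by rewrite (count_memPn jc) !mul0r mulr0.
  rewrite mulrCA -word_pow_cons; congr (_ * _).
  by rewrite /word_pow; apply: perm_big; rewrite perm_sym perm_to_rem.
by rewrite mulr0 addr0 add0n word_pow_cons mulrCA.
Qed.

Lemma rpartial_wmul c f j : row_smooth f ->
  'd_[:: j] (wmul c f) =
  fun x => (count_mem j c)%:R * wmul (rem j c) f x + 1 * wmul c ('d_[:: j] f) x.
Proof.
move=> sf; apply/funext => x.
apply: (is_derive_unique (rsmooth_is_derive j x (rsmooth_wmul c sf))).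
apply: (is_derive_eq (is_deriveM (is_derive_word_pow c j x) (rsmooth_is_derive j x sf))).
by rewrite /GRing.scale /= /wmul; ring.
Qed.

(** Leibniz rule: a derivative falling on the monomial costs a factor
    [size c], which the gain from [fpow (size c)] to [fpow (size c).-1]
    absorbs because [1 <= tau]. *)
Lemma partials_wmul_le f (C H sigma tau : R) :
  row_smooth f -> 0 <= C -> 1 <= H -> 0 <= sigma -> 1 <= tau ->
  (forall m w x, `|x| ^+ m * `|'d_w f x| <= C * H ^+ (m + size w) * fpow m tau * fpow (size w) sigma) ->
  forall w c v x, `|'d_w (wmul c ('d_v f)) x| <=
    C * 2 ^+ size w * H ^+ (size c + size w + size v) * fpow (size c) tau * fpow (size w + size v) sigma.
Proof.
move=> sf C0 H1 s0 t1 Hf w.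
elim/last_ind: w => [|w j IH] c v x.
  rewrite rpartials_nil /wmul normrM expr0 mulr1 addn0 add0n.
  by apply: le_trans (Hf _ _ x); apply: ler_wpM2r => //; exact: word_pow_le.
have sv := rsmooth_partials v sf.
rewrite -rpartials_rcons (rpartial_wmul _ _ sv).
have [_ ->] := rpartials_lin ((count_mem j c)%:R : R) 1 (rsmooth_wmul (rem j c) sv)
   (rsmooth_wmul c (rsmooth_partials [:: j] sv)).
apply: le_trans (ler_normD _ _) _.
set B := C * 2 ^+ size w * H ^+ (size c + (size w).+1 + size v) * fpow (size c) tau * fpow ((size w).+1 + size v) sigma.
have -> : C * 2 ^+ size (rcons w j) * H ^+ (size c + size (rcons w j) + size v) * fpow (size c) tau
   * fpow (size (rcons w j) + size v) sigma = B + B.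
  by rewrite /B size_rcons exprS; ring.
apply: lerD; last first.
  rewrite mul1r rpartials_cons; apply: le_trans (IH c (j :: v) x) _ => /=.
  by rewrite /B !addnS !addSn.
rewrite normrM normr_nat.
have [jc|jc] := boolP (j \in c); last first.
  rewrite (count_memPn jc) mul0r /B !mulr_ge0 ?fpow_ge0 ?exprn_ge0 //.
  exact: le_trans H1.
apply: (@le_trans _ _ ((size c)%:R * `|'d_w (wmul (rem j c) ('d_v f)) x|)).
  by apply: ler_wpM2r => //; rewrite ler_nat count_size.
apply: le_trans (ler_wpM2l (ler0n _ _) (IH (rem j c) v x)) _.
rewrite {}/B size_rem //; case: c jc => // i c _ /=; move: (size c) => p.
have E : fpow p.+1 tau >= p.+1%:R * fpow p tau by exact: fpow_succ.
rewrite (_ : p.+1%:R * _ = C * 2 ^+ size w * H ^+ (p + size w + size v) * (p.+1%:R * fpow p tau) * fpow (size w + size v) sigma); last by ring.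
have H0 : 0 <= H by exact: le_trans H1.
apply: ler_pM; rewrite ?mulr_ge0 ?fpow_ge0 ?exprn_ge0 //; last first.
  by apply: fpow_mono => //; rewrite leq_add2r.
apply: ler_pM; rewrite ?mulr_ge0 ?fpow_ge0 ?exprn_ge0 //.
apply: ler_wpM2l; rewrite ?mulr_ge0 ?exprn_ge0 //.
by apply: ler_weXn2l => //; rewrite !(addnS, addSn) (leq_trans (leqnSn _)).
Qed.

End leibniz.

(** * Moments and correlations *)
Section moments.
Context {R : realType} {n : nat}.
Implicit Types (f g : 'rV[R]_n -> R) (x b : 'rV[R]_n) (c w v : seq 'I_n).
Notation Omega := (rvint (@envelope R n)).

(** The only part of the Schwartz property of [g] that matters for integrals
    against [g]. *)
Definition decays g : Prop :=
  continuous g /\ forall M, exists A, forall x, `|x| ^+ M * `|g x| <= A.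

Definition moments0 g : Prop := forall c, rvint (wmul c g) = 0.

Lemma Omega_ge0 : 0 <= Omega.
Proof. by apply: Rintegral_ge0 => t _; rewrite ltW // envelope_gt0. Qed.

Lemma rvint_bound g (A : R) : continuous g -> (forall x, `|g x| <= A) ->
  (forall x, `|x| ^+ (2 * n) * `|g x| <= A) ->
  rvintegrable g /\ `|rvint g| <= 2 ^+ n * A * Omega.
Proof.
move=> cg g1 g2; apply: rvint_dominated => // x; apply: le_envelope => //.
exact: le_trans (g1 0).
Qed.

Lemma decays_integrable g : decays g -> rvintegrable g.
Proof.
move=> [cg dg]; have [A HA] := dg 0%N; have [A' HA'] := dg (2 * n)%N.
have [//|//||//] := @rvint_bound g (Num.max A A').
  by move=> x; have := HA x; rewrite expr0 mul1r le_max => ->.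
by move=> x; rewrite le_max HA' orbT.
Qed.

Lemma decays_bounded_mul f g (K : R) : continuous f -> (forall x, `|f x| <= K) ->
  decays g -> decays (fun x => f x * g x).
Proof.
move=> cf fK [cg dg]; split=> [x|M]; first exact: continuousM (cf x) (cg x).
have [A HA] := dg M; exists (K * A) => x.
by rewrite normrM mulrCA; apply: ler_pM => //; rewrite mulr_ge0 // exprn_ge0.
Qed.

Lemma decays_wmul c g : decays g -> decays (wmul c g).
Proof.
move=> [cg dg]; split=> [|M]; first exact: continuous_wmul.
have [A HA] := dg (M + size c)%N; exists A => x.
apply: le_trans (HA x); rewrite /wmul normrM mulrA exprD.
by apply: ler_wpM2r => //; apply: ler_wpM2l; [rewrite exprn_ge0|exact: word_pow_le].
Qed.

Lemma moments0_wmul c g : moments0 g -> moments0 (wmul c g).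
Proof. by move=> mg w; rewrite -wmul_cat. Qed.

Lemma continuous_bigsum (I : Type) (s : seq I) (F : I -> 'rV[R]_n -> R) :
  (forall i, continuous (F i)) -> continuous (fun x => \sum_(i <- s) F i x).
Proof.
move=> cF; elim: s => [|i s IH] x.
  under eq_fun do rewrite big_nil; exact: cst_continuous.
under eq_fun do rewrite big_cons.
exact: continuousD (cF i x) (IH x).
Qed.

Lemma continuous_dirn m f b (a : R) : continuous (fun x => dirn m f (a *: x) b).
Proof.
elim: m f => [|m IH] f x; first exact: cst_continuous.
have -> : (fun x => dirn m.+1 f (a *: x) b) =
    fun x => \sum_i a * x ord0 i * dirn m ('d_[:: i] f) (a *: x) b.
  by apply/funext => y /=; apply: eq_bigr => i _; rewrite mxE.
apply: continuous_bigsum => i {}x.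
have C := continuousM (continuousM (@cst_continuous _ _ a x) (@continuous_coord R n i x)) (IH ('d_[:: i] f) x).
exact: C.
Qed.

(** Taylor polynomials are polynomials in the increment, so functions with
    vanishing moments do not see them. *)
Lemma rvint_dirn_moment m f b (a : R) g c : decays g -> moments0 g ->
  rvintegrable (fun x => dirn m f (a *: x) b * wmul c g x) /\
  rvint (fun x => dirn m f (a *: x) b * wmul c g x) = 0.
Proof.
move=> dg mg; elim: m f c => [|m IH] f c.
  have [] := rvintZ (f b) (decays_integrable (decays_wmul c dg)).
  by rewrite mg mulr0.
have E : (fun x => dirn m.+1 f (a *: x) b * wmul c g x) =
    fun x => \sum_i a * (dirn m ('d_[:: i] f) (a *: x) b * wmul (i :: c) g x).
  apply/funext => x; rewrite /= mulr_suml; apply: eq_bigr => i _.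
  by rewrite mxE /wmul word_pow_cons; ring.
have H i := rvintZ a (IH ('d_[:: i] f) (i :: c)).1.
have [|I1 I2] := rvint_sum (index_enum 'I_n) (F := fun i x => a * (dirn m ('d_[:: i] f) (a *: x) b * wmul (i :: c) g x)).
  by move=> i; have [] := H i.
rewrite E; split=> //; rewrite I2 big1 // => i _.
by have [_ ->] := H i; rewrite (IH _ _).2 mulr0.
Qed.

Definition corr f g b (a : R) : R := rvint (fun x => f (b + a *: x) * g x).

(** Subtracting from [f (b + a x)] its Taylor polynomial at [b] does not change
    the correlation, and the remainder is of order [(a |x|) ^ L]. *)
Lemma corr_taylor_bound f g b (a K A : R) L : row_smooth f ->
  (forall w y, size w = L -> `|'d_w f y| <= K) -> 0 <= K -> 0 <= a ->
  decays g -> moments0 g ->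
  (forall x, `|x| ^+ L * `|g x| <= A) ->
  (forall x, `|x| ^+ (L + 2 * n) * `|g x| <= A) ->
  rvintegrable (fun x => f (b + a *: x) * g x) /\
  `|corr f g b a| <= a ^+ L * (n%:R ^+ L * K / L`!%:R) * (2 ^+ n * A * Omega).
Proof.
move=> sf HK K0 a0 dg mg A1 A2.
set B := n%:R ^+ L * K / L`!%:R.
have B0 : 0 <= B by rewrite !mulr_ge0 ?invr_ge0 ?exprn_ge0.
pose P x := \sum_(m < L) m`!%:R^-1 * (dirn m f (a *: x) b * wmul [::] g x).
pose F x := f (b + a *: x) * g x + (- 1) * P x.
have cg : continuous g by have [] := dg.
have Pi (m : 'I_L) := rvintZ (m`!%:R^-1) (rvint_dirn_moment m f b a [::] dg mg).1.
have [|IP1 IP2] := rvint_sum (index_enum 'I_L)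
    (F := fun (m : 'I_L) x => m`!%:R^-1 * (dirn m f (a *: x) b * wmul [::] g x)).
  by move=> m; have [] := Pi m.
have IP0 : rvint P = 0.
  rewrite IP2 big1 // => m _; have [_ ->] := Pi m.
  by rewrite (rvint_dirn_moment m f b a [::] dg mg).2 mulr0.
have cF : continuous F.
  move=> x.
  have cT : {for x, continuous (fun y : 'rV[R]_n => f (b + a *: y))}.
    apply: (continuous_comp (f := fun y : 'rV[R]_n => b + a *: y)).
      apply: continuousD; first exact: cst_continuous.
      exact: continuousZr.
    exact: rsmooth_continuous.
  have cP : continuous P.
    apply: continuous_bigsum => m y; rewrite wmul_nil.
    have C := continuousM (@cst_continuous _ _ (m`!%:R^-1 : R) y)
       (continuousM (@continuous_dirn m f b a y) (cg y)).
    exact: C.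
  have C := continuousD (continuousM cT (cg x)) (continuousM (@cst_continuous _ _ (- 1 : R) x) (cP x)).
  exact: C.
have FB x : `|F x| <= a ^+ L * B * (`|x| ^+ L * `|g x|).
  have -> : F x = (f (b + a *: x) - \sum_(m < L) dirn m f (a *: x) b / m`!%:R) * g x.
    rewrite mulrBl mulr_suml /F mulN1r; congr (_ - _); apply: eq_bigr => m _.
    by rewrite wmul_nil; ring.
  rewrite normrM mulrA; apply: ler_wpM2r => //.
  apply: le_trans (taylor_row b (a *: x) sf HK) _.
  rewrite normrZ ger0_norm // exprMn /B le_eqVlt; apply/orP; left; apply/eqP; ring.
have aB0 : 0 <= a ^+ L * B by rewrite mulr_ge0 // exprn_ge0.
have [||Fi FE] := @rvint_bound F (a ^+ L * B * A) cF.
- by move=> x; apply: le_trans (FB x) _; apply: ler_wpM2l.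
- move=> x; apply: le_trans (ler_wpM2l _ (FB x)) _; first by rewrite exprn_ge0.
  rewrite mulrCA; apply: ler_wpM2l => //; rewrite mulrA -exprD addnC; exact: A2.
have [Ti TE] := rvintD Fi IP1.
have FP : (fun x => F x + P x) = fun x => f (b + a *: x) * g x.
  by apply/funext => x; rewrite /F mulN1r addrNK.
rewrite FP in Ti TE; split=> //.
rewrite /corr TE IP0 addr0; apply: le_trans FE _.
rewrite le_eqVlt; apply/orP; left; apply/eqP; ring.
Qed.

End moments.

Section correlation.
Context {R : realType} {n : nat}.
Implicit Types (f g : 'rV[R]_n -> R) (x b : 'rV[R]_n) (c w v : seq 'I_n).
Notation Omega := (rvint (@envelope R n)).

(** The substitution [y = b + a x] exchanges the two functions and turns large
    [a] into small [a]. *)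
Lemma corr_swap f g b (a : R) : 0 < a -> continuous f -> continuous g ->
  rvintegrable (fun x => f (b + a *: x) * g x) ->
  corr f g b a = a ^- n * corr g f (- (a^-1 *: b)) a^-1.
Proof.
move=> a0 cf cg fgi.
have ch : continuous (fun y : 'rV[R]_n => g (- (a^-1 *: b) + a^-1 *: y) * f y).
  move=> y.
  have cT : {for y, continuous (fun y : 'rV[R]_n => g (- (a^-1 *: b) + a^-1 *: y))}.
    apply: (continuous_comp (f := fun y : 'rV[R]_n => - (a^-1 *: b) + a^-1 *: y)).
      apply: continuousD; first exact: cst_continuous.
      exact: continuousZr.
    exact: cg.
  exact: continuousM cT (cf y).
have E : (fun x => g (- (a^-1 *: b) + a^-1 *: (b + a *: x)) * f (b + a *: x)) =
   fun x => f (b + a *: x) * g x.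
  apply/funext => x; rewrite mulrC; congr (_ * g _).
  by rewrite scalerDr scalerA mulVf ?gt_eqF // scale1r addKr.
have [|_] := integral_row_affine (b := b) a0 ch; first by rewrite E.
rewrite E -/(corr f g b a) => e.
by rewrite /corr e mulKf // expf_neq0 // gt_eqF.
Qed.

(** Binomial formula for [b_i = (b + a x)_i - a x_i]: the weight in [b] becomes
    monomials on both functions. *)
Lemma corr_binomial f g b (a : R) i k :
  (forall j : 'I_k.+1, rvintegrable (fun x =>
     wmul (nseq (k - j) i) f (b + a *: x) * wmul (nseq j i) g x)) ->
  b ord0 i ^+ k * corr f g b a =
  \sum_(j < k.+1) 'C(k, j)%:R * (- a) ^+ j *
     corr (wmul (nseq (k - j) i) f) (wmul (nseq j i) g) b a.
Proof.
move=> Ij.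
pose F (j : 'I_k.+1) x := ('C(k, j)%:R * (- a) ^+ j) *
  (wmul (nseq (k - j) i) f (b + a *: x) * wmul (nseq j i) g x).
have FI (j : 'I_k.+1) := rvintZ ('C(k, j)%:R * (- a) ^+ j) (Ij j).
have [|I1 I2] := rvint_sum (index_enum 'I_k.+1) (F := F).
  by move=> j; have [] := FI j.
transitivity (\sum_(j < k.+1) rvint (F j)); last first.
  by apply: eq_bigr => j _; have [_ ->] := FI j.
rewrite -I2.
have E : (fun x => \sum_(j < k.+1) F j x) = fun x => b ord0 i ^+ k * (f (b + a *: x) * g x).
  apply/funext => x.
  have -> : b ord0 i = (b + a *: x) ord0 i + (- a) * x ord0 i.
    by rewrite !mxE mulNr addrK.
  rewrite exprDn mulr_suml; apply: eq_bigr => j _.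
  rewrite /F /wmul !word_pow_nseq exprMn -mulr_natl; ring.
rewrite E /corr; have [b0|b0] := eqVneq (b ord0 i ^+ k) 0.
  rewrite b0 mul0r (_ : (fun x => _) = fun=> 0) ?rvint_cst0 //.
  by apply/funext => x; rewrite mul0r.
rewrite E in I1; have [_ H] := rvintZ (b ord0 i ^+ k)^-1 I1.
have E2 : (fun x => (b ord0 i ^+ k)^-1 * (b ord0 i ^+ k * (f (b + a *: x) * g x))) =
    fun x => f (b + a *: x) * g x.
  by apply/funext => x; rewrite mulKf.
by rewrite E2 in H; rewrite H mulVKf.
Qed.

(** The order [L j] of the Taylor expansion may depend on the term [j] of the
    binomial formula; for [1 <= a] this freedom is needed. *)
Lemma corr_weighted_bound f g b (a : R) i k (L : nat -> nat) (P Q : nat -> R) :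
  row_smooth f -> decays g -> moments0 g -> 0 <= a ->
  (forall j, (j <= k)%N -> 0 <= P j) ->
  (forall j w y, (j <= k)%N -> size w = L j -> `|'d_w (wmul (nseq (k - j) i) f) y| <= P j) ->
  (forall j x, (j <= k)%N -> `|x| ^+ (L j + j) * `|g x| <= Q j) ->
  (forall j x, (j <= k)%N -> `|x| ^+ (L j + 2 * n + j) * `|g x| <= Q j) ->
  `|b ord0 i| ^+ k * `|corr f g b a| <=
  \sum_(j < k.+1) 'C(k, j)%:R * (a ^+ j * a ^+ L j) *
     ((n%:R ^+ L j * P j / (L j)`!%:R) * (2 ^+ n * Q j * Omega)).
Proof.
move=> sf dg mg a0 P0 HP Q1 Q2.
have H (j : 'I_k.+1) := @corr_taylor_bound R n (wmul (nseq (k - j) i) f) (wmul (nseq j i) g)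
   b a (P j) (Q j) (L j) (rsmooth_wmul _ sf).
have jk (j : 'I_k.+1) : (j <= k)%N by rewrite -ltnS.
have wg (j : nat) M x : `|x| ^+ M * `|wmul (nseq j i) g x| <= `|x| ^+ (M + j) * `|g x|.
  rewrite /wmul normrM mulrA exprD; apply: ler_wpM2r => //.
  apply: ler_wpM2l; first by rewrite exprn_ge0.
  by apply: le_trans (word_pow_le _ _) _; rewrite size_nseq.
have {}H (j : 'I_k.+1) := H j (fun w y => HP j w y (jk j)) (P0 j (jk j)) a0
  (decays_wmul _ dg) (moments0_wmul _ mg)
  (fun x => le_trans (wg j _ x) (Q1 j x (jk j))) (fun x => le_trans (wg j _ x) (Q2 j x (jk j))).
rewrite -normrX -normrM corr_binomial; last by move=> j; have [] := H j.
apply: le_trans (ler_norm_sum _ _ _) _; apply: ler_sum => j _.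
have [_ Hj] := H j.
rewrite !normrM normr_nat normrX normrN (ger0_norm a0).
rewrite -!mulrA; apply: ler_wpM2l => //; apply: ler_wpM2l; first by rewrite exprn_ge0.
by apply: le_trans Hj _; rewrite !mulrA.
Qed.

End correlation.

(** * Vanishing moments are inherited by derivatives *)
Section moments_of_derivatives.
Context {R : realType} {n : nat}.
Implicit Types (f g : 'rV[R]_n -> R) (x z b : 'rV[R]_n) (c w v : seq 'I_n).

Definition rschwartz f : Prop := row_smooth f /\ forall w, decays ('d_w f).

Lemma rschwartz_decays f : rschwartz f -> decays f.
Proof. by move=> [_ /(_ [::])]; rewrite rpartials_nil. Qed.

Lemma rschwartz_partials w f : rschwartz f -> rschwartz ('d_w f).
Proof.
move=> [sf df]; split=> [|v]; first exact: rsmooth_partials.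
by rewrite -rpartials_cat; exact: df.
Qed.

Lemma second_order_remainder f i x (t K : R) : row_smooth f ->
  (forall s : R, 0 <= s <= 1 -> `|'d_[:: i; i] f (x + s *: (t *: unitv i))| <= K) ->
  `|f (x + t *: unitv i) - f x - t * 'd_[:: i] f x| <= t ^+ 2 * K.
Proof.
move=> sf HK; set v := t *: unitv i.
pose U m (s : R) := t ^+ m * 'd_(nseq m i) f (x + s *: v).
have DU m (s : R) : is_derive s (1 : R) (U m) (U m.+1 s).
  apply: (is_derive_eq (is_deriveZ (t ^+ m)
    (is_derive_line (is_derive_scalev t (rsmooth_is_derive i (x + s *: v) (rsmooth_partials (nseq m i) sf)))))).
  by rewrite rpartials_cons /U exprSr /GRing.scale /= mulrA.
have := @taylor_line R U 2 (t ^+ 2 * K) DU.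
have H (s : R) : 0 <= s <= 1 -> `|U 2%N s| <= t ^+ 2 * K.
  move=> s01; rewrite /U normrM normrX real_normK ?num_real //.
  by apply: ler_wpM2l; [exact: sqr_ge0|exact: HK].
move=> /(_ H 1); rewrite ler01 lexx => /(_ isT).
rewrite !big_ord_recl big_ord0 /U /= !scale1r !scale0r !addr0 !expr1n !rpartials_nil.
rewrite expr0 !mul1r fact0 /bump /= addn0 expr1 !mulr1 !divr1 opprD addrA.
have : 0 <= t ^+ 2 * K by apply: le_trans (normr_ge0 _) (H 0 _); rewrite lexx ler01.
move: (_ * K) => y y0 /le_trans; apply.
by rewrite ler_piMr // invf_le1 ?ler1n ?ltr0n ?fact_gt0.
Qed.

(** Weights at points at distance at most [1] are comparable. *)
Lemma weight_shift_le x y (M : nat) : `|x - y| <= 1 ->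
  `|x| ^+ M <= 2 ^+ M * (1 + `|y| ^+ M).
Proof.
move=> xy; have xy1 : `|x| <= `|y| + 1.
  by rewrite -[x](subrK y); apply: le_trans (ler_normD _ _) _; rewrite addrC lerD2l.
apply: (@le_trans _ _ ((2 * Num.max 1 `|y|) ^+ M)).
  apply: lerXn2r; rewrite ?nnegrE //.
  apply: le_trans xy1 _.
  have : 1 <= Num.max 1 `|y| by rewrite le_max lexx.
  have : `|y| <= Num.max 1 `|y| by rewrite le_max lexx orbT.
  lra.
rewrite exprMn; apply: ler_wpM2l; first exact: exprn_ge0.
case: (leP 1 `|y|) => y1; first by rewrite lerDr.
by rewrite expr1n lerDl exprn_ge0.
Qed.

Lemma rvint_shifted_moment f z c d : decays f -> moments0 f ->
  rvintegrable (fun x => word_pow c (x + z) * wmul d f x) /\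
  rvint (fun x => word_pow c (x + z) * wmul d f x) = 0.
Proof.
move=> df mf; elim: c d => [|i c IH] d.
  have -> : (fun x => word_pow [::] (x + z) * wmul d f x) = wmul d f.
    by apply/funext => x; rewrite word_pow_nil mul1r.
  by split; [exact: decays_integrable (decays_wmul d df)|exact: mf].
have -> : (fun x => word_pow (i :: c) (x + z) * wmul d f x) =
  fun x => word_pow c (x + z) * wmul (i :: d) f x + z ord0 i * (word_pow c (x + z) * wmul d f x).
  by apply/funext => x; rewrite /wmul !word_pow_cons !mxE; ring.
have [I1 E1] := IH (i :: d); have [I2 E2] := IH d.
have [I3 E3] := rvintZ (z ord0 i) I2.
by have [I4 ->] := rvintD I1 I3; rewrite E1 E3 E2 mulr0 addr0.
Qed.

(** The moments of the translates [f (x + t e_i)] vanish, by the binomial formula.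
    Up to an error [O(t ^ 2)], [t] times the moment of the derivative is the
    difference of two such moments; dividing by [t] and letting it tend to zero
    avoids an integration by parts. *)
Lemma moments0_partial f i : rschwartz f -> moments0 f -> moments0 ('d_[:: i] f).
Proof.
move=> [sf df] mf c; set J := rvint _.
have cf : continuous f := rsmooth_continuous sf.
have df0 : decays f by have := df [::]; rewrite rpartials_nil.
(* the Taylor remainder of order two, weighted; its integral is [- t * J] *)
pose D t x := word_pow c x * (f (x + t *: unitv i) - f x - t * 'd_[:: i] f x).
have B M : exists A, forall t : R, 0 < t <= 1 -> forall x, `|x| ^+ M * `|D t x| <= t ^+ 2 * A.
  have [_ dd] := df [:: i; i]; have [A0 HA0] := dd 0%N; have [A1 HA1] := dd (M + size c)%N.
  have A01 : 0 <= A0 + A1.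
    by apply: addr_ge0; [apply: le_trans (HA0 0)|apply: le_trans (HA1 0)];
      rewrite mulr_ge0 // exprn_ge0.
  exists (2 ^+ (M + size c) * (A0 + A1)) => t /andP[t0 t1] x.
  have S : `|x| ^+ (M + size c) * `|f (x + t *: unitv i) - f x - t * 'd_[:: i] f x|
      <= t ^+ 2 * (2 ^+ (M + size c) * (A0 + A1)).
    have [x0|x0] := eqVneq (`|x| ^+ (M + size c)) 0.
      by rewrite x0 mul0r mulr_ge0 ?sqr_ge0 // mulr_ge0 // exprn_ge0.
    rewrite -ler_pdivlMl ?lt0r ?x0 ?exprn_ge0 // mulrCA.
    apply: second_order_remainder => // s /andP[s0 s1].
    rewrite ler_pdivlMl ?lt0r ?x0 ?exprn_ge0 //.
    set y := x + _; have xy : `|x - y| <= 1.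
      rewrite /y opprD addrA subrr sub0r normrN !normrZ !ger0_norm ?(ltW t0) //.
      by rewrite mulrA -[1]mulr1; apply: ler_pM => //; [rewrite mulr_ge0 // ltW|rewrite mulr_ile1 // ltW|exact: norm_unitv].
    apply: le_trans (ler_wpM2r (normr_ge0 _) (weight_shift_le (M + size c) xy)) _.
    rewrite -mulrA; apply: ler_wpM2l; first exact: exprn_ge0.
    rewrite mulrDl mul1r; apply: lerD; last exact: HA1.
    by have := HA0 y; rewrite expr0 mul1r.
  apply: le_trans S; rewrite /D normrM mulrA exprD; apply: ler_wpM2r => //.
  by apply: ler_wpM2l; [rewrite exprn_ge0|exact: word_pow_le].
have [A0 HA0] := B 0%N; have [A1 HA1] := B (2 * n)%N.
pose A := Num.max A0 A1.
suff H (t : R) : 0 < t <= 1 -> t * `|J| <= 2 ^+ n * (t ^+ 2 * A) * rvint (@envelope R n).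
  apply/eqP; rewrite -normr_le0; apply/ler_addgt0Pr => e e0; rewrite add0r.
  set C := 2 ^+ n * A * rvint (@envelope R n).
  have C1 : 0 < `|C| + 1 by rewrite ltr_pwDr.
  pose t := Num.min 1 (e / (`|C| + 1)).
  have t0 : 0 < t by rewrite lt_min ltr01 divr_gt0.
  have t1 : t <= 1 by rewrite ge_min lexx.
  have te : t * (`|C| + 1) <= e by rewrite -ler_pdivlMr // ge_min lexx orbT.
  have := H t; rewrite t0 t1 => /(_ isT).
  rewrite (_ : _ * rvint _ = t * (t * C)); last by rewrite /C; ring.
  rewrite ler_pM2l // => /le_trans; apply.
  apply: le_trans te; apply: ler_wpM2l; first exact: ltW.
  by apply: le_trans (ler_norm C) _; rewrite lerDl.
move=> /andP[t0 t1].
pose k x := word_pow c x * f (x + t *: unitv i).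
have ck : continuous k.
  move=> x.
  have cT : {for x, continuous (fun y : 'rV[R]_n => f (y + t *: unitv i))}.
    apply: (continuous_comp (f := fun y : 'rV[R]_n => y + t *: unitv i)); last exact: cf.
    by apply: continuousD; [exact: cvg_id|exact: cst_continuous].
  exact: continuousM (@continuous_word_pow R n c x) cT.
have [S1 S2] := rvint_shifted_moment (- (t *: unitv i)) c [::] df0 mf.
have Ek : (fun x => word_pow c (x + - (t *: unitv i)) * wmul [::] f x) =
    fun x => k (- (t *: unitv i) + 1 *: x).
  by apply/funext => x; rewrite wmul_nil /k scale1r [- _ + x]addrC subrK.
rewrite Ek in S1 S2; have [kI kE] := integral_row_affine ltr01 ck S1.
rewrite S2 mulr0 in kE.
have fI := decays_integrable (decays_wmul c df0).
have dI := decays_integrable (decays_wmul c (df [:: i])).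
have [I1 E1] := rvintZ (- 1) fI; have [I2 E2] := rvintZ (- t) dI.
have [I3 E3] := rvintD kI I1; have [I4 E4] := rvintD I3 I2.
have FE : rvint (fun x => k x + - 1 * wmul c f x + - t * wmul c ('d_[:: i] f) x) = - t * J.
  by rewrite E4 E3 E1 E2 kE mf mulr0 !add0r.
have -> : t * `|J| = `|- t * J| by rewrite normrM normrN (gtr0_norm t0).
rewrite -FE.
have FD : (fun x => k x + - 1 * wmul c f x + - t * wmul c ('d_[:: i] f) x) = D t.
  by apply/funext => x; rewrite /k /wmul /D; ring.
have t01 : 0 < t <= 1 by rewrite t0.
have [||| _] := @rvint_bound R n (D t) (t ^+ 2 * A).
- rewrite -FD => x.
  have C := continuousD (continuousD (ck x)
     (continuousM (@cst_continuous _ _ (- 1 : R) x) (@continuous_wmul R n c f cf x)))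
     (continuousM (@cst_continuous _ _ (- t : R) x) (@continuous_wmul R n c _ (df [:: i]).1 x)).
  exact: C.
- move=> x; have := HA0 t t01 x; rewrite expr0 mul1r => /le_trans; apply.
  by apply: ler_wpM2l; [exact: sqr_ge0|rewrite le_max lexx].
- move=> x; apply: le_trans (HA1 t t01 x) _.
  by apply: ler_wpM2l; [exact: sqr_ge0|rewrite le_max lexx orbT].
by rewrite -FD.
Qed.

Lemma moments0_partials f w : rschwartz f -> moments0 f -> moments0 ('d_w f).
Proof.
move=> sf mf; elim: w => [|i w IH]; first by rewrite rpartials_nil.
by rewrite -rpartials_cons; apply: moments0_partial => //; exact: rschwartz_partials.
Qed.

End moments_of_derivatives.

(** * The decay of correlations *)
Section exponents.
Context {R : realType}.
Variables (n al : nat) (H rho1 rho2 sigma tau s t tau1 tau2 : R).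
Hypotheses (H1 : 1 <= H) (sigma0 : 0 <= sigma) (rho10 : 0 <= rho1).
Hypotheses (tau_1 : 1 <= tau) (rho2_1 : 1 <= rho2).
Hypotheses (sigma_s : sigma <= s) (sigma_tau2 : sigma + rho2 - 1 <= tau2).
Hypotheses (tau_t : tau <= t) (rho2_t : rho2 <= t).
Hypotheses (rho1_tau1 : tau + rho1 - 1 <= tau1) (rho_t : tau + rho1 - 1 + rho2 <= t).

(** The tuple [(l, p, j, q)] consists of the decay order [l] in [a], the two
    parts [p] and [j] of the binomial formula for a weight of order [p + j], and
    the order [q] of the derivative in [b]. *)
Let T := (nat * nat * nat * nat)%type.
Let l (x : T) := x.1.1.1.
Let p (x : T) := x.1.1.2.
Let j (x : T) := x.1.2.
Let q (x : T) := x.2.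
Definition order4 (x : T) : nat := (l x + p x + j x + q x)%N.
Local Notation N := order4.

(** The [j]-th term of [corr_weighted_bound] for [a <= 1], with expansion of
    order [l], when the bounds of the classes are inserted. *)
Definition near_term (x : T) : R :=
  'C(p x + j x, j x)%:R *
  (n%:R ^+ l x * (2 ^+ l x * H ^+ (p x + l x + (al + q x)) * fpow (p x) tau *
     fpow (l x + (al + q x)) sigma) / (l x)`!%:R) *
  (H ^+ (l x + 2 * n + j x + al) * fpow (l x + 2 * n + j x + al) rho2).

(** The same for [1 <= a], where the functions are exchanged and the expansion
    has order [l + p]. *)
Definition far_term (x : T) : R :=
  'C(p x + j x, j x)%:R *
  (n%:R ^+ (l x + p x) * (2 ^+ (l x + p x) * H ^+ (p x + al + (l x + p x)) * fpow (p x + al) rho2 *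
     fpow (l x + p x) rho1) / (l x + p x)`!%:R) *
  (H ^+ (l x + p x + 2 * n + j x + (al + q x)) * fpow (l x + p x + 2 * n + j x) tau
    * fpow (al + q x) sigma).

Definition weight4 (tau0 : R) (x : T) : R :=
  fpow (p x + j x) t * fpow (l x) tau0 * fpow (q x) s.

Let H0 : 0 <= H. Proof. exact: le_trans H1. Qed.

Let dom (X Y : T -> R) := (forall x, 0 <= X x) /\ geo N X Y.

Let dom_mul X X' Y Y' : dom X Y -> dom X' Y' ->
  dom (fun x => X x * X' x) (fun x => Y x * Y' x).
Proof. by move=> [X0 HX] [X0' HX']; split=> [x|]; [rewrite mulr_ge0|exact: geo_mul]. Qed.

Let dom_refl X : (forall x, 0 <= X x) -> dom X X.
Proof. by move=> X0; split=> //; exact: geo_le. Qed.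

Let dom_pow C (m : T -> nat) (e : nat) : 0 <= C -> (forall x, (m x <= 4 * N x + e)%N) ->
  dom (fun x => C ^+ m x) (fun=> 1).
Proof. by move=> C0 mN; split=> [x|]; [rewrite exprn_ge0|exact: geo_exp mN]. Qed.

Let dom_fpow_add (a b : T -> nat) (e1 e2 : nat) (r : R) :
  (forall x, (a x + b x <= 4 * N x + e1)%N) ->
  dom (fun x => fpow (a x + b x + e2) r) (fun x => fpow (a x) r * fpow (b x) r).
Proof.
move=> ab; split=> [x|]; first exact: fpow_ge0.
exact: geo_trans (geo_fpow_shift e2 r ab) (geo_fpow_add r ab).
Qed.

Local Ltac nat_bound := let x := fresh in move=> x; case: x => [[[? ?] ?] ?];
  rewrite /order4 /l /p /j /q /=; clear; lia.

Let dom_bin : dom (fun x => 'C(p x + j x, j x)%:R) (fun=> 1).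
Proof.
split=> [x|]; first exact: ler0n.
apply: (@geo_trans _ _ _ _ (fun x => 2 ^+ (p x + j x))).
  apply: geo_le => x; rewrite -natrX ler_nat.
  have jP : (j x < (p x + j x).+1)%N by rewrite ltnS leq_addl.
  rewrite -[X in (_ <= X ^ _)%N]/(1 + 1)%N expnDn (bigD1 (Ordinal jP)) //=.
  by rewrite !exp1n !muln1 leq_addr.
by apply: (@geo_exp _ _ _ _ _ 4 0); nat_bound.
Qed.

Let fpowV m : (m`!%:R)^-1 = fpow m (-1) :> R.
Proof. by rewrite /fpow powRN powRr1 // ler0n. Qed.

Let merge x : fpow (p x) t * fpow (j x) t <= fpow (p x + j x) t.
Proof. by apply: fpow_mul_le; apply: le_trans tau_t; apply: le_trans tau_1. Qed.

(** The powers of [l!] collected here are [sigma], [rho2] and [-1]. *)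
Lemma near_term_geo : geo N near_term (weight4 tau2).
Proof.
have B1 : dom (fun x => n%:R ^+ l x) (fun=> 1) by apply: (@dom_pow _ _ 0); [|nat_bound].
have B2 : dom (fun x => 2 ^+ l x) (fun=> 1) by apply: (@dom_pow _ _ 0); [|nat_bound].
have B3 : dom (fun x => H ^+ (p x + l x + (al + q x))) (fun=> 1).
  by apply: (@dom_pow _ _ al); [|nat_bound].
have B4 : dom (fun x => fpow (p x) tau) (fun x => fpow (p x) tau).
  by apply: dom_refl => x; exact: fpow_ge0.
have B5 : dom (fun x => fpow (l x + (al + q x)) sigma)
    (fun x => fpow (l x) sigma * fpow (q x) sigma).
  rewrite (_ : (fun x => _) = (fun x => fpow (l x + q x + al) sigma)).
    by apply: (@dom_fpow_add _ _ 0); nat_bound.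
  by apply/funext => x; rewrite [(al + _)%N]addnC addnA.
have B6 : dom (fun x => ((l x)`!%:R)^-1) (fun x => fpow (l x) (-1)).
  by under eq_fun do rewrite fpowV; apply: dom_refl => x; exact: fpow_ge0.
have B7 : dom (fun x => H ^+ (l x + 2 * n + j x + al)) (fun=> 1).
  by apply: (@dom_pow _ _ (2 * n + al)); [|nat_bound].
have B8 : dom (fun x => fpow (l x + 2 * n + j x + al) rho2)
    (fun x => fpow (l x) rho2 * fpow (j x) rho2).
  rewrite (_ : (fun x => _) = (fun x => fpow (l x + j x + (2 * n + al)) rho2)).
    by apply: (@dom_fpow_add _ _ 0); nat_bound.
  by apply/funext => x; congr (fpow _ _); clear; lia.
have [_ G] := dom_mul (dom_mul dom_bin (dom_mul (dom_mul B1 (dom_mul (dom_mul (dom_mul B2 B3) B4) B5)) B6))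
  (dom_mul B7 B8).
apply: (geo_trans G); apply: geo_le => x.
rewrite !mul1r /weight4.
rewrite (_ : _ * _ = (fpow (p x) tau * fpow (j x) rho2) * (fpow (l x) (sigma + rho2 - 1)) * fpow (q x) sigma); last first.
  by rewrite !fpow_expD; ring.
apply: ler_pM; rewrite ?mulr_ge0 ?fpow_ge0 ?fpow_exp //.
apply: ler_pM; rewrite ?mulr_ge0 ?fpow_ge0 ?fpow_exp //.
apply: le_trans (merge x).
by apply: ler_pM; rewrite ?fpow_ge0 ?fpow_exp.
Qed.

(** The expansion of order [l + p] contributes [rho1 - 1] to the exponents of both
    [l!] and [p!]. *)
Lemma far_term_geo : geo N far_term (weight4 tau1).
Proof.
have B1 : dom (fun x => n%:R ^+ (l x + p x)) (fun=> 1) by apply: (@dom_pow _ _ 0); [|nat_bound].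
have B2 : dom (fun x => 2 ^+ (l x + p x)) (fun=> 1) by apply: (@dom_pow _ _ 0); [|nat_bound].
have B3 : dom (fun x => H ^+ (p x + al + (l x + p x))) (fun=> 1).
  by apply: (@dom_pow _ _ al); [|nat_bound].
have B4 : dom (fun x => fpow (p x + al) rho2) (fun x => fpow (p x) rho2).
  split=> [x|]; first exact: fpow_ge0.
  by apply: (@geo_fpow_shift _ _ _ _ _ _ 4 0); nat_bound.
have B5 : dom (fun x => fpow (l x + p x) rho1 / (l x + p x)`!%:R)
    (fun x => fpow (l x) (rho1 - 1) * fpow (p x) (rho1 - 1)).
  rewrite (_ : (fun x => _) = (fun x => fpow (l x + p x + 0) (rho1 - 1))).
    by apply: (@dom_fpow_add _ _ 0); nat_bound.
  by apply/funext => x; rewrite addn0 fpowV fpow_expD.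
have B7 : dom (fun x => H ^+ (l x + p x + 2 * n + j x + (al + q x))) (fun=> 1).
  by apply: (@dom_pow _ _ (2 * n + al)); [|nat_bound].
have B8 : dom (fun x => fpow (l x + p x + 2 * n + j x) tau)
    (fun x => fpow (l x) tau * (fpow (p x) tau * fpow (j x) tau)).
  have [P1 G1] : dom (fun x => fpow (l x + (p x + j x) + 2 * n) tau)
      (fun x => fpow (l x) tau * fpow (p x + j x) tau).
    by apply: (@dom_fpow_add _ _ 0); nat_bound.
  have [P2 G2] : dom (fun x => fpow (l x) tau * fpow (p x + j x + 0) tau)
      (fun x => fpow (l x) tau * (fpow (p x) tau * fpow (j x) tau)).
    apply: dom_mul; first by apply: dom_refl => x; exact: fpow_ge0.
    by apply: (@dom_fpow_add _ _ 0); nat_bound.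
  split=> [x|]; first exact: fpow_ge0.
  rewrite (_ : (fun x => fpow (l x + p x + 2 * n + j x) tau) = (fun x => fpow (l x + (p x + j x) + 2 * n) tau)).
    apply: (geo_trans G1); move: G2.
    by under eq_fun do rewrite addn0.
  by apply/funext => x; congr (fpow _ _); clear; lia.
have B9 : dom (fun x => fpow (al + q x) sigma) (fun x => fpow (q x) sigma).
  split=> [x|]; first exact: fpow_ge0.
  under eq_fun do rewrite addnC.
  by apply: (@geo_fpow_shift _ _ _ _ _ _ 4 0); nat_bound.
have [_ G] := dom_mul (dom_mul dom_bin (dom_mul B1 (dom_mul (dom_mul (dom_mul B2 B3) B4) B5)))
  (dom_mul (dom_mul B7 B8) B9).
rewrite (_ : far_term = fun x => 'C(p x + j x, j x)%:R *
   (n%:R ^+ (l x + p x) * (2 ^+ (l x + p x) * H ^+ (p x + al + (l x + p x)) *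
     fpow (p x + al) rho2 * (fpow (l x + p x) rho1 / (l x + p x)`!%:R))) *
   (H ^+ (l x + p x + 2 * n + j x + (al + q x)) * fpow (l x + p x + 2 * n + j x) tau
    * fpow (al + q x) sigma)); last first.
  by apply/funext => x; rewrite /far_term !mulrA.
apply: (geo_trans G); apply: geo_le => x.
rewrite !mul1r /weight4.
rewrite (_ : _ * _ = (fpow (p x) (tau + rho1 - 1 + rho2) * fpow (j x) tau) *
   (fpow (l x) (tau + rho1 - 1)) * fpow (q x) sigma); last first.
  by rewrite !fpow_expD; ring.
apply: ler_pM; rewrite ?mulr_ge0 ?fpow_ge0 ?fpow_exp //.
apply: ler_pM; rewrite ?mulr_ge0 ?fpow_ge0 ?fpow_exp //.
apply: le_trans (merge x).
by apply: ler_pM; rewrite ?fpow_ge0 ?fpow_exp.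
Qed.

End exponents.

(** The binomial sum has [k + 1 <= 2 ^ k] terms. *)
Lemma sum_weight4_le {R : realType} (s t : R) (X : nat * nat * nat * nat -> R) (tau0 c D : R) (l k q : nat) :
  0 <= c -> 1 <= D ->
  (forall y, X y <= c * D ^+ order4 y * weight4 s t tau0 y) ->
  \sum_(j < k.+1) X (l, (k - j)%N, nat_of_ord j, q) <=
    c * (2 * D) ^+ (l + k + q) * (fpow k t * fpow l tau0 * fpow q s).
Proof.
move=> c0 D1 HX.
apply: (@le_trans _ _ (\sum_(j < k.+1) (c * D ^+ (l + k + q) * (fpow k t * fpow l tau0 * fpow q s)))).
  apply: ler_sum => j _; apply: le_trans (HX _) _.
  have jk : (j <= k)%N by rewrite -ltnS.
  by rewrite /order4 /weight4 /= subnK // -(addnA l) subnK.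
rewrite sumr_const card_ord -[leLHS]mulr_natl exprMn.
have D0 : 0 <= D by exact: le_trans D1.
rewrite [leRHS](_ : _ =
   2 ^+ (l + k + q) * (c * D ^+ (l + k + q) * (fpow k t * fpow l tau0 * fpow q s))); last by ring.
apply: ler_wpM2r; first by rewrite !mulr_ge0 ?exprn_ge0 ?fpow_ge0.
rewrite -natrX ler_nat (leq_trans (ltn_expl k (isT : (1 < 2)%N))) // leq_pexp2l //.
by rewrite addnAC leq_addl.
Qed.

Section gs_bounds.
Context {R : realType} {n : nat}.
Implicit Types (f g : 'rV[R]_n -> R) (x b : 'rV[R]_n) (c w v u : seq 'I_n).
Notation Omega := (rvint (@envelope R n)).

(** The real form of the norms, with weights in the sup norm and words instead of
    multi-indices. *)
Definition gs_bound (C H sigma tau : R) f : Prop := forall m w x,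
  `|x| ^+ m * `|'d_w f x| <= C * H ^+ (m + size w) * fpow m tau * fpow (size w) sigma.

Lemma gs_bound_schwartz C H sigma tau f :
  row_smooth f -> gs_bound C H sigma tau f -> rschwartz f.
Proof.
move=> sf bf; split=> // w; split; first by have [] := sf w.
by move=> M; exists (C * H ^+ (M + size w) * fpow M tau * fpow (size w) sigma) => x; exact: bf.
Qed.

Lemma gs_bound_ge0 C H sigma tau f : gs_bound C H sigma tau f -> 0 <= C.
Proof.
by move=> /(_ 0%N [::] 0); rewrite !expr0 mul1r !fpow0 !mulr1; exact: le_trans.
Qed.

Lemma continuous_affine f b (a : R) : continuous f -> continuous (fun x => f (b + a *: x)).
Proof.
move=> cf x; apply: (continuous_comp (f := fun y : 'rV[R]_n => b + a *: y)); last exact: cf.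
by apply: continuousD; [exact: cst_continuous|exact: continuousZr].
Qed.

Lemma corr_integrable f g b (a : R) : decays f -> decays g ->
  rvintegrable (fun x => f (b + a *: x) * g x).
Proof.
move=> [cf df] dg; have [K HK] := df 0%N.
apply: decays_integrable; apply: (@decays_bounded_mul _ _ _ _ K) => //.
  exact: continuous_affine.
by move=> x; have := HK (b + a *: x); rewrite expr0 mul1r.
Qed.

Section estimate.
Variables (al : nat) (H rho1 rho2 sigma tau s t tau1 tau2 : R).
Hypotheses (H1 : 1 <= H) (sigma0 : 0 <= sigma) (rho10 : 0 <= rho1).
Hypotheses (tau_1 : 1 <= tau) (rho2_1 : 1 <= rho2).
Hypotheses (sigma_s : sigma <= s) (sigma_tau2 : sigma + rho2 - 1 <= tau2).
Hypotheses (tau_t : tau <= t) (rho2_t : rho2 <= t).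
Hypotheses (rho1_tau1 : tau + rho1 - 1 <= tau1) (rho_t : tau + rho1 - 1 + rho2 <= t).

Let H0 : 0 <= H. Proof. exact: le_trans H1. Qed.

(** Small [a]: the powers [a ^ j] of the binomial formula are at most [1]. *)
Lemma corr_near : exists c D : R, [/\ 0 <= c, 1 <= D &
  forall f g A B u v b a i k l, row_smooth f -> row_smooth g ->
    gs_bound B H sigma tau f -> gs_bound A H rho1 rho2 g -> moments0 g ->
    size u = al -> 0 < a -> a <= 1 ->
    `|b ord0 i| ^+ k * `|corr ('d_(u ++ v) f) (wmul u g) b a| <=
    c * D ^+ (l + k + size v) * (A * B) * (fpow k t * fpow l tau2 * fpow (size v) s) * a ^+ l].
Proof.
have [c [D [c0 D1 HX]]] := near_term_geo n al H1 tau_1 sigma_s sigma_tau2 tau_t rho2_t.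
exists (2 ^+ n * Omega * c), (2 * D); split.
- by rewrite !mulr_ge0 ?exprn_ge0 // Omega_ge0.
- lra.
move=> f g A B u v b a i k l sf sg bf bg mg ual a0 a1.
have A0 := gs_bound_ge0 bg; have B0 := gs_bound_ge0 bf.
have dg := rschwartz_decays (gs_bound_schwartz sg bg).
pose P (j : nat) := B * 2 ^+ l * H ^+ (k - j + l + (al + size v)) * fpow (k - j) tau *
   fpow (l + (al + size v)) sigma.
pose Q (j : nat) := A * (H ^+ (l + 2 * n + j + al) * fpow (l + 2 * n + j + al) rho2).
have P0 j : (j <= k)%N -> 0 <= P j by move=> _; rewrite !mulr_ge0 ?exprn_ge0 ?fpow_ge0.
have HP j w y : (j <= k)%N -> size w = l ->
    `|'d_w (wmul (nseq (k - j) i) ('d_(u ++ v) f)) y| <= P j.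
  move=> jk wl.
  have := partials_wmul_le sf B0 H1 sigma0 tau_1 bf w (nseq (k - j) i) (u ++ v) y.
  by rewrite size_nseq size_cat ual wl.
have bg0 M x : `|x| ^+ M * `|g x| <= A * (H ^+ M * fpow M rho2).
  by have := bg M [::] x; rewrite rpartials_nil addn0 fpow0 mulr1 mulrA.
have wug M x : `|x| ^+ M * `|wmul u g x| <= A * (H ^+ (M + al) * fpow (M + al) rho2).
  apply: le_trans (bg0 (M + al)%N x); rewrite /wmul normrM mulrA exprD; apply: ler_wpM2r => //.
  by apply: ler_wpM2l; [rewrite exprn_ge0|rewrite -ual; exact: word_pow_le].
have rho20 : 0 <= rho2 by exact: le_trans rho2_1.
have Q2 j x : (j <= k)%N -> `|x| ^+ (l + 2 * n + j) * `|wmul u g x| <= Q j.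
  by move=> _; exact: wug.
have Q1 j x : (j <= k)%N -> `|x| ^+ (l + j) * `|wmul u g x| <= Q j.
  move=> _; apply: le_trans (wug _ _) _; apply: ler_wpM2l => //.
  have le : (l + j + al <= l + 2 * n + j + al)%N by rewrite leq_add2r leq_add2r leq_addr.
  by apply: ler_pM; rewrite ?exprn_ge0 ?fpow_ge0 ?fpow_mono // ler_weXn2l.
apply: le_trans (corr_weighted_bound (L := fun=> l) b (rsmooth_partials (u ++ v) sf)
   (decays_wmul u dg) (moments0_wmul u mg) (ltW a0) P0 HP Q1 Q2) _.
have S := sum_weight4_le l k (size v) c0 D1 HX.
set W := _ * _ * _ in S.
have K0 : 0 <= 2 ^+ n * Omega * (A * B) * a ^+ l.
  by rewrite !mulr_ge0 ?exprn_ge0 ?Omega_ge0 // ltW.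
apply: (@le_trans _ _ (2 ^+ n * Omega * (A * B) * a ^+ l *
    \sum_(j < k.+1) near_term n al H rho2 sigma tau (l, (k - j)%N, nat_of_ord j, size v))).
  rewrite mulr_sumr; apply: ler_sum => j _.
  have jk : (j <= k)%N by rewrite -ltnS.
  set Y := near_term _ _ _ _ _ _ _.
  have Y0 : 0 <= Y.
    by rewrite /Y /near_term /= !mulr_ge0 ?exprn_ge0 ?fpow_ge0 ?invr_ge0.
  rewrite [leLHS](_ : _ = a ^+ j * (2 ^+ n * Omega * (A * B) * a ^+ l * Y)); last first.
    by rewrite /Y /near_term /= subnK // /P /Q; ring.
  by apply: ler_piMl; [rewrite mulr_ge0|apply: exprn_ile1 => //; exact: ltW].
apply: le_trans (ler_wpM2l K0 S) _.
by rewrite /W le_eqVlt; apply/orP; left; apply/eqP; ring.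
Qed.

(** Large [a]: [b_i ^ k] is [a ^ k] times a power of the new translation
    parameter, and the expansion of order [l + k - j] provides, with the [a ^- j]
    of the binomial formula, exactly [a ^- (l + k)]. *)
Lemma corr_far : exists c D : R, [/\ 0 <= c, 1 <= D &
  forall f g A B u v b a i k l, row_smooth f -> row_smooth g ->
    gs_bound B H sigma tau f -> gs_bound A H rho1 rho2 g -> moments0 f ->
    size u = al -> 1 <= a ->
    `|b ord0 i| ^+ k * `|corr ('d_(u ++ v) f) (wmul u g) b a| <=
    c * D ^+ (l + k + size v) * (A * B) * (fpow k t * fpow l tau1 * fpow (size v) s) * a ^- l].
Proof.
have [c [D [c0 D1 HX]]] := far_term_geo n al H1 tau_1 sigma_s tau_t rho1_tau1 rho_t.
exists (2 ^+ n * Omega * c), (2 * D); split.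
- by rewrite !mulr_ge0 ?exprn_ge0 // Omega_ge0.
- lra.
move=> f g A B u v b a i k l sf sg bf bg mf ual a1.
have a0 : 0 < a by exact: lt_le_trans a1.
have A0 := gs_bound_ge0 bg; have B0 := gs_bound_ge0 bf.
have rg := gs_bound_schwartz sg bg; have rf := gs_bound_schwartz sf bf.
have dg := rschwartz_decays rg.
have dF : decays ('d_(u ++ v) f) := rf.2 _.
have dG : decays (wmul u g) := decays_wmul u dg.
have mF : moments0 ('d_(u ++ v) f) := moments0_partials _ rf mf.
rewrite (corr_swap a0 dF.1 dG.1 (corr_integrable b a dF dG)).
set b' := - (a^-1 *: b); set a' := a^-1.
have a'0 : 0 <= a' by rewrite invr_ge0 ltW.
have bb' : `|b ord0 i| ^+ k = a ^+ k * `|b' ord0 i| ^+ k.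
  rewrite /b' !mxE normrN normrM normfV (gtr0_norm a0) exprMn exprVn mulVKf //.
  by rewrite expf_neq0 // gt_eqF.
pose P (j : nat) := A * 2 ^+ (l + (k - j)) * H ^+ (k - j + al + (l + (k - j))) * fpow (k - j + al) rho2 *
   fpow (l + (k - j)) rho1.
pose Q (j : nat) := B * (H ^+ (l + (k - j) + 2 * n + j + (al + size v)) *
   fpow (l + (k - j) + 2 * n + j) tau * fpow (al + size v) sigma).
have P0 j : (j <= k)%N -> 0 <= P j by move=> _; rewrite !mulr_ge0 ?exprn_ge0 ?fpow_ge0.
have HP j w y : (j <= k)%N -> size w = (l + (k - j))%N ->
    `|'d_w (wmul (nseq (k - j) i) (wmul u g)) y| <= P j.
  move=> jk wl.
  have := partials_wmul_le sg A0 H1 rho10 rho2_1 bg w (nseq (k - j) i ++ u) [::] y.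
  by rewrite rpartials_nil wmul_cat size_cat size_nseq ual wl !addn0.
have tau0 : 0 <= tau by exact: le_trans tau_1.
have bF M x : `|x| ^+ M * `|'d_(u ++ v) f x| <= B * (H ^+ (M + (al + size v)) * fpow M tau * fpow (al + size v) sigma).
  by have := bf M (u ++ v) x; rewrite size_cat ual !mulrA.
have Q2 j x : (j <= k)%N -> `|x| ^+ (l + (k - j) + 2 * n + j) * `|'d_(u ++ v) f x| <= Q j.
  by move=> _; exact: bF.
have Q1 j x : (j <= k)%N -> `|x| ^+ (l + (k - j) + j) * `|'d_(u ++ v) f x| <= Q j.
  move=> _; apply: le_trans (bF _ _) _; apply: ler_wpM2l => //.
  have le : (l + (k - j) + j <= l + (k - j) + 2 * n + j)%N by rewrite leq_add2r leq_addr.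
  apply: ler_wpM2r; first exact: fpow_ge0.
  by apply: ler_pM; rewrite ?exprn_ge0 ?fpow_ge0 ?fpow_mono // ler_weXn2l // leq_add2r.
have CB := corr_weighted_bound (L := fun j => (l + (k - j))%N) b' (rsmooth_wmul u sg)
   dF mF a'0 P0 HP Q1 Q2.
have S := sum_weight4_le l k (size v) c0 D1 HX.
set W := _ * _ * _ in S.
have K0 : 0 <= 2 ^+ n * Omega * (A * B) * a' ^+ (l + k).
  by rewrite !mulr_ge0 ?exprn_ge0 ?Omega_ge0.
have {CB}CB : `|b' ord0 i| ^+ k * `|corr (wmul u g) ('d_(u ++ v) f) b' a'| <=
    2 ^+ n * Omega * (A * B) * a' ^+ (l + k) * W.
  apply: le_trans CB _; apply: le_trans (ler_wpM2l K0 S).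
  rewrite mulr_sumr; apply: ler_sum => j _.
  have jk : (j <= k)%N by rewrite -ltnS.
  set Y := far_term _ _ _ _ _ _ _ _.
  rewrite [leLHS](_ : _ = (2 ^+ n * Omega * (A * B) * a' ^+ (l + k) * Y)) //.
  rewrite -exprD (_ : (j + (l + (k - j)) = l + k)%N); last by rewrite addnCA subnKC.
  by rewrite /Y /far_term /= subnK // /P /Q; ring.
rewrite normrM bb' mulrACA normfV normrX (gtr0_norm a0).
have -> : a ^- l = a ^+ k * a' ^+ (l + k).
  rewrite /a' exprVn exprD invfM mulrCA mulfV ?mulr1 //.
  by rewrite expf_neq0 // gt_eqF.
apply: (@le_trans _ _ (a ^+ k * a ^- n * (2 ^+ n * Omega * (A * B) * a' ^+ (l + k) * W))).
  by apply: ler_wpM2l => //; rewrite mulr_ge0 ?invr_ge0 ?exprn_ge0 // ltW.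
rewrite (_ : a ^+ k * a ^- n * _ = a ^- n * (a ^+ k * (2 ^+ n * Omega * (A * B) * a' ^+ (l + k) * W))); last by ring.
rewrite [leRHS](_ : _ = a ^+ k * (2 ^+ n * Omega * (A * B) * a' ^+ (l + k) * W)); last first.
  by rewrite /W; ring.
have D0 : 0 <= D by exact: le_trans D1.
have W0 : 0 <= W by rewrite /W !(mulr_ge0, exprn_ge0, fpow_ge0).
apply: ler_piMl; first by apply: mulr_ge0; [rewrite exprn_ge0 // ltW|exact: mulr_ge0].
by rewrite invf_le1 ?exprn_gt0 // exprn_ege1.
Qed.

(** The weight is comparable with the maximum of [1] and a single coordinate. *)
Lemma japanese_le b k (X Y : R) : (0 < n)%N -> 0 <= X -> X <= Y ->
  (forall i, `|b ord0 i| ^+ k * X <= Y) -> japanese b ^+ k * X <= n.+1%:R ^+ k * Y.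
Proof.
move=> n0 X0 XY HY.
have jb : japanese b <= n.+1%:R * Num.max 1 `|b|.
  have M1 : 1 <= Num.max 1 `|b| by rewrite le_max lexx.
  have Mb : `|b| <= Num.max 1 `|b| by rewrite le_max lexx orbT.
  move: (Num.max _ _) M1 Mb => M M1 Mb; have M0 : 0 <= M by exact: le_trans M1.
  rewrite -[leRHS]ger0_norm ?mulr_ge0 // -sqrtr_sqr; apply: ler_wsqrtr.
  apply: (@le_trans _ _ (\sum_(i < n.+1) M ^+ 2)).
    rewrite big_ord_recl; apply: lerD; first exact: exprn_ege1.
    apply: ler_sum => i _; rewrite -real_normK ?num_real //.
    by apply: lerXn2r; rewrite ?nnegrE //; apply: le_trans Mb; exact: norm_coord.
  rewrite sumr_const card_ord -[leLHS]mulr_natl exprMn; apply: ler_wpM2r; first exact: sqr_ge0.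
  by rewrite -natrX ler_nat expnS expn1 leq_pmull.
have M0 : 0 <= Num.max 1 `|b| by rewrite le_max ler01.
apply: (@le_trans _ _ ((n.+1%:R * Num.max 1 `|b|) ^+ k * X)).
  apply: ler_wpM2r => //; apply: lerXn2r; rewrite ?nnegrE ?mulr_ge0 //.
  exact: sqrtr_ge0.
rewrite exprMn -mulrA; apply: ler_wpM2l; first by rewrite exprn_ge0.
case: (leP 1 `|b|) => b1; last by rewrite expr1n mul1r.
have [b0|[i ->]] := row_norm_attained b; last exact: HY.
by move: b1; rewrite b0 ler10.
Qed.

Lemma corr_estimate : (0 < n)%N -> exists c D : R, [/\ 0 <= c, 1 <= D &
  forall f g A B u v b a k l1 l2, row_smooth f -> row_smooth g ->
    gs_bound B H sigma tau f -> gs_bound A H rho1 rho2 g -> moments0 f -> moments0 g ->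
    size u = al -> 0 < a ->
    (a ^+ l1 + a ^- l2) * japanese b ^+ k * `|corr ('d_(u ++ v) f) (wmul u g) b a| <=
    c * D ^+ (size v + k + l1 + l2) * (A * B) *
      (fpow (size v) s * fpow k t * fpow l1 tau1 * fpow l2 tau2)].
Proof.
move=> n0.
have [c1 [D1 [c10 D11 N]]] := corr_near; have [c2 [D2 [c20 D21 F]]] := corr_far.
set c := c1 + c2; set D := D1 * D2.
have c0 : 0 <= c by rewrite addr_ge0.
have D1' : 1 <= D by exact: mulr_ege1.
have D0 : 0 <= D by exact: le_trans D1'.
have tau20 : 0 <= tau2 by apply: le_trans sigma_tau2; move: sigma0 rho2_1; lra.
have tau10 : 0 <= tau1 by apply: le_trans rho1_tau1; move: rho10 tau_1; lra.
have t0 : 0 <= t by apply: le_trans rho2_t; exact: le_trans rho2_1.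
exists (2 * c), (n.+1%:R * D); split; first by rewrite mulr_ge0.
  by apply: mulr_ege1 => //; rewrite ler1n.
move=> f g A B u v b a k l1 l2 sf sg bf bg mf mg ual a0.
have A0 := gs_bound_ge0 bg; have B0 := gs_bound_ge0 bf.
set X := `|corr _ _ b a|; set q := size v.
pose Y := 2 * c * D ^+ (q + k + l1 + l2) * (A * B) * (fpow q s * fpow k t * fpow l1 tau1 * fpow l2 tau2).
(* one power of one coordinate of b at a time *)
have H1c i k' : (k' <= k)%N -> `|b ord0 i| ^+ k' * ((a ^+ l1 + a ^- l2) * X) <= Y.
  move=> kk'.
  have cmp (c' D' : R) l (tau' : R) l' (tau'' : R) : 0 <= c' -> c' <= c -> 1 <= D' -> D' <= D ->
     0 <= tau'' -> (l + k' + q <= q + k + l1 + l2)%N ->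
     c' * D' ^+ (l + k' + q) * (A * B) * (fpow k' t * fpow l tau' * fpow q s) <=
     c * D ^+ (q + k + l1 + l2) * (A * B) * (fpow q s * fpow k t * (fpow l tau' * fpow l' tau'')).
    move=> c'0 c'c D'1 D'D t''0 le.
    have D'0 : 0 <= D' by exact: le_trans D'1.
    apply: ler_pM; rewrite ?(mulr_ge0, exprn_ge0, fpow_ge0) //.
      apply: ler_wpM2r; first by rewrite mulr_ge0.
      apply: ler_pM; rewrite ?exprn_ge0 //.
      apply: le_trans (_ : D ^+ (l + k' + q) <= _); last by rewrite ler_weXn2l.
      by apply: lerXn2r; rewrite ?nnegrE.
    rewrite (_ : fpow k' t * _ * _ = fpow q s * fpow k' t * (fpow l tau' * 1)); last by ring.
    apply: ler_pM; rewrite ?(mulr_ge0, exprn_ge0, fpow_ge0) //.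
      by apply: ler_wpM2l; rewrite ?fpow_ge0 ?fpow_mono.
    by apply: ler_wpM2l; rewrite ?fpow_ge0 ?fpow_ge1.
  have X0 : 0 <= `|b ord0 i| ^+ k' * X by rewrite mulr_ge0 ?exprn_ge0 ?normr_ge0.
  have S (e Z : R) : 0 < e -> a ^+ l1 + a ^- l2 <= 2 * e -> `|b ord0 i| ^+ k' * X <= Z * e^-1 ->
      2 * Z <= Y -> `|b ord0 i| ^+ k' * ((a ^+ l1 + a ^- l2) * X) <= Y.
    move=> e0 h1 h2 h3; apply: le_trans h3.
    rewrite mulrCA; apply: le_trans (ler_wpM2r X0 h1) _.
    rewrite -mulrA; apply: ler_wpM2l => //.
    by rewrite mulrC -ler_pdivlMr.
  have [a1|a1] := leP a 1.
    have N1 := N f g A B u v b a i k' l2 sf sg bf bg mg ual a0 a1.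
    apply: (S (a ^- l2)); [by rewrite invr_gt0 exprn_gt0| |by rewrite invrK; exact: N1|].
      have : a ^+ l1 <= 1 by apply: exprn_ile1 => //; exact: ltW.
      have : 1 <= a ^- l2 by rewrite invf_ge1 ?exprn_gt0 //; apply: exprn_ile1 => //; exact: ltW.
      lra.
    rewrite /Y -!mulrA; apply: ler_wpM2l => //; rewrite !mulrA.
    have := cmp c1 D1 l2 tau2 l1 tau1.
    rewrite [fpow l2 tau2 * fpow l1 tau1]mulrC !mulrA; apply => //.
    - by rewrite lerDl.
    - by apply: ler_peMr => //; exact: le_trans D11.
    - by rewrite -/q; move: kk'; generalize q; clear; move=> ? ?; lia.
  have F1 := F f g A B u v b a i k' l1 sf sg bf bg mf ual (ltW a1).
  apply: (S (a ^+ l1)); [by rewrite exprn_gt0| |exact: F1|].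
    have : 1 <= a ^+ l1 by apply: exprn_ege1; exact: ltW.
    have : a ^- l2 <= 1 by rewrite invf_le1 ?exprn_gt0 //; apply: exprn_ege1; exact: ltW.
    lra.
  rewrite /Y -!mulrA; apply: ler_wpM2l => //; rewrite !mulrA.
  have := cmp c2 D2 l1 tau1 l2 tau2; rewrite !mulrA; apply => //.
  - by rewrite lerDr.
  - by apply: ler_peMl => //; exact: le_trans D21.
  - by rewrite -/q; move: kk'; generalize q; clear; move=> ? ?; lia.
have Y0 : 0 <= Y by rewrite /Y !mulr_ge0 ?exprn_ge0 ?fpow_ge0.
rewrite mulrAC mulrC.
apply: le_trans (japanese_le (Y := Y) n0 _ _ (fun i => H1c i k (leqnn k))) _.
- by apply: mulr_ge0; [apply: addr_ge0; rewrite ?invr_ge0 exprn_ge0 // ltW|exact: normr_ge0].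
- by have := H1c (Ordinal n0) 0%N (leq0n k); rewrite expr0 mul1r.
have nk : n.+1%:R ^+ k <= n.+1%:R ^+ (q + k + l1 + l2) :> R.
  by rewrite ler_weXn2l ?ler1n //; generalize q; clear; move=> ?; lia.
have EM : (n.+1%:R * D) ^+ (q + k + l1 + l2) =
    n.+1%:R ^+ (q + k + l1 + l2) * D ^+ (q + k + l1 + l2) by exact: exprMn.
rewrite EM [leRHS](_ : _ = n.+1%:R ^+ (q + k + l1 + l2) * Y); last by rewrite /Y; ring.
exact: ler_wpM2r.
Qed.

End estimate.
End gs_bounds.

(** * Correlations are smooth on the half-space *)
Section corr_smooth.
Context {R : realType} {n : nat}.
Implicit Types (f g : 'rV[R]_n -> R) (x b : 'rV[R]_n) (c w v u : seq 'I_n).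
Implicit Types (z e : 'rV[R]_n * R).

Lemma rschwartz_bounded L f : rschwartz f ->
  exists K, 0 <= K /\ forall w x, size w = L -> `|'d_w f x| <= K.
Proof.
elim: L f => [|L IH] f sf.
  have [K HK] := (sf.2 [::]).2 0%N; exists K; split.
    by apply: le_trans (HK 0); rewrite expr0 mul1r.
  by move=> w x /size0nil ->; have := HK x; rewrite expr0 mul1r.
have /choice[K HK] i := IH _ (rschwartz_partials [:: i] sf).
exists (\sum_i K i); split; first by apply: sumr_ge0 => i _; have [] := HK i.
move=> w x; case/lastP: w => // w i; rewrite size_rcons => -[wL].
rewrite -rpartials_rcons; have [_ /(_ w x wL) /le_trans] := HK i; apply.
rewrite (bigD1 i) //= lerDl; apply: sumr_ge0 => j _; by have [] := HK j.
Qed.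

Lemma decays_norm g : decays g -> decays (fun x => `|g x|).
Proof.
move=> [cg dg]; split=> [x|M].
  by apply: (continuous_comp (cg x)); exact: norm_continuous.
by have [A HA] := dg M; exists A => x; rewrite normr_id.
Qed.

(** The constant in the integrated second-order Taylor estimates: the direction
    [e.1 + e.2 x] of the motion of [b + a x] grows linearly in [x]. *)
Definition moment2 g : R := rvint (fun x => 2 * (1 + `|x| ^+ 2) * `|g x|).

Lemma moment2_integrable g : decays g ->
  rvintegrable (fun x => 2 * (1 + `|x| ^+ 2) * `|g x|).
Proof.
move=> dg; have [cg Dg] := decays_norm dg; apply: decays_integrable; split=> [x|M].
  have cn : {for x, continuous (fun y : 'rV[R]_n => `|y|)} by exact: norm_continuous.
  have c2 := continuousM cn cn.
  have C := continuousM (continuousM (@cst_continuous _ _ (2 : R) x)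
     (continuousD (@cst_continuous _ _ (1 : R) x) c2)) (cg x).
  exact: C.
have [A0 H0] := Dg M; have [A2 H2] := Dg (M + 2)%N.
exists (2 * (A0 + A2)) => x.
have := H0 x; have := H2 x; rewrite normr_id exprD => h2 h0.
rewrite normrM normr_id ger0_norm; last by rewrite mulr_ge0 // addr_ge0 ?exprn_ge0.
rewrite [leLHS](_ : _ = 2 * (`|x| ^+ M * `|g x| + `|x| ^+ M * `|x| ^+ 2 * `|g x|)); last by ring.
by apply: ler_wpM2l => //; apply: lerD.
Qed.

Lemma moment2_le f g (C : R) : decays g -> continuous f -> 0 <= C ->
  (forall x, `|f x| <= C * (1 + `|x|) ^+ 2) ->
  rvintegrable (fun x => f x * g x) /\ `|rvint (fun x => f x * g x)| <= C * moment2 g.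
Proof.
move=> dg cf C0 Hf; have cg := dg.1.
have [I2 <-] := rvintZ C (moment2_integrable dg).
have B x : `|f x * g x| <= C * (2 * (1 + `|x| ^+ 2) * `|g x|).
  rewrite normrM mulrA; apply: ler_wpM2r => //; apply: le_trans (Hf x) _.
  apply: ler_wpM2l => //; have := sqr_ge0 (1 - `|x|); move: `|x| => y.
  rewrite !expr2; lra.
have I1 : rvintegrable (fun x => f x * g x).
  apply: (le_integrable measurableT _ _ I2).
    by apply/measurable_EFinP; apply: measurable_row => x; exact: continuousM (cf x) (cg x).
  move=> t _ /=; rewrite lee_fin; apply: le_trans (B _) _; exact: ler_norm.
by split=> //; exact: rvint_norm_le.
Qed.

Definition corrz f g z : R := corr f g z.1 z.2.

Let shift_dir z e (t : R) x :
  (z + t *: e).1 + (z + t *: e).2 *: x = (z.1 + z.2 *: x) + t *: (e.1 + e.2 *: x).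
Proof. by rewrite /= scalerDl scalerDr scalerA addrACA. Qed.

Let dir_le e x : `|e.1| <= 1 -> `|e.2| <= 1 -> `|e.1 + e.2 *: x| <= 1 + `|x|.
Proof.
move=> e1 e2; apply: le_trans (ler_normD _ _) _; apply: lerD => //.
by rewrite normrZ ler_piMl.
Qed.

(** Differentiation under the integral sign, by integrating the quadratic Taylor
    remainder against [g]. *)
Lemma is_derive_corrz f g z e : rschwartz f -> decays g -> `|e.1| <= 1 -> `|e.2| <= 1 ->
  is_derive z e (corrz f g)
    (rvint (fun x => (\sum_i (e.1 + e.2 *: x) ord0 i * 'd_[:: i] f (z.1 + z.2 *: x)) * g x)).
Proof.
move=> sf dg e1 e2.
have [K [K0 HK]] := rschwartz_bounded 2 sf.
have [K1 [K10 HK1]] := rschwartz_bounded 1 sf.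
have df := rschwartz_decays sf.
have cd i : continuous ('d_[:: i] f) by have [] := sf.2 [:: i].
pose S x := \sum_i (e.1 + e.2 *: x) ord0 i * 'd_[:: i] f (z.1 + z.2 *: x).
have cS : continuous S.
  apply: continuous_bigsum => i x.
  have := continuousM (@continuous_affine R n _ e.1 e.2 (@continuous_coord R n i) x)
     (@continuous_affine R n _ z.1 z.2 (cd i) x).
  exact.
have SB x : `|S x| <= n%:R * K1 * (1 + `|x|) ^+ 2.
  apply: le_trans (ler_norm_sum _ _ _) _.
  apply: (@le_trans _ _ (\sum_(i < n) ((1 + `|x|) * K1))).
    apply: ler_sum => i _; rewrite normrM; apply: ler_pM => //; last exact: HK1.
    by apply: le_trans (norm_coord _ _) _; exact: dir_le.
  rewrite sumr_const card_ord -[leLHS]mulr_natl -[leRHS]mulrA [K1 * _]mulrC.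
  apply: ler_wpM2l => //; apply: ler_wpM2r => //.
  by rewrite expr2 ler_peMl ?addr_ge0 // lerDl.
have [SI _] := moment2_le dg cS (mulr_ge0 (ler0n R n) K10) SB.
pose C := n%:R ^+ 2 * K.
apply: (@is_derive_quadratic _ _ _ _ _ _ (C * moment2 g)) => t _.
pose F x := f ((z + t *: e).1 + (z + t *: e).2 *: x) - f (z.1 + z.2 *: x) - t * S x.
have cF : continuous F.
  move=> x; have := continuousB (continuousB (@continuous_affine R n _ (z + t *: e).1 (z + t *: e).2 df.1 x)
    (@continuous_affine R n _ z.1 z.2 df.1 x)) (continuousM (@cst_continuous _ _ t x) (cS x)).
  exact.
have FB x : `|F x| <= (t ^+ 2 * C) * (1 + `|x|) ^+ 2.
  rewrite /F shift_dir; set y := z.1 + _; set v := t *: _.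
  have := taylor_row (L := 2) y v sf.1 (fun w y => HK w y).
  rewrite !big_ord_recl big_ord0 /= fact0 !divr1 addr0 opprD addrA.
  have -> : \sum_i v ord0 i * 'd_[:: i] f y = t * S x.
    by rewrite /S mulr_sumr; apply: eq_bigr => i _; rewrite /v mxE mulrA.
  move=> /le_trans; apply.
  have vB : `|v| ^+ 2 <= t ^+ 2 * (1 + `|x|) ^+ 2.
    rewrite /v normrZ exprMn real_normK ?num_real //; apply: ler_wpM2l; first exact: sqr_ge0.
    by apply: lerXn2r; rewrite ?nnegrE ?addr_ge0 //; exact: dir_le.
  apply: (@le_trans _ _ (n%:R ^+ 2 * `|v| ^+ 2 * K)).
    by rewrite ler_piMr ?invf_le1 ?ltr0n ?fact_gt0 ?ler1n ?fact_gt0 // !mulr_ge0 ?exprn_ge0.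
  rewrite /C [leRHS](_ : _ = n%:R ^+ 2 * (t ^+ 2 * (1 + `|x|) ^+ 2) * K); last by ring.
  by apply: ler_wpM2r => //; apply: ler_wpM2l => //; rewrite exprn_ge0.
have tC0 : 0 <= t ^+ 2 * C by rewrite mulr_ge0 ?sqr_ge0 // mulr_ge0 // exprn_ge0.
have [FI FE] := moment2_le dg cF tC0 FB.
have I1 := corr_integrable z.1 z.2 df dg.
have I2 := corr_integrable (z + t *: e).1 (z + t *: e).2 df dg.
have [I3 E3] := rvintZ (- 1) I1; have [I4 E4] := rvintZ (- t) SI.
have [I5 E5] := rvintD I2 I3; have [I6 E6] := rvintD I5 I4.
have E : corrz f g (z + t *: e) - corrz f g z - t * rvint (fun x => S x * g x) =
    rvint (fun x => F x * g x).
  rewrite (_ : (fun x => F x * g x) = fun x => f ((z + t *: e).1 + (z + t *: e).2 *: x) * g x +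
    -1 * (f (z.1 + z.2 *: x) * g x) + - t * (S x * g x)).
    by rewrite E6 E5 E3 E4 /corrz /corr; ring.
  by apply/funext => x; rewrite /F; ring.
rewrite E; apply: le_trans FE _; rewrite le_eqVlt; apply/orP; left; apply/eqP; ring.
Qed.

Lemma continuous_corrz f g : rschwartz f -> decays g -> continuous (corrz f g).
Proof.
move=> sf dg z; have [K [K0 HK]] := rschwartz_bounded 1 sf.
have df := rschwartz_decays sf.
have M0 : 0 <= moment2 g.
  by apply: Rintegral_ge0 => t _; rewrite !mulr_ge0 // addr_ge0 ?exprn_ge0.
set C := n%:R * K * moment2 g.
have C0 : 0 <= C by rewrite !mulr_ge0.
have C1 : 0 < C + 1 by rewrite ltr_pwDr.
have L z' : `|corrz f g z - corrz f g z'| <= C * `|z - z'|.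
  have I1 := corr_integrable z.1 z.2 df dg; have I2 := corr_integrable z'.1 z'.2 df dg.
  have [I3 E3] := rvintZ (- 1) I2; have [I4 E4] := rvintD I1 I3.
  pose F x := f (z.1 + z.2 *: x) - f (z'.1 + z'.2 *: x).
  have -> : corrz f g z - corrz f g z' = rvint (fun x => F x * g x).
    rewrite (_ : (fun x => F x * g x) = fun x => f (z.1 + z.2 *: x) * g x + -1 * (f (z'.1 + z'.2 *: x) * g x)).
      by rewrite E4 E3 /corrz /corr; ring.
    by apply/funext => x; rewrite /F; ring.
  have cF : continuous F.
    by move=> x; have := continuousB (@continuous_affine R n _ z.1 z.2 df.1 x) (@continuous_affine R n _ z'.1 z'.2 df.1 x); exact.
  have FB x : `|F x| <= (n%:R * K * `|z - z'|) * (1 + `|x|) ^+ 2.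
    have -> : F x = f ((z'.1 + z'.2 *: x) + ((z - z').1 + (z - z').2 *: x)) - f (z'.1 + z'.2 *: x).
      by rewrite /F /= scalerBl addrACA !(addrC _ (_ - _)) !subrK.
    apply: le_trans (lipschitz_row _ _ sf.1 (fun i y => HK [:: i] y erefl)) _.
    rewrite -!mulrA; apply: ler_wpM2l => //; apply: ler_wpM2l => //.
    apply: le_trans (ler_normD _ _) _; rewrite normrZ.
    have h1 : `|(z - z').1| <= `|z - z'| by rewrite [leRHS]prod_normE le_max lexx.
    have h2 : `|(z - z').2| <= `|z - z'| by rewrite [leRHS]prod_normE le_max lexx orbT.
    apply: (@le_trans _ _ (`|z - z'| * (1 + `|x|))).
      by rewrite mulrDr mulr1; apply: lerD => //; apply: ler_wpM2r.
    by apply: ler_wpM2l => //; rewrite expr2 ler_peMl ?addr_ge0 // lerDl.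
  have C'0 : 0 <= n%:R * K * `|z - z'| by rewrite !mulr_ge0.
  have [_ FE] := moment2_le dg cF C'0 FB.
  by apply: le_trans FE _; rewrite /C le_eqVlt; apply/orP; left; apply/eqP; ring.
apply/cvgrPdist_le => eps eps0.
have r0 : 0 < eps / (C + 1) by exact: divr_gt0.
apply: filterS (nbhsx_ballx z _ r0) => z'.
rewrite -ball_normE /= ltr_pdivlMr // => zz'; apply: le_trans (L z') _.
apply: le_trans (ltW zz'); rewrite mulrC; apply: ler_wpM2l => //; by rewrite lerDl.
Qed.

End corr_smooth.

Section half_space_jet.
Context {R : realType} {n : nat}.
Implicit Types (f g : 'rV[R]_n -> R) (c w v u : seq 'I_n) (W : seq (option 'I_n)).
Implicit Types (z : 'rV[R]_n * R) (p : seq 'I_n * seq 'I_n).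

(** [Some i] differentiates in [b_i], [None] in [a]; the latter gives, for every
    coordinate [i], a derivative on [f] and a factor [x_i] on [g]. *)
Definition dir_terms (o : option 'I_n) p : seq (seq 'I_n * seq 'I_n) :=
  if o is Some i then [:: (i :: p.1, p.2)]
  else [seq (i :: p.1, i :: p.2) | i <- index_enum 'I_n].

(** The derivative of [corrz f g] along the word [W] is the sum of the
    correlations of ['d_v f] and [wmul u g] over the pairs [(v, u)] below. *)
Fixpoint jet_terms W : seq (seq 'I_n * seq 'I_n) :=
  if W is o :: W' then flatten [seq dir_terms o p | p <- jet_terms W']
  else [:: ([::], [::])].

Definition jet_sum f g (s : seq (seq 'I_n * seq 'I_n)) z : R :=
  \sum_(p <- s) corrz ('d_p.1 f) (wmul p.2 g) z.

Lemma jet_sum_nil f g z : jet_sum f g [::] z = 0.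
Proof. by rewrite /jet_sum big_nil. Qed.

Lemma jet_sum_cons f g p s z :
  jet_sum f g (p :: s) z = corrz ('d_p.1 f) (wmul p.2 g) z + jet_sum f g s z.
Proof. by rewrite /jet_sum big_cons. Qed.

Lemma jet_sum_cat f g s s' z : jet_sum f g (s ++ s') z = jet_sum f g s z + jet_sum f g s' z.
Proof. by rewrite /jet_sum big_cat. Qed.

Lemma is_derive_corrz_dir f g o p z : rschwartz f -> decays g ->
  is_derive z (hs_dir o) (corrz ('d_p.1 f) (wmul p.2 g)) (jet_sum f g (dir_terms o p) z).
Proof.
move=> sf dg; case: p => v u /=.
have sv := rschwartz_partials v sf; have du := decays_wmul u dg.
have e12 : `|(hs_dir o : 'rV[R]_n * R).1| <= 1 /\ `|(hs_dir o : 'rV[R]_n * R).2| <= 1.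
  by case: o => [i|] /=; rewrite ?normr0 ?normr1 ?ler01 //; split=> //; exact: norm_unitv.
apply: (is_derive_eq (is_derive_corrz z sv du e12.1 e12.2)).
case: o {e12} => [i|] /=.
  rewrite jet_sum_cons jet_sum_nil addr0 /= -rpartials_cons /corrz /corr.
  congr (rvint _); apply/funext => x; congr (_ * _).
  rewrite (bigD1 i) //= big1 ?addr0 => [|j ji].
    by rewrite !mxE !eqxx /= mul0r addr0 mul1r.
  by rewrite !mxE eqxx /= (negbTE ji) mul0r add0r mul0r.
rewrite /jet_sum big_map /=.
have I i := corr_integrable z.1 z.2 (sf.2 (i :: v)) (decays_wmul (i :: u) dg).
have [_ <-] := rvint_sum (index_enum 'I_n) I.
congr (rvint _); apply/funext => x; rewrite mulr_suml; apply: eq_bigr => i _.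
by rewrite !mxE mul1r add0r rpartials_cons /wmul word_pow_cons; ring.
Qed.

Lemma is_derive_jet_sum f g o s z : rschwartz f -> decays g ->
  is_derive z (hs_dir o) (jet_sum f g s) (jet_sum f g (flatten [seq dir_terms o p | p <- s]) z).
Proof.
move=> sf dg; elim: s => [|p s IH].
  rewrite (_ : jet_sum f g [::] = cst 0); first by exact: is_derive_cst.
  by apply/funext => y; rewrite jet_sum_nil.
rewrite /= jet_sum_cat.
rewrite (_ : jet_sum f g (p :: s) = corrz ('d_p.1 f) (wmul p.2 g) + jet_sum f g s).
  by apply: is_deriveD; exact: is_derive_corrz_dir.
by apply/funext => y; rewrite jet_sum_cons.
Qed.

Lemma continuous_jet_sum f g s : rschwartz f -> decays g -> continuous (jet_sum f g s).
Proof.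
move=> sf dg; elim: s => [|p s IH] z.
  rewrite (_ : jet_sum f g [::] = cst 0); first exact: cst_continuous.
  by apply/funext => y; rewrite jet_sum_nil.
rewrite (_ : jet_sum f g (p :: s) = corrz ('d_p.1 f) (wmul p.2 g) + jet_sum f g s).
  apply: continuousD; last exact: IH.
  by apply: continuous_corrz; [exact: rschwartz_partials|exact: decays_wmul].
by apply/funext => y; rewrite jet_sum_cons.
Qed.

Lemma corrz_jet f g : rschwartz f -> decays g ->
  (@rsmooth R _ _ (@hs_dir R n) (corrz f g)) /\
  forall W, rpartials (@hs_dir R n) W (corrz f g) = jet_sum f g (jet_terms W).
Proof.
move=> sf dg.
have E : corrz f g = jet_sum f g (jet_terms [::]).
  by apply/funext => z; rewrite /= jet_sum_cons jet_sum_nil addr0 /= rpartials_nil wmul_nil.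
rewrite E; apply: (rsmooth_jet (F := fun W => jet_sum f g (jet_terms W))) => [W|W o z].
  exact: continuous_jet_sum.
exact: is_derive_jet_sum.
Qed.

Lemma jet_terms_deriv al v p : p \in jet_terms (nseq al None ++ map Some v) ->
  p.1 = p.2 ++ v /\ size p.2 = al.
Proof.
elim: al p => [|al IH] p /=.
  suff -> : jet_terms (map Some v) = [:: (v, [::])] by rewrite inE => /eqP ->.
  by elim: v => //= i v ->.
move=> /flatten_mapP[q /IH[q1 q2]] /mapP[i _ ->] /=.
by rewrite q1 q2.
Qed.

Lemma size_jet_terms al v : size (jet_terms (nseq al None ++ map Some v)) = (n ^ al)%N.
Proof.
elim: al => [|al IH] /=.
  suff -> : jet_terms (map Some v) = [:: (v, [::])] by [].
  by elim: v => //= i v ->.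
rewrite size_flatten /shape -map_comp sumnE big_map.
rewrite (eq_bigr (fun=> n)) => [|p _ /=]; last first.
  by rewrite size_map -[RHS](size_enum_ord n) enumT.
by rewrite big_const_seq count_predT iter_addn_0 IH expnS.
Qed.

End half_space_jet.

(** * Real and imaginary parts *)
Import Normc.
Local Open Scope complex_scope.
Local Notation ReF f := (@complex.Re _ \o f).
Local Notation ImF f := (@complex.Im _ \o f).
Local Notation csmooth f := (smooth_on unitv setT f).

Section complex_parts.
Context {R : realType}.
Notation C := R[i].

Lemma Re_le_normc (z : C) : `|complex.Re z| <= normc z.
Proof.
case: z => x y /=; rewrite -sqrtr_sqr; apply: ler_wsqrtr.
by rewrite lerDl sqr_ge0.
Qed.

Lemma Im_le_normc (z : C) : `|complex.Im z| <= normc z.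
Proof.
case: z => x y /=; rewrite -sqrtr_sqr; apply: ler_wsqrtr.
by rewrite lerDr sqr_ge0.
Qed.

Lemma normc_le_ReIm (z : C) : normc z <= `|complex.Re z| + `|complex.Im z|.
Proof.
case: z => x y /=.
rewrite -[leRHS]ger0_norm ?addr_ge0 // -sqrtr_sqr; apply: ler_wsqrtr.
rewrite -(real_normK (num_real x)) -(real_normK (num_real y)).
move: (normr_ge0 x) (normr_ge0 y); move: `|x| `|y| => u v u0 v0.
have : 0 <= u * v by rewrite mulr_ge0.
rewrite !expr2; lra.
Qed.

Lemma normc_nneg (z : C) : 0 <= normc z.
Proof. by case: z => x y; exact: sqrtr_ge0. Qed.

Lemma normc_real (r : R) : normc (r%:C) = `|r|.
Proof. by rewrite /= expr0n addr0 sqrtr_sqr. Qed.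

Lemma Re_scale (r : R) (z : C) : complex.Re (r%:C * z) = r * complex.Re z.
Proof. by case: z => x y /=; rewrite mul0r subr0. Qed.

Lemma Im_scale (r : R) (z : C) : complex.Im (r%:C * z) = r * complex.Im z.
Proof. by case: z => x y /=; rewrite mul0r addr0. Qed.

Section directions.
Context {V : normedModType R} {I : eqType} (e : I -> V).
Implicit Types (f : V -> C) (w : seq I).

Lemma cpartialsE w f : cpartials e w f =
  fun x => Complex (rpartials e w (ReF f) x) (rpartials e w (ImF f) x).
Proof.
elim: w => [|i w IH]; first by apply/funext => x /=; rewrite !rpartials_nil /=; case: (f x).
rewrite /= IH; apply/funext => x; rewrite /cpartial.
by congr Complex; rewrite rpartials_consE.
Qed.

Lemma smooth_onT f : smooth_on e setT f <-> rsmooth e (ReF f) /\ rsmooth e (ImF f).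
Proof.
have ER w : ReF (cpartials e w f) = rpartials e w (ReF f).
  by apply/funext => x; rewrite cpartialsE.
have EI w : ImF (cpartials e w f) = rpartials e w (ImF f).
  by apply/funext => x; rewrite cpartialsE.
split=> [sf|[sr si] w x _].
  split=> w; split=> [x|i x].
  - by have [] := sf w x Logic.I; rewrite ER.
  - have [_ _ /(_ i)[D _]] := sf w x Logic.I.
    by rewrite ER in D; rewrite rpartials_consE; exact: derivableP.
  - by have [_] := sf w x Logic.I; rewrite EI.
  - have [_ _ /(_ i)[_ D]] := sf w x Logic.I.
    by rewrite EI in D; rewrite rpartials_consE; exact: derivableP.
rewrite ER EI; split; [exact: (sr w).1|exact: (si w).1|].
by move=> i; split; [have [] := (sr w).2 i x|have [] := (si w).2 i x].
Qed.

Let near_eq_continuous (g h : V -> R) x : {near x, g =1 h} ->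
  {for x, continuous g} -> {for x, continuous h}.
Proof.
move=> gh; have ghx : g x = h x by exact: (nbhs_singleton gh).
move=> cg; have {}cg : g y @[y --> x] --> h x by rewrite -ghx; exact: cg.
apply: cvg_trans cg.
exact: near_eq_cvg.
Qed.

(** Derivatives only depend on a function near the point, so a function that
    agrees on an open set with a smooth one inherits its partials there. *)
Lemma cpartials_local (D : set V) f (r s : V -> R) : open D ->
  rsmooth e r -> rsmooth e s -> (forall x, D x -> f x = Complex (r x) (s x)) ->
  smooth_on e D f /\
  forall w x, D x -> cpartials e w f x = Complex (rpartials e w r x) (rpartials e w s x).
Proof.
move=> oD sr ss fE.
have nD x : D x -> \forall y \near x, D y by move=> Dx; exact: open_nbhs_nbhs.
have E w x : D x -> cpartials e w f x = Complex (rpartials e w r x) (rpartials e w s x).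
  elim: w x => [|i w IH] x Dx; first by rewrite !rpartials_nil /=; exact: fE.
  rewrite /= /cpartial !rpartials_consE.
  by congr Complex; apply: near_eq_derive; near=> y => /=; rewrite IH //; near: y; exact: nD.
split=> // w x Dx.
have ER : {near x, rpartials e w r =1 ReF (cpartials e w f)}.
  by near=> y => /=; rewrite E //; near: y; exact: nD.
have EI : {near x, rpartials e w s =1 ImF (cpartials e w f)}.
  by near=> y => /=; rewrite E //; near: y; exact: nD.
split.
- exact: near_eq_continuous ER ((sr w).1 x).
- exact: near_eq_continuous EI ((ss w).1 x).
- move=> i; split.
    by apply: (near_eq_derivable ER); have [] := (sr w).2 i x.
  by apply: (near_eq_derivable EI); have [] := (ss w).2 i x.
Unshelve. all: by end_near. Qed.

End directions.
End complex_parts.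

(** * The Gelfand-Shilov norms *)
Section gelfand_shilov_bounds.
Context {R : realType} {n : nat}.
Notation C := R[i].
Implicit Types (phi psi : 'rV[R]_n -> C) (x : 'rV[R]_n) (w : seq 'I_n).

Lemma mderivE b phi x : mderiv b phi x =
  Complex ('d_(mword b) (ReF phi) x) ('d_(mword b) (ImF phi) x).
Proof. exact: (congr1 (@^~ x) (cpartialsE (@unitv R n) (mword b) phi)). Qed.

Lemma mpow_count x w : mpow x (fun i => count_mem i w) = word_pow w x.
Proof.
rewrite /mpow /word_pow; elim: w => [|j w IH].
  by rewrite big_nil big1.
rewrite big_cons -IH (bigD1 j) //= eqxx exprS -mulrA; congr (_ * _).
rewrite [RHS](bigD1 j) //=; congr (_ * _); apply: eq_bigr => i ij.
by rewrite eq_sym (negbTE ij).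
Qed.

Lemma gs_normP rho1 rho2 h phi (M : R) : (gs_norm rho1 rho2 h phi <= M%:E)%E <->
  forall x (a b : 'I_n -> nat), h ^+ (mabs a + mabs b) /
       ((mfact a)%:R `^ rho2 * (mfact b)%:R `^ rho1) *
     normc ((mpow x a)%:C * mderiv b phi x) <= M.
Proof.
split=> [H x a b|H].
  rewrite -lee_fin; apply: le_trans H; apply: ereal_sup_ubound.
  by exists x, a, b.
by apply: ge_ereal_sup => _ [x [a [b ->]]]; rewrite lee_fin.
Qed.

Lemma gs_norm_ge0 rho1 rho2 h phi : 0 <= h -> (0 <= gs_norm rho1 rho2 h phi)%E.
Proof.
move=> h0; apply: le_trans (_ : (0 <= (h ^+ (mabs (fun=> 0%N) + mabs (fun=> 0%N)) /
   ((mfact (fun=> 0%N))%:R `^ rho2 * (mfact (fun=> 0%N))%:R `^ rho1) *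
     normc ((mpow 0 (fun=> 0%N))%:C * mderiv (fun=> 0%N) phi 0))%:E)%E) _.
  rewrite lee_fin; apply: mulr_ge0; last exact: normc_nneg.
  by apply: divr_ge0; [rewrite exprn_ge0|rewrite mulr_ge0 ?powR_ge0].
by apply: ereal_sup_ubound; exists 0, (fun=> 0%N), (fun=> 0%N).
Qed.

Lemma mfact_count_le w : (mfact (fun i => count_mem i w) <= (size w)`!)%N.
Proof.
rewrite -(mabs_count w) /mfact /mabs.
elim/big_ind2: _ => // m1 n1 m2 n2 H1 H2.
by apply: leq_trans (leq_mul H1 H2) _; rewrite -(bin_fact (leq_addr m2 m1)) addKn leq_pmull // bin_gt0 leq_addr.
Qed.

Lemma row_norm_coord x : (0 < n)%N -> exists i, `|x| = `|x ord0 i|.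
Proof.
move=> n0; have [x0|//] := row_norm_attained x; exists (Ordinal n0).
by apply/eqP; rewrite eq_le norm_coord andbT x0.
Qed.

(** [|x| ^ m] is the absolute value of a power of one coordinate, and partials
    along a word are those along its multi-index. *)
Lemma gs_norm_gs_bound rho1 rho2 h phi (M : R) : (0 < n)%N -> 0 < h -> 0 <= rho1 ->
  row_smooth (ReF phi) -> row_smooth (ImF phi) -> (gs_norm rho1 rho2 h phi <= M%:E)%E ->
  gs_bound M (Num.max 1 h^-1) rho1 rho2 (ReF phi) /\
  gs_bound M (Num.max 1 h^-1) rho1 rho2 (ImF phi).
Proof.
move=> n0 h0 r0 sr si /gs_normP HM.
set H := Num.max 1 h^-1.
have H1 : 1 <= H by rewrite le_max lexx.
have H0 : 0 <= H by exact: le_trans H1.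
suff K m w x : `|x| ^+ m * normc (Complex ('d_w (ReF phi) x) ('d_w (ImF phi) x)) <=
    M * H ^+ (m + size w) * fpow m rho2 * fpow (size w) rho1.
  split=> m w x; apply: le_trans (K m w x); apply: ler_wpM2l; rewrite ?exprn_ge0 //.
    exact: (Re_le_normc (Complex _ _)).
  exact: (Im_le_normc (Complex _ _)).
have [i xi] := row_norm_coord x n0.
pose a (j : 'I_n) := if j == i then m else 0%N.
have aE : mabs a = m.
  by rewrite /mabs (bigD1 i) //= /a eqxx big1 ?addn0 // => j /negbTE ->.
have fE : mfact a = m`!.
  by rewrite /mfact (bigD1 i) //= /a eqxx big1 ?muln1 // => j /negbTE ->.
have pE : mpow x a = x ord0 i ^+ m.
  by rewrite /mpow (bigD1 i) //= /a eqxx big1 ?mulr1 // => j /negbTE ->; rewrite expr0.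
have := HM x a (fun j => count_mem j w).
rewrite mderivE -(rpartials_perm sr (perm_mword w)) -(rpartials_perm si (perm_mword w)).
rewrite aE fE pE mabs_count; set z := Complex _ _; move=> Hz.
have -> : `|x| ^+ m * normc z = normc ((x ord0 i ^+ m)%:C * z).
  by rewrite normcM normc_real normrX -xi.
move: Hz; set N := normc _ => Hz.
pose D : R := m`!%:R `^ rho2 * (mfact (fun j => count_mem j w))%:R `^ rho1.
rewrite -/D in Hz.
have D0 : 0 < D by rewrite mulr_gt0 // powR_gt0 // ltr0n ?fact_gt0 // prodn_gt0 // => j; rewrite fact_gt0.
have hm : 0 < h ^+ (m + size w) by rewrite exprn_gt0.
have {}Hz : N <= M * (h^-1) ^+ (m + size w) * D.
  by rewrite exprVn mulrAC ler_pdivlMr // mulrC -ler_pdivrMr // mulrAC.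
have N0 : 0 <= N by exact: normc_nneg.
have M0 : 0 <= M.
  have := le_trans N0 Hz; rewrite -mulrA pmulr_lge0 // mulr_gt0 // exprn_gt0 // invr_gt0 //.
apply: le_trans Hz _; rewrite -[leRHS]mulrA.
have h10 : 0 <= h^-1 by rewrite invr_ge0 ltW.
apply: ler_pM; [by rewrite mulr_ge0 ?exprn_ge0|exact: ltW| |].
  apply: ler_wpM2l => //; apply: lerXn2r; rewrite ?nnegrE //.
  by rewrite le_max lexx orbT.
apply: ler_wpM2l; first exact: powR_ge0.
apply: ge0_ler_powR; rewrite ?nnegrE //.
by rewrite ler_nat mfact_count_le.
Qed.

End gelfand_shilov_bounds.

(** * The wavelet transform *)
Section wavelet_transform.
Context {R : realType} {n : nat}.
Notation C := R[i].
Implicit Types (phi psi : 'rV[R]_n -> C) (x b : 'rV[R]_n) (z : 'rV[R]_n * R).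

Definition cschwartz phi : Prop := rschwartz (ReF phi) /\ rschwartz (ImF phi).

Definition cmoments0 phi : Prop :=
  forall m : 'I_n -> nat, cintegral (fun x => (mpow x m)%:C * phi x) = 0.

Lemma mpow_mword x (m : 'I_n -> nat) : mpow x m = word_pow (mword m) x.
Proof.
rewrite -mpow_count; apply: eq_bigr => i _; by rewrite count_mword.
Qed.

Lemma cintegralE (f : 'rV[R]_n -> C) : cintegral f = Complex (rvint (ReF f)) (rvint (ImF f)).
Proof. by []. Qed.

Lemma cmoments0P phi : cmoments0 phi <-> moments0 (ReF phi) /\ moments0 (ImF phi).
Proof.
have ER m : ReF (fun x => (mpow x m)%:C * phi x) = wmul (mword m) (ReF phi).
  by apply/funext => x; rewrite [LHS]Re_scale mpow_mword.
have EI m : ImF (fun x => (mpow x m)%:C * phi x) = wmul (mword m) (ImF phi).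
  by apply/funext => x; rewrite [LHS]Im_scale mpow_mword.
split=> [H|[Hr Hi] m]; last by rewrite cintegralE ER EI Hr Hi.
have W (w : seq 'I_n) (f : 'rV[R]_n -> R) : wmul w f = wmul (mword (fun i => count_mem i w)) f.
  by apply/funext => x; rewrite /wmul -mpow_mword mpow_count.
by split=> w; have := H (fun i => count_mem i w); rewrite cintegralE ER EI => -[h1 h2]; rewrite W.
Qed.

Definition wave_re psi phi z : R :=
  1 * corrz (ReF phi) (ReF psi) z + 1 * corrz (ImF phi) (ImF psi) z.
Definition wave_im psi phi z : R :=
  1 * corrz (ImF phi) (ReF psi) z + (- 1) * corrz (ReF phi) (ImF psi) z.

(** The substitution [y = b + a x] moves the scaling from the wavelet to the
    analysed function. *)
Lemma waveletE psi phi b (a : R) : cschwartz psi -> cschwartz phi -> 0 < a ->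
  wavelet psi phi b a = Complex (wave_re psi phi (b, a)) (wave_im psi phi (b, a)).
Proof.
move=> [pr pi] [fr fi] a0.
have D := @rschwartz_decays R n.
have dpr := D _ pr; have dpi := D _ pi; have dfr := D _ fr; have dfi := D _ fi.
pose T x := a^-1 *: (x - b).
have TK x : T (b + a *: x) = x.
  by rewrite /T [b + _]addrC addrK scalerA mulVf ?scale1r // gt_eqF.
have cT (f : 'rV[R]_n -> R) : continuous f -> continuous (fun x => f (T x)).
  move=> cf x; have := @continuous_affine R n f (- (a^-1 *: b)) a^-1 cf x.
  rewrite (_ : (fun y => f (- (a^-1 *: b) + a^-1 *: y)) = (fun y => f (T y))) //.
  by apply/funext => y; rewrite /T scalerBr addrC.
have main (f1 f2 g1 g2 : 'rV[R]_n -> R) (e1 e2 : R) (F : 'rV[R]_n -> R) :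
    decays f1 -> decays f2 -> decays g1 -> decays g2 ->
    (F = fun y => e1 * (f1 y * g1 (T y)) + e2 * (f2 y * g2 (T y))) ->
    a ^- n * rvint F = e1 * corr f1 g1 b a + e2 * corr f2 g2 b a.
  move=> df1 df2 dg1 dg2 FE.
  have cF : continuous F.
    rewrite FE => y.
    have c1 := continuousM (df1.1 y) (cT _ dg1.1 y); have c2 := continuousM (df2.1 y) (cT _ dg2.1 y).
    have := continuousD (continuousM (@cst_continuous _ _ e1 y) c1) (continuousM (@cst_continuous _ _ e2 y) c2).
    exact.
  have [I1 E1] := rvintZ e1 (corr_integrable b a df1 dg1).
  have [I2 E2] := rvintZ e2 (corr_integrable b a df2 dg2).
  have [I3 E3] := rvintD I1 I2.
  have EF : (fun x => F (b + a *: x)) = fun x => e1 * (f1 (b + a *: x) * g1 x) + e2 * (f2 (b + a *: x) * g2 x).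
    by apply/funext => x; rewrite FE TK.
  have [|_ ->] := integral_row_affine (b := b) a0 cF; first by rewrite EF.
  by rewrite EF E3 E1 E2 mulKf // expf_neq0 // gt_eqF.
rewrite /wavelet cintegralE.
have -> (X Y : R) : (a ^- n)%:C * Complex X Y = Complex (a ^- n * X) (a ^- n * Y).
  by apply/eqP; rewrite eq_complex /= !mul0r subr0 addr0 !eqxx.
congr Complex.
  apply: main => //; apply/funext => y /=; rewrite -/(T y).
  by case: (phi y) => p q; case: (psi (T y)) => r s /=; ring.
apply: main => //; apply/funext => y /=; rewrite -/(T y).
by case: (phi y) => p q; case: (psi (T y)) => r s /=; ring.
Qed.

(** The transform as a function on the half-space, extended by zero. *)
Definition wave psi phi z : C := if 0 < z.2 then wavelet psi phi z.1 z.2 else 0.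

Lemma open_half_space : open (@half_space R n).
Proof.
rewrite /half_space (_ : [set z | 0 < z.2] = snd @^-1` [set y : R | 0 < y]) //.
apply: open_comp; last exact: open_gt.
by move=> z _; exact: cvg_snd.
Qed.

Lemma wave_jet psi phi : cschwartz psi -> cschwartz phi ->
  hs_smooth (wave psi phi) /\
  forall al beta b (a : R), 0 < a ->
    let s := jet_terms (nseq al None ++ map Some (mword beta)) in
    hs_deriv al beta (wave psi phi) (b, a) =
    Complex (jet_sum (ReF phi) (ReF psi) s (b, a) + jet_sum (ImF phi) (ImF psi) s (b, a))
            (jet_sum (ImF phi) (ReF psi) s (b, a) - jet_sum (ReF phi) (ImF psi) s (b, a)).
Proof.
move=> sp sf; have [[pr pi] [fr fi]] := (sp, sf).
have D := @rschwartz_decays R n.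
have [s1 j1] := corrz_jet fr (D _ pr); have [s2 j2] := corrz_jet fi (D _ pi).
have [s3 j3] := corrz_jet fi (D _ pr); have [s4 j4] := corrz_jet fr (D _ pi).
have [sr jr] := rpartials_lin 1 1 s1 s2; have [si ji] := rpartials_lin 1 (- 1) s3 s4.
have E z : half_space z -> wave psi phi z = Complex (wave_re psi phi z) (wave_im psi phi z).
  by case: z => b a /= a0; rewrite /wave /= ifT //; exact: waveletE.
have [S J] := cpartials_local open_half_space sr si E.
split.
  split=> // -[b a]; rewrite /half_space /wave /= => /negP/negbTE ->; by [].
move=> al beta b a a0 s; rewrite /hs_deriv J // jr ji j1 j2 j3 j4.
by rewrite !mul1r mulN1r.
Qed.

End wavelet_transform.

Section wave_bound.
Context {R : realType} {n : nat}.
Notation C := R[i].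
Implicit Types (phi psi : 'rV[R]_n -> C) (x b : 'rV[R]_n) (z : 'rV[R]_n * R).

Lemma sum_seq_le (T : eqType) (r : seq T) (F : T -> R) (E : R) :
  (forall p, p \in r -> F p <= E) -> \sum_(p <- r) F p <= (size r)%:R * E.
Proof.
elim: r => [|p r IH] H; first by rewrite big_nil mul0r.
rewrite big_cons /= -natr1 mulrDl mul1r addrC; apply: lerD; last by apply: H; rewrite mem_head.
by apply: IH => q qr; apply: H; rewrite inE qr orbT.
Qed.

(** [mabs beta] factorial exceeds [mfact beta] by a geometric factor only. *)
Lemma fpow_mabs_le (beta : 'I_n -> nat) (s : R) : 0 <= s ->
  fpow (mabs beta) s <= ((2 ^ n)%:R `^ s) ^+ mabs beta * (mfact beta)%:R `^ s.
Proof.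
move=> s0; have -> : ((2 ^ n)%:R `^ s) ^+ mabs beta = ((2 ^ n)%:R ^+ mabs beta) `^ s :> R.
  by rewrite -(powR_mulrn _ (powR_ge0 _ s)) -powRrM (mulrC s) powRrM powR_mulrn.
rewrite -powRM ?exprn_ge0 //; apply: ge0_ler_powR; rewrite ?nnegrE ?mulr_ge0 ?exprn_ge0 //.
by rewrite -natrX -natrM ler_nat mabs_fact_le.
Qed.

Lemma gs_norm_cschwartz rho1 rho2 h phi (M : R) : (0 < n)%N -> 0 < h -> 0 <= rho1 ->
  csmooth phi -> (gs_norm rho1 rho2 h phi <= M%:E)%E -> cschwartz phi.
Proof.
move=> n0 h0 r0 /smooth_onT[sr si] HM.
have [br bi] := gs_norm_gs_bound n0 h0 r0 sr si HM.
by split; [exact: gs_bound_schwartz br|exact: gs_bound_schwartz bi].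
Qed.

Section estimate.
Variables (rho1 rho2 sigma tau s t tau1 tau2 : R).
Hypotheses (n0 : (0 < n)%N) (sigma0 : 0 <= sigma) (rho10 : 0 <= rho1).
Hypotheses (tau_1 : 1 <= tau) (rho2_1 : 1 <= rho2).
Hypotheses (sigma_s : sigma <= s) (sigma_tau2 : sigma + rho2 - 1 <= tau2).
Hypotheses (tau_t : tau <= t) (rho2_t : rho2 <= t).
Hypotheses (rho1_tau1 : tau + rho1 - 1 <= tau1) (rho_t : tau + rho1 - 1 + rho2 <= t).

(** The bound on each pair of steps, linear in either norm: a derivative of order
    [al] in [a] produces [n ^ al] correlations, for each of the four products of
    real and imaginary parts. *)
Lemma wave_bound (al : nat) (h : R) : 0 < h -> exists h' K : R, [/\ 0 < h', 0 <= K &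
  forall psi phi A B, csmooth psi -> csmooth phi ->
    (gs_norm rho1 rho2 h psi <= A%:E)%E -> (gs_norm sigma tau h phi <= B%:E)%E ->
    cmoments0 psi -> cmoments0 phi ->
    (hs_norm s t tau1 tau2 al h' (wave psi phi) <= (K * (A * B))%:E)%E].
Proof.
move=> h0.
have H1 : 1 <= Num.max 1 h^-1 by rewrite le_max lexx.
have [c [D [c0 D1 EST]]] := corr_estimate al H1 sigma0 rho10 tau_1 rho2_1 sigma_s sigma_tau2
  tau_t rho2_t rho1_tau1 rho_t n0.
have s0 : 0 <= s by exact: le_trans sigma_s.
set K := (2 ^ n)%:R `^ s : R.
have K1 : 1 <= K by rewrite -[1](powRr0 (2 ^ n)%:R); apply: ler_powR => //; rewrite ler1n expn_gt0.
have DK1 : 1 <= D * K by exact: mulr_ege1.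
have DK0 : 0 < D * K by exact: lt_le_trans DK1.
have D0 : 0 <= D by exact: le_trans D1.
exists (D * K)^-1, (4 * (n ^ al)%:R * c); split; rewrite ?invr_gt0 ?mulr_ge0 //.
move=> psi phi A B cpsi cphi Apsi Bphi mpsi mphi.
have [spr spi] := (smooth_onT (@unitv R n) psi).1 cpsi.
have [sfr sfi] := (smooth_onT (@unitv R n) phi).1 cphi.
have [bpr bpi] := gs_norm_gs_bound n0 h0 rho10 spr spi Apsi.
have [bfr bfi] := gs_norm_gs_bound n0 h0 sigma0 sfr sfi Bphi.
have [mpr mpi] := (cmoments0P psi).1 mpsi; have [mfr mfi] := (cmoments0P phi).1 mphi.
have A0 := gs_bound_ge0 bpr; have B0 := gs_bound_ge0 bfr.
have [_ J] := wave_jet (gs_norm_cschwartz n0 h0 rho10 cpsi Apsi)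
                       (gs_norm_cschwartz n0 h0 sigma0 cphi Bphi).
apply: ge_ereal_sup => _ [b [a [k [l1 [l2 [beta [a0 ->]]]]]]]; rewrite lee_fin.
rewrite (J al beta b a a0).
set S := jet_terms _; set N := (mabs beta + k + l1 + l2)%N.
set w0 := (a ^+ l1 + a ^- l2); set jb := japanese b ^+ k.
have w00 : 0 <= w0 by rewrite addr_ge0 ?invr_ge0 ?exprn_ge0 // ltW.
have jb0 : 0 <= jb by rewrite exprn_ge0 // sqrtr_ge0.
pose E := c * D ^+ N * (A * B) *
  (fpow (mabs beta) s * fpow k t * fpow l1 tau1 * fpow l2 tau2).
have one f g : row_smooth f -> row_smooth g ->
    gs_bound B (Num.max 1 h^-1) sigma tau f -> gs_bound A (Num.max 1 h^-1) rho1 rho2 g ->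
    moments0 f -> moments0 g -> w0 * jb * `|jet_sum f g S (b, a)| <= (n ^ al)%:R * E.
  move=> sf sg bf bg mf mg.
  apply: (@le_trans _ _ (w0 * jb * \sum_(p <- S) `|corrz ('d_p.1 f) (wmul p.2 g) (b, a)|)).
    by apply: ler_wpM2l; [rewrite mulr_ge0|exact: ler_norm_sum].
  rewrite mulr_sumr -(size_jet_terms al (mword beta)); apply: sum_seq_le => p pS.
  have [-> p2] := jet_terms_deriv pS.
  have := EST f g A B p.2 (mword beta) b a k l1 l2 sf sg bf bg mf mg p2 a0.
  by rewrite size_mword.
have h1 := one _ _ sfr spr bfr bpr mfr mpr; have h2 := one _ _ sfi spi bfi bpi mfi mpi.
have h3 := one _ _ sfi spr bfi bpr mfi mpr; have h4 := one _ _ sfr spi bfr bpi mfr mpi.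
move: h1 h2 h3 h4; set X1 := jet_sum (ReF phi) (ReF psi) _ _; set X2 := jet_sum (ImF phi) (ImF psi) _ _.
set X3 := jet_sum (ImF phi) (ReF psi) _ _; set X4 := jet_sum (ReF phi) (ImF psi) _ _.
move=> h1 h2 h3 h4; set z := Complex _ _.
have Hz : w0 * jb * normc z <= 4 * ((n ^ al)%:R * E).
  apply: (@le_trans _ _ (w0 * jb * (`|X1| + `|X2| + (`|X3| + `|X4|)))).
    apply: ler_wpM2l; first by rewrite mulr_ge0.
    apply: le_trans (normc_le_ReIm z) _; rewrite /z /=.
    by apply: lerD; [exact: ler_normD|exact: ler_normB].
  rewrite !mulrDr; move: h1 h2 h3 h4.
  by move: (w0 * jb * _) (w0 * jb * _) (w0 * jb * _) (w0 * jb * _) ((n ^ al)%:R * E) => ? ? ? ? ?; lra.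
have EF : E <= c * (D * K) ^+ N * (A * B) *
    ((mfact beta)%:R `^ s * k`!%:R `^ t * l1`!%:R `^ tau1 * l2`!%:R `^ tau2).
  have EM : (D * K) ^+ N = D ^+ N * K ^+ N by exact: exprMn.
  rewrite EM [leRHS](_ : _ = c * D ^+ N * (A * B) *
    (K ^+ N * (mfact beta)%:R `^ s * fpow k t * fpow l1 tau1 * fpow l2 tau2)); last first.
    by rewrite /fpow; ring.
  apply: ler_wpM2l; first by rewrite !mulr_ge0 // exprn_ge0.
  do 3 (apply: ler_wpM2r; first exact: fpow_ge0).
  apply: le_trans (fpow_mabs_le beta s0) _; apply: ler_wpM2r; first exact: powR_ge0.
  by apply: ler_weXn2l => //; rewrite /N -!addnA leq_addr.
pose Den : R := (mfact beta)%:R `^ s * k`!%:R `^ t * l1`!%:R `^ tau1 * l2`!%:R `^ tau2.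
rewrite -/Den in EF *.
have Den0 : 0 < Den.
  have F m (r : R) : 0 < m`!%:R `^ r by rewrite powR_gt0 // ltr0n fact_gt0.
  rewrite /Den !mulr_gt0 ?F // powR_gt0 // ltr0n.
  by rewrite prodn_gt0 // => i; rewrite fact_gt0.
have hN : 0 < (D * K) ^+ N by rewrite exprn_gt0.
have -> : (D * K)^-1 ^+ N / Den * w0 * jb * normc z = (w0 * jb * normc z) / ((D * K) ^+ N * Den).
  by rewrite (exprVn (D * K) N) (invfM ((D * K) ^+ N) Den); ring.
rewrite (ler_pdivrMr _ _ (mulr_gt0 hN Den0)); apply: le_trans Hz _.
rewrite [leRHS](_ : _ = 4 * ((n ^ al)%:R * (c * (D * K) ^+ N * (A * B) * Den))); last by ring.
by apply: ler_wpM2l => //; apply: ler_wpM2l.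
Qed.

End estimate.

Lemma rschwartz_lin (c d : R) (f g : 'rV[R]_n -> R) : rschwartz f -> rschwartz g ->
  rschwartz (fun x => c * f x + d * g x).
Proof.
move=> [sf df] [sg dg]; have [s E] := rpartials_lin c d sf sg; split=> // w.
rewrite E; split=> [x|M].
  have := continuousD (continuousM (@cst_continuous _ _ c x) ((df w).1 x))
                      (continuousM (@cst_continuous _ _ d x) ((dg w).1 x)).
  exact.
have [A HA] := (df w).2 M; have [B HB] := (dg w).2 M.
exists (`|c| * A + `|d| * B) => x.
apply: le_trans (ler_wpM2l _ (ler_normD _ _)) _; first by rewrite exprn_ge0.
by rewrite mulrDr !normrM; apply: lerD; rewrite mulrCA; apply: ler_wpM2l.
Qed.

Lemma corrz_linl (c d : R) (f f' g : 'rV[R]_n -> R) z : decays f -> decays f' -> decays g ->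
  corrz (fun x => c * f x + d * f' x) g z = c * corrz f g z + d * corrz f' g z.
Proof.
move=> df df' dg; rewrite /corrz /corr.
have [I1 <-] := rvintZ c (corr_integrable z.1 z.2 df dg).
have [I2 <-] := rvintZ d (corr_integrable z.1 z.2 df' dg).
have [_ <-] := rvintD I1 I2; congr (rvint _); apply/funext => x; ring.
Qed.

Lemma corrz_linr (c d : R) (f g g' : 'rV[R]_n -> R) z : decays f -> decays g -> decays g' ->
  corrz f (fun x => c * g x + d * g' x) z = c * corrz f g z + d * corrz f g' z.
Proof.
move=> df dg dg'; rewrite /corrz /corr.
have [I1 <-] := rvintZ c (corr_integrable z.1 z.2 df dg).
have [I2 <-] := rvintZ d (corr_integrable z.1 z.2 df dg').
have [_ <-] := rvintD I1 I2; congr (rvint _); apply/funext => x; ring.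
Qed.

Lemma ReF_lin (c d : R) (f g : 'rV[R]_n -> C) :
  ReF (fun x => c%:C * f x + d%:C * g x) = fun x => c * ReF f x + d * ReF g x.
Proof. by apply/funext => x /=; case: (f x) => ? ?; case: (g x) => ? ? /=; ring. Qed.

Lemma ImF_lin (c d : R) (f g : 'rV[R]_n -> C) :
  ImF (fun x => c%:C * f x + d%:C * g x) = fun x => c * ImF f x + d * ImF g x.
Proof. by apply/funext => x /=; case: (f x) => ? ?; case: (g x) => ? ? /=; ring. Qed.

Lemma cschwartz_lin (c d : R) (f g : 'rV[R]_n -> C) : cschwartz f -> cschwartz g ->
  cschwartz (fun x => c%:C * f x + d%:C * g x).
Proof.
by move=> [fr fi] [gr gi]; split; rewrite ?ReF_lin ?ImF_lin; exact: rschwartz_lin.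
Qed.

Lemma wave_linl (c d : R) psi psi' phi : cschwartz psi -> cschwartz psi' -> cschwartz phi ->
  wave (fun x => c%:C * psi x + d%:C * psi' x) phi =
  fun z => c%:C * wave psi phi z + d%:C * wave psi' phi z.
Proof.
move=> sp sp' sf; apply/funext => -[b a]; rewrite /wave /=.
case: ifPn => a0; last by rewrite !mulr0 addr0.
rewrite !waveletE //; last exact: cschwartz_lin.
move: sp sp' sf => [/rschwartz_decays p1 /rschwartz_decays p2] [/rschwartz_decays q1 /rschwartz_decays q2] [/rschwartz_decays f1 /rschwartz_decays f2].
apply/eqP; rewrite eq_complex /wave_re /wave_im ReF_lin ImF_lin !corrz_linr //=.
by apply/andP; split; apply/eqP; ring.
Qed.

Lemma wave_linr (c d : R) psi phi phi' : cschwartz psi -> cschwartz phi -> cschwartz phi' ->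
  wave psi (fun x => c%:C * phi x + d%:C * phi' x) =
  fun z => c%:C * wave psi phi z + d%:C * wave psi phi' z.
Proof.
move=> sp sf sf'; apply/funext => -[b a]; rewrite /wave /=.
case: ifPn => a0; last by rewrite !mulr0 addr0.
rewrite !waveletE //; last exact: cschwartz_lin.
move: sp sf sf' => [/rschwartz_decays p1 /rschwartz_decays p2] [/rschwartz_decays q1 /rschwartz_decays q2] [/rschwartz_decays f1 /rschwartz_decays f2].
apply/eqP; rewrite eq_complex /wave_re /wave_im ReF_lin ImF_lin !corrz_linl //=.
by apply/andP; split; apply/eqP; ring.
Qed.

End wave_bound.

(** * Compactness of bounded sets of smooth functions *)
Lemma lipschitz_continuous {R : realType} {V : normedModType R} (g : V -> R) (L : R) :
  0 <= L -> (forall x v, `|g (x + v) - g x| <= L * `|v|) -> continuous g.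
Proof.
move=> L0 lip x; apply/cvgrPdist_le => e e0.
have LL : 0 < L + 1 by rewrite ltr_wpDl.
have d0 : 0 < e / (L + 1) by rewrite divr_gt0.
near=> y.
have yx : `|x - y| <= e / (L + 1) by near: y; exact: cvgr_dist_le.
have := lip y (x - y); rewrite (addrC y) subrK => h; apply: le_trans h _.
apply: le_trans (ler_wpM2r _ (_ : _ <= L + 1)) _; rewrite ?lerDl //.
by rewrite mulrC -ler_pdivlMr.
Unshelve. all: by end_near. Qed.

Lemma nbhs_norm_le {R : realType} {V : normedModType R} (x : V) (d : R) : 0 < d ->
  nbhs x [set y | `|x - y| <= d].
Proof.
move=> d0; apply: filterS (nbhsx_ballx x _ d0) => y.
by rewrite -ball_normE => /ltW.
Qed.

Section ultralimits.
Context {R : realType} (U : set_system nat) {UU : UltraFilter U}.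

(** The limit is the supremum of the [x] that lie below [u] on a set of the
    ultrafilter. *)
Lemma ultra_bounded (u : nat -> R) (M : R) : (forall j, `|u j| <= M) ->
  exists l : R, u j @[j --> U] --> l.
Proof.
move=> uM; pose S : set R := [set x | U [set j | x <= u j]].
have SM : S (- M).
  by apply: filterS filterT => j _ /=; have := uM j; rewrite ler_norml => /andP[].
have bS : ubound S M.
  move=> x Sx; have [j /= xj] := filter_ex (FF := @ultra_proper _ _ UU) Sx.
  by apply: le_trans xj _; have := uM j; rewrite ler_norml => /andP[].
have hS : has_sup S by split; [exists (- M)|exists M].
exists (sup S); apply/cvgrPdist_le => e e0.
have [x Sx lx] := sup_adherent e0 hS.
have [|nS] := in_ultra_setVsetC [set j | sup S + e <= u j] UU.
  move=> Se; exfalso; have := ub_le_sup hS.2 (Se : S (sup S + e)).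
  by rewrite gerDl leNgt e0.
apply: filterS2 Sx nS => j /= xj /negP; rewrite -ltNge => je.
by rewrite distrC ler_distl (ltW je) andbT (le_trans _ xj) // ltW.
Qed.

Lemma ultra_norm_le (u : nat -> R) (l M : R) : u j @[j --> U] --> l ->
  (forall j, `|u j| <= M) -> `|l| <= M.
Proof.
move=> ul uM; refine (@cvgr_to_le _ U (@ultra_proper _ _ UU) R _ _ _ (cvg_norm ul) _).
by apply: filterS filterT => j _ /=.
Qed.

Section arzela_ascoli.
Context {n : nat}.
Variables (f : nat -> 'rV[R]_n -> R) (C H sigma tau : R).
Hypotheses (sf : forall j, rsmooth (@unitv R n) (f j))
           (bf : forall j, gs_bound C H sigma tau (f j)).

Let F_ex (p : seq 'I_n * 'rV[R]_n) : exists l : R, 'd_(p.1) (f j) p.2 @[j --> U] --> l.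
Proof.
apply: (@ultra_bounded _ (C * H ^+ (0 + size p.1) * fpow 0 tau * fpow (size p.1) sigma)) => j.
by have := bf j 0 p.1 p.2; rewrite expr0 mul1r.
Qed.

Let F (w : seq 'I_n) x : R := projT1 (cid (F_ex (w, x))).

Let FP w x : 'd_w (f j) x @[j --> U] --> F w x.
Proof. exact: projT2 (cid (F_ex (w, x))). Qed.

Let B (w : seq (ordinal n)) : R := C * H ^+ (0 + size w) * fpow 0 tau * fpow (size w) sigma.

Let d_le w j x : `|'d_w (f j) x| <= B w.
Proof. by have := bf j 0 w x; rewrite expr0 mul1r. Qed.

Let B0 w : 0 <= B w. Proof. exact: le_trans (d_le w 0 0). Qed.

Let L (w : seq (ordinal n)) : R := n%:R * (\sum_(i < n) B (i :: w)).

Let L0 w : 0 <= L w. Proof. by rewrite mulr_ge0 // sumr_ge0. Qed.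

Let lip w j x v : `|'d_w (f j) (x + v) - 'd_w (f j) x| <= L w * `|v|.
Proof.
apply: lipschitz_row; first exact: rsmooth_partials.
move=> i y; rewrite -rpartials_cat /=; apply: le_trans (d_le _ j y) _.
by rewrite (bigD1 i) //= lerDl sumr_ge0.
Qed.

Let lipF w x v : `|F w (x + v) - F w x| <= L w * `|v|.
Proof.
refine (@ultra_norm_le (fun j => 'd_w (f j) (x + v) - 'd_w (f j) x) _ _ _ (fun j => lip w j x v)).
refine (cvgB (@FP w (x + v)) (@FP w x)).
Qed.

Let cF w : continuous (F w).
Proof. exact: (lipschitz_continuous (L0 w) (lipF w)). Qed.

Let dF w i x : is_derive x (@unitv R n i) (F w) (F (i :: w) x).
Proof.
apply: (@is_derive_quadratic _ _ _ _ _ _ (B (i :: i :: w))) => t _.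
refine (@ultra_norm_le (fun j => 'd_w (f j) (x + t *: unitv i) - 'd_w (f j) x -
  t * 'd_(i :: w) (f j) x) _ _ _ _).
  by refine (cvgB (cvgB (@FP w (x + t *: unitv i)) (@FP w x)) (cvgMl_tmp (a := t) (@FP (i :: w) x))).
move=> j.
have := @second_order_remainder _ _ ('d_w (f j)) i x t (B (i :: i :: w)).
rewrite -!rpartials_cat /= => HS; rewrite (mulrC (B _)); apply: HS; first exact: rsmooth_partials.
by move=> s _; rewrite -?rpartials_cat; exact: d_le.
Qed.

(** The partials converge pointwise along the ultrafilter; the limits are again
    derivatives of each other because the quadratic remainders are bounded
    uniformly.  Convergence is uniform on compact sets by equicontinuity, and at
    infinity one more power of [|x|] makes the weighted functions small. *)
Lemma arzela_ascoli : exists2 g : 'rV[R]_n -> R, rsmooth (@unitv R n) g &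
  (forall w x, 'd_w (f j) x @[j --> U] --> 'd_w g x) /\
  forall w k (e : R), 0 < e ->
    U [set j | forall x, `|x| ^+ k * `|'d_w (f j) x - 'd_w g x| <= e].
Proof.
have [sF EF] := rsmooth_jet cF dF.
exists (F [::]) => //; split=> [w x|w k e e0]; rewrite EF; first exact: (@FP w x).
pose D := C * H ^+ (k.+1 + size w) * fpow k.+1 tau * fpow (size w) sigma.
have dD j x : `|x| ^+ k.+1 * `|'d_w (f j) x| <= D by exact: bf.
have dDF x : `|x| ^+ k.+1 * `|F w x| <= D.
  have N y : `|x| ^+ k.+1 * `|y| = `| `|x| ^+ k.+1 * y| :> R.
    by rewrite normrM ger0_norm // exprn_ge0.
  rewrite N; apply: (@ultra_norm_le (fun j => `|x| ^+ k.+1 * 'd_w (f j) x) _ _ (cvgMl_tmp (a := `|x| ^+ k.+1) (@FP w x))) => j.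
  by rewrite -N; exact: dD.
have D0 : 0 <= D by apply: le_trans (dD 0 0); rewrite mulr_ge0 ?exprn_ge0.
pose rho : R := 1 + (D + D) / e.
have rho1 : 1 <= rho by rewrite lerDl divr_ge0 ?addr_ge0 // ltW.
have rho0 : 0 < rho by exact: lt_le_trans rho1.
have rhok : 0 < rho ^+ k by rewrite exprn_gt0.
pose K := [set x : 'rV[R]_n | `|x| <= rho].
have cK : compact K.
  apply: bounded_closed_compact.
    exists rho; split; first exact: num_real.
    by move=> y ry x /= Kx; exact: le_trans Kx (ltW ry).
  rewrite (_ : K = (fun x : 'rV[R]_n => `|x|) @^-1` [set y | y <= rho]) //.
  by apply: closed_comp => [x _|]; [exact: norm_continuous|exact: closed_le].
have ek : 0 < e / rho ^+ k by rewrite divr_gt0.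
have KU : U [set j | K `<=` [set x | `|'d_w (f j) x - F w x| <= e / rho ^+ k]].
  apply: ((compact_near_coveringP K).1 cK _ U
    (fun j x => `|'d_w (f j) x - F w x| <= e / rho ^+ k)).
  move=> x _; pose d : R := e / rho ^+ k / 3.
  have d0 : 0 < d by rewrite divr_gt0.
  have LL : 0 < L w + 1 by rewrite ltr_wpDl.
  have dL : 0 < d / (L w + 1) by rewrite divr_gt0.
  exists ([set y | `|x - y| <= d / (L w + 1)], [set j | `|F w x - 'd_w (f j) x| <= d]).
    split; first exact: nbhs_norm_le.
    have HU := (cvgrPdist_le (F := U) _ _).1 (@FP w x) d d0; exact: HU.
  move=> [y j] /= [xy jx].
  have small : L w * `|y - x| <= d.
    rewrite distrC; apply: le_trans (ler_wpM2r _ (_ : _ <= L w + 1)) _; rewrite ?lerDl //.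
    by rewrite mulrC -ler_pdivlMr.
  have l1 := le_trans (lip w j x (y - x)) small; have l2 := le_trans (lipF w x (y - x)) small.
  rewrite (addrC x) subrK in l1 l2.
  have -> : 'd_w (f j) y - F w y = ('d_w (f j) y - 'd_w (f j) x) -
      (F w x - 'd_w (f j) x) - (F w y - F w x) by ring.
  apply: le_trans (ler_normB _ _) _; apply: le_trans (lerD (ler_normB _ _) (lexx _)) _.
  rewrite (_ : e / rho ^+ k = d + d + d); last by rewrite /d; field; rewrite gt_eqF.
  by apply: lerD l2; apply: lerD l1 jx.
apply: filterS KU => j Hj x.
have [xr|xr] := leP `|x| rho.
  apply: le_trans (ler_pM _ _ (lerXn2r k _ _ xr) (Hj x xr)) _; rewrite ?nnegrE ?exprn_ge0 //.
    exact: ltW.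
  by rewrite mulrC divfK // gt_eqF.
have x0 : 0 < `|x| by exact: lt_trans xr.
rewrite -(ler_pM2l x0) mulrA -exprS.
apply: le_trans (ler_wpM2l (exprn_ge0 _ (normr_ge0 x)) (ler_normB _ _)) _.
rewrite mulrDr; apply: le_trans (lerD (dD j x) (dDF x)) _.
rewrite -ler_pdivrMr //; apply: le_trans (ltW xr).
by rewrite /rho lerDr.
Qed.

End arzela_ascoli.
End ultralimits.

Section complex_combinations.
Context {R : realType}.
Notation C := R[i].

Section directions.
Context {V : normedModType R} {I : eqType} (e : I -> V).
Implicit Types (f g : V -> C) (w : seq I).

Lemma cpartials_clin (c d : C) f g : smooth_on e setT f -> smooth_on e setT g ->
  smooth_on e setT (fun x => c * f x + d * g x) /\
  forall w x, cpartials e w (fun x => c * f x + d * g x) x =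
              c * cpartials e w f x + d * cpartials e w g x.
Proof.
move=> /smooth_onT[fr fi] /smooth_onT[gr gi].
case: c => c1 c2; case: d => d1 d2.
have ER : ReF (fun x => (c1 +i* c2) * f x + (d1 +i* d2) * g x) =
    fun x => 1 * (c1 * ReF f x + (- c2) * ImF f x) + 1 * (d1 * ReF g x + (- d2) * ImF g x).
  by apply/funext => x /=; case: (f x) => ? ?; case: (g x) => ? ? /=; ring.
have EI : ImF (fun x => (c1 +i* c2) * f x + (d1 +i* d2) * g x) =
    fun x => 1 * (c1 * ImF f x + c2 * ReF f x) + 1 * (d1 * ImF g x + d2 * ReF g x).
  by apply/funext => x /=; case: (f x) => ? ?; case: (g x) => ? ? /=; ring.
have [s1 E1] := rpartials_lin c1 (- c2) fr fi; have [s2 E2] := rpartials_lin d1 (- d2) gr gi.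
have [s3 E3] := rpartials_lin c1 c2 fi fr; have [s4 E4] := rpartials_lin d1 d2 gi gr.
have [s5 E5] := rpartials_lin 1 1 s1 s2; have [s6 E6] := rpartials_lin 1 1 s3 s4.
split; first by apply/smooth_onT; rewrite ER EI.
move=> w x; rewrite !cpartialsE ER EI E5 E6 E1 E2 E3 E4.
by apply/eqP; rewrite eq_complex /=; apply/andP; split; apply/eqP; ring.
Qed.

End directions.

Context {n : nat}.
Implicit Types (phi psi : 'rV[R]_n -> C).

Lemma gs_norm_clin (rho1 rho2 h : R) (c d : C) phi psi (A B : R) : 0 <= h ->
  csmooth phi -> csmooth psi ->
  (gs_norm rho1 rho2 h phi <= A%:E)%E -> (gs_norm rho1 rho2 h psi <= B%:E)%E ->
  (gs_norm rho1 rho2 h (fun x => (c * phi x + d * psi x)%R) <= (normc c * A + normc d * B)%:E)%E.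
Proof.
move=> h0 sf sg /gs_normP HA /gs_normP HB; apply/gs_normP => x a b.
have [_ E] := cpartials_clin c d sf sg.
rewrite [mderiv _ _ _]E -/(mderiv b phi x) -/(mderiv b psi x).
move: (HA x a b) (HB x a b); set W := h ^+ _ / _; set z := mderiv b phi x; set z' := mderiv b psi x.
have W0 : 0 <= W by rewrite divr_ge0 ?exprn_ge0 // mulr_ge0 // powR_ge0.
move=> {}HA {}HB.
have -> : (mpow x a)%:C * (c * z + d * z') = c * ((mpow x a)%:C * z) + d * ((mpow x a)%:C * z') by ring.
apply: le_trans (ler_wpM2l W0 (le_normcD _ _)) _.
rewrite (normcM c) (normcM d) mulrDr; apply: lerD.
  by rewrite mulrCA; apply: ler_wpM2l => //; exact: normc_nneg.
by rewrite mulrCA; apply: ler_wpM2l => //; exact: normc_nneg.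
Qed.

Lemma gs_norm_le_mono (rho1 rho2 h h' : R) phi (M : R) : 0 <= h' -> h' <= h ->
  (gs_norm rho1 rho2 h phi <= M%:E)%E -> (gs_norm rho1 rho2 h' phi <= M%:E)%E.
Proof.
move=> h0 hh /gs_normP HM; apply/gs_normP => x a b; apply: le_trans (HM x a b).
apply: ler_wpM2r; first exact: normc_nneg.
apply: ler_wpM2r; first by rewrite invr_ge0 mulr_ge0 // powR_ge0.
by apply: lerXn2r; rewrite ?nnegrE // (le_trans h0).
Qed.

Lemma gs_norm_schwartz (rho1 rho2 h : R) phi (M : R) : 0 < h -> csmooth phi ->
  (gs_norm rho1 rho2 h phi <= M%:E)%E -> schwartz phi.
Proof.
move=> h0 sf /gs_normP HM; split=> // a b.
set W : R := h ^+ (mabs a + mabs b) / ((mfact a)%:R `^ rho2 * (mfact b)%:R `^ rho1).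
have W0 : 0 < W.
  rewrite divr_gt0 ?exprn_gt0 // mulr_gt0 // powR_gt0 // ltr0n prodn_gt0 // => i; exact: fact_gt0.
by exists (M / W) => x; rewrite ler_pdivlMr // mulrC; exact: HM.
Qed.

Lemma gs_norm_fin (rho1 rho2 h : R) phi : 0 <= h -> (gs_norm rho1 rho2 h phi < +oo)%E ->
  exists2 M, 0 <= M & (gs_norm rho1 rho2 h phi <= M%:E)%E.
Proof.
move=> h0; have := gs_norm_ge0 rho1 rho2 phi h0.
case: (gs_norm _ _ _ _) => [M M0 _||]//; exists M => //.
Qed.

Lemma geometric_small (q B e : R) : 0 <= q -> q < 1 -> 0 < e -> exists N, q ^+ N * B <= e.
Proof.
move=> q0 q1 e0; have qn : `|q| < 1 by rewrite ger0_norm.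
have B0 : 0 < `|B| + 1 by rewrite ltr_pwDr.
have d0 : 0 < e / (`|B| + 1) by rewrite divr_gt0.
have [N _ HN] := (cvgrPdist_le (F := \oo) _ _).1 (cvg_expr qn) _ d0.
exists N; have := HN N (leqnn N); rewrite sub0r normrN ger0_norm ?exprn_ge0 // => qN.
apply: le_trans (_ : q ^+ N * (`|B| + 1) <= _); last by rewrite -ler_pdivlMr.
apply: ler_wpM2l; first exact: exprn_ge0.
by apply: le_trans (ler_norm B) _; rewrite lerDl.
Qed.

Section compactness.
Variables (U : set_system nat) (UU : UltraFilter U).

(** Bounded sets of the step [h] are relatively compact in every step
    [h' < h]: a bounded sequence converges along an ultrafilter, pointwise with
    all its derivatives.  The terms of the norm of large total order are then
    small by the factor [(h' / h) ^ N], and only finitely many orders, each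
    treated by Arzela-Ascoli, remain. *)
Lemma gs_compact (rho1 rho2 h h' r : R) (phi : nat -> 'rV[R]_n -> C) :
  (0 < n)%N -> 0 < h' -> h' < h -> 0 <= rho1 -> 0 <= rho2 ->
  (forall j, csmooth (phi j)) -> (forall j, (gs_norm rho1 rho2 h (phi j) <= r%:E)%E) ->
  exists psi, [/\ csmooth psi, (gs_norm rho1 rho2 h psi <= r%:E)%E &
    forall e : R, 0 < e ->
      U [set j | (gs_norm rho1 rho2 h' (fun x => (phi j x - psi x)%R) <= e%:E)%E]].
Proof.
move=> n0 h'0 hh r1 r2 sphi bphi; have h0 : 0 < h by exact: lt_trans hh.
have UP := @ultra_proper _ _ UU.
have sr j : rsmooth (@unitv R n) (ReF (phi j)) by have [] := (smooth_onT (@unitv R n) _).1 (sphi j).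
have si j : rsmooth (@unitv R n) (ImF (phi j)) by have [] := (smooth_onT (@unitv R n) _).1 (sphi j).
have br j := (gs_norm_gs_bound n0 h0 r1 (sr j) (si j) (bphi j)).1.
have bi j := (gs_norm_gs_bound n0 h0 r1 (sr j) (si j) (bphi j)).2.
have [gr sgr [cgr ugr]] := @arzela_ascoli R U UU n _ _ _ _ _ sr br.
have [gi sgi [cgi ugi]] := @arzela_ascoli R U UU n _ _ _ _ _ si bi.
pose psi x := Complex (gr x) (gi x).
have spsi : csmooth psi by apply/smooth_onT.
have dpsi b x : mderiv b psi x = Complex ('d_(mword b) gr x) ('d_(mword b) gi x).
  by rewrite mderivE.
have dist b x j : normc (mderiv b (phi j) x - mderiv b psi x) <=
    `|'d_(mword b) (ReF (phi j)) x - 'd_(mword b) gr x| +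
    `|'d_(mword b) (ImF (phi j)) x - 'd_(mword b) gi x|.
  by rewrite dpsi mderivE; apply: le_trans (normc_le_ReIm _) _.
have npsi : (gs_norm rho1 rho2 h psi <= r%:E)%E.
  apply/gs_normP => x a b; set W := _ / _; rewrite normcM normc_real mulrA.
  have W0 : 0 <= W by rewrite divr_ge0 ?exprn_ge0 ?(ltW h0) // mulr_ge0 // powR_ge0.
  set X := W * _; have X0 : 0 <= X by rewrite mulr_ge0.
  apply/ler_addgt0Pr => e e0.
  have X1 : 0 < 2 * (X + 1) by rewrite mulr_gt0 // ltr_wpDl.
  have d0 : 0 < e / (2 * (X + 1)) by rewrite divr_gt0.
  have [j [/= j1 j2]] := filter_ex (filterI ((cvgrPdist_le (F := U) _ _).1 (@cgr (mword b) x) _ d0)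
                              ((cvgrPdist_le (F := U) _ _).1 (@cgi (mword b) x) _ d0)).
  rewrite distrC in j1; rewrite distrC in j2.
  have dj := le_trans (dist b x j) (lerD j1 j2).
  have Hj := (gs_normP _ _ _ _ _).1 (bphi j) x a b.
  rewrite -/W (normcM ((mpow x a)%:C)) normc_real mulrA -/X in Hj.
  have tri : normc (mderiv b psi x) <= normc (mderiv b (phi j) x) + e / (X + 1).
    have -> : mderiv b psi x = mderiv b (phi j) x + - (mderiv b (phi j) x - mderiv b psi x) by ring.
    apply: le_trans (le_normcD _ _) _; rewrite normcN; apply: lerD => //.
    by apply: le_trans dj _; rewrite le_eqVlt; apply/orP; left; apply/eqP; field; rewrite gt_eqF // ltr_wpDl.
  apply: le_trans (ler_wpM2l X0 tri) _; rewrite mulrDr; apply: lerD => //.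
  rewrite mulrA ler_pdivrMr ?ltr_wpDl // mulrC; apply: ler_wpM2l; rewrite ?(ltW e0) //.
  by rewrite lerDl.
exists psi; split=> // e e0.
have q0 : 0 <= h' / h by rewrite divr_ge0 // ltW.
have q1 : h' / h < 1 by rewrite ltr_pdivrMr // mul1r.
have [N HN] := geometric_small (r + r) q0 q1 e0.
pose c : R := (Num.max 1 h') ^+ N.
have c1 : 1 <= c by apply: exprn_ege1; rewrite le_max lexx.
have d0 : 0 < e / (2 * c) by rewrite divr_gt0 // mulr_gt0 // (lt_le_trans _ c1).
have UN : U [set j | forall (k m : 'I_N) (w : m.-tuple 'I_n), forall x,
    `|x| ^+ k * `|'d_w (ReF (phi j)) x - 'd_w gr x| <= e / (2 * c) /\
    `|x| ^+ k * `|'d_w (ImF (phi j)) x - 'd_w gi x| <= e / (2 * c)].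
  apply: filter_forall => k; apply: filter_forall => m; apply: filter_forall => w.
  by apply: filterS2 (ugr w k _ d0) (ugi w k _ d0) => j h1 h2 x.
apply: filterS UN => j Hj /=.
have E : (fun x => phi j x - psi x) = (fun x => 1 * phi j x + (- 1) * psi x).
  by apply/funext => x; rewrite mul1r mulN1r.
have Hdiff : (gs_norm rho1 rho2 h (fun x => (1 * phi j x + (- 1) * psi x)%R) <= (r + r)%:E)%E.
  have := gs_norm_clin 1 (- 1) (ltW h0) (sphi j) spsi (bphi j) npsi.
  have -> : normc (- 1 : C) = normc (1 : C) by exact: normcN.
  by rewrite (normc_real 1) normr1 !mul1r.
have [sd dd] := cpartials_clin 1 (- 1) (sphi j) spsi.
rewrite E; apply/gs_normP => x a b.
have := (gs_normP _ _ _ _ _).1 Hdiff x a b.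
set z := mderiv b _ x; set D := (X in _ / X); set M := (mabs a + mabs b)%N.
have D0 : 0 < D.
  by rewrite mulr_gt0 // powR_gt0 // ltr0n prodn_gt0 // => i; exact: fact_gt0.
have [MN|NM] := ltnP M N; last first.
  move=> Hz; have -> : h' ^+ M / D = (h' / h) ^+ M * (h ^+ M / D).
    by rewrite expr_div_n; field; rewrite gt_eqF //= expf_neq0 // gt_eqF.
  have r0 : 0 <= r + r.
    apply: le_trans Hz; apply: mulr_ge0; last exact: normc_nneg.
    by rewrite divr_ge0 ?exprn_ge0 // ltW.
  rewrite -mulrA; apply: le_trans (ler_wpM2l (exprn_ge0 _ q0) Hz) _.
  apply: le_trans HN; apply: ler_wpM2r => //; apply: ler_wiXn2l => //; exact: ltW.
move=> _.
have aN : (mabs a < N)%N by apply: leq_ltn_trans MN; rewrite leq_addr.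
have bN : (size (mword b) < N)%N by rewrite size_mword; apply: leq_ltn_trans MN; rewrite leq_addl.
have [h1 h2] := Hj (Ordinal aN) (Ordinal bN) (in_tuple (mword b)) x.
have zE : z = mderiv b (phi j) x - mderiv b psi x.
  by rewrite /z [mderiv _ _ _]dd mul1r mulN1r.
have zle : normc ((mpow x a)%:C * z) <= e / c.
  rewrite normcM normc_real zE; apply: le_trans (ler_wpM2l _ (dist b x j)) _ => //.
  have pa : `|mpow x a| <= `|x| ^+ mabs a by rewrite mpow_mword -(size_mword a); exact: word_pow_le.
  apply: le_trans (ler_wpM2r _ pa) _; first by rewrite addr_ge0.
  rewrite mulrDr; apply: le_trans (lerD h1 h2) _.
  by rewrite le_eqVlt; apply/orP; left; apply/eqP; field; rewrite gt_eqF // (lt_le_trans _ c1).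
apply: le_trans (_ : c * (e / c) <= e); last by rewrite mulrC divfK // gt_eqF // (lt_le_trans _ c1).
apply: ler_pM => //; [by rewrite divr_ge0 ?exprn_ge0 // ltW|exact: normc_nneg|].
have D1 : 1 <= D.
  have F (f : 'I_n -> nat) (q : R) : 0 <= q -> 1 <= (mfact f)%:R `^ q.
    move=> qq; rewrite -[leLHS](powRr0 (mfact f)%:R); apply: ler_powR => //.
    by rewrite ler1n prodn_gt0 // => i; exact: fact_gt0.
  by apply: mulr_ege1; exact: F.
rewrite ler_pdivrMr //; apply: le_trans (_ : c <= _); last by rewrite ler_peMr // (le_trans _ c1).
apply: le_trans (_ : (Num.max 1 h') ^+ M <= _).
  by apply: lerXn2r; rewrite ?nnegrE ?(ltW h'0) // ?le_max ?lexx ?orbT // ler01.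
by apply: ler_weXn2l; [rewrite le_max lexx|exact: ltnW].
Qed.

End compactness.

End complex_combinations.

(** * Open conditions in inductive limits of compact type *)
Section scales.
Context {R : realType}.
Notation C := R[i].

Definition tends {T : Type} (U : set_system nat) (p : R -> (T -> C) -> \bar R) (h : R)
    (f : nat -> T -> C) (g : T -> C) : Prop :=
  forall e : R, 0 < e -> U [set j | (p h (fun x => (f j x - g x)%R) <= e%:E)%E].

(** A scale of seminormed steps in which bounded sets of one step are relatively
    compact in all the larger ones, the steps growing as [h] decreases.
    Sequences along ultrafilters replace subsequences. *)
Record silva_scale {T : Type} (A : set (T -> C)) (p : R -> (T -> C) -> \bar R) : Prop := {
  scale_lin : forall h (c d : C) f g (M N : R), 0 < h -> A f -> A g ->
    (p h f <= M%:E)%E -> (p h g <= N%:E)%E ->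
    A (fun x => c * f x + d * g x) /\
    (p h (fun x => (c * f x + d * g x)%R) <= (normc c * M + normc d * N)%:E)%E;
  scale_mono : forall h h' f (M : R), 0 < h' -> h' <= h ->
    (p h f <= M%:E)%E -> (p h' f <= M%:E)%E;
  scale_zero : A (fun=> 0) /\ forall h, 0 < h -> (p h (fun=> 0%R) <= 0)%E;
  scale_compact : forall (U : set_system nat) h h' (r : R) (f : nat -> T -> C),
    UltraFilter U -> 0 < h' -> h' < h ->
    (forall j, A (f j)) -> (forall j, (p h (f j) <= r%:E)%E) ->
    exists g, [/\ A g, (p h g <= r%:E)%E & tends U p h' f g] }.

(** A sequence of steps cofinal in the inductive limit. *)
Definition radius (m : nat) : R := m.+1%:R^-1.

Lemma radius_gt0 m : 0 < radius m. Proof. by rewrite invr_gt0. Qed.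

Lemma radius_lt m : radius m.+1 < radius m.
Proof. by rewrite ltf_pV2 ?posrE // ltr_nat. Qed.

Lemma radius_small (h : R) : 0 < h -> exists m, radius m <= h.
Proof.
move=> h0; exists (Num.truncn h^-1); rewrite /radius -[leRHS]invrK lef_pV2 ?posrE ?invr_gt0 //.
by rewrite ltW // truncnS_gt.
Qed.

Section one_scale.
Context {T : Type} {A : set (T -> C)} {p : R -> (T -> C) -> \bar R}.
Hypothesis sA : silva_scale A p.
Implicit Types (K : set (T -> C)) (f g k b : T -> C).

Let normc1 : normc (1 : C) = 1.
Proof. by rewrite (normc_real 1) normr1. Qed.

Lemma scaleD h f g (M N : R) : 0 < h -> A f -> A g ->
  (p h f <= M%:E)%E -> (p h g <= N%:E)%E ->
  A (fun x => f x + g x) /\ (p h (fun x => (f x + g x)%R) <= (M + N)%:E)%E.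
Proof.
move=> h0 Af Ag pf pg; have := scale_lin sA 1 1 h0 Af Ag pf pg.
rewrite normc1 !mul1r (_ : (fun x => 1 * f x + 1 * g x) = fun x => f x + g x) //.
by apply/funext => x; rewrite !mul1r.
Qed.

Lemma scaleB h f g (M N : R) : 0 < h -> A f -> A g ->
  (p h f <= M%:E)%E -> (p h g <= N%:E)%E ->
  A (fun x => f x - g x) /\ (p h (fun x => (f x - g x)%R) <= (M + N)%:E)%E.
Proof.
move=> h0 Af Ag pf pg; have := scale_lin sA 1 (- 1) h0 Af Ag pf pg.
have -> : normc (- 1 : C) = normc (1 : C) by exact: normcN.
rewrite normc1 !mul1r (_ : (fun x => 1 * f x + (- 1) * g x) = fun x => f x - g x) //.
by apply/funext => x; rewrite !mul1r mulN1r.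
Qed.

Definition compact_disk (m : nat) K : Prop :=
  [/\ K (fun=> 0), absolutely_convex K,
      (forall k, K k -> A k /\ exists M : R, (p (radius m) k <= M%:E)%E) &
      forall (U : set_system nat) (k : nat -> T -> C), UltraFilter U ->
        (forall j, K (k j)) -> exists2 g, K g & tends U p (radius m) k g].

Definition add_ball (m : nat) (r : R) K : set (T -> C) :=
  [set f | exists k b, [/\ K k, A b, (p (radius m) b <= r%:E)%E & f = fun x => k x + b x]].

Lemma sub_add_ball m r K : 0 < r -> K `<=` add_ball m r K.
Proof.
move=> r0 k Kk; exists k, (fun=> 0); split=> //; first exact: (scale_zero sA).1.
  apply: le_trans ((scale_zero sA).2 _ (radius_gt0 m)) _.
  by rewrite lee_fin ltW.
by apply/funext => x; rewrite addr0.
Qed.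

Lemma compact_disk0 : compact_disk 0 [set (fun=> 0)].
Proof.
split=> //.
- by move=> f g -> -> c d _; apply/funext => x /=; rewrite !mulr0 addr0.
- move=> k ->; split; first exact: (scale_zero sA).1.
  by exists 0; exact: ((scale_zero sA).2 _ (radius_gt0 0)).
- move=> U k UU K0; exists (fun=> 0) => // e e0; apply: filterS filterT => j _ /=.
  rewrite (K0 j) (_ : (fun x => 0 - 0) = fun=> 0); last by apply/funext => x; rewrite subr0.
  apply: le_trans ((scale_zero sA).2 _ (radius_gt0 0)) _.
  by rewrite lee_fin ltW.
Qed.

(** The ball of the step [m] is relatively compact in the next one, and the sum
    of two sequences that converge along an ultrafilter converges. *)
Lemma compact_disk_add_ball m r K : 0 < r -> compact_disk m K ->
  compact_disk m.+1 (add_ball m r K).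
Proof.
move=> r0 [K0 cK bK kK].
have h0 := radius_gt0 m; have h'0 := radius_gt0 m.+1; have hh := radius_lt m.
split.
- exact: (sub_add_ball m r0 K0).
- move=> f g [k [b [Kk Ab pb ->]]] [k' [b' [Kk' Ab' pb' ->]]] c d cd.
  have [AL pL] := scale_lin sA c d h0 Ab Ab' pb pb'.
  exists (fun x => c * k x + d * k' x), (fun x => c * b x + d * b' x); split=> //.
  + exact: cK.
  + apply: le_trans pL _; rewrite lee_fin -mulrDl -[leRHS]mul1r.
    by apply: ler_wpM2r => //; exact: ltW.
  + by apply/funext => x; ring.
- move=> f [k [b [Kk Ab pb ->]]]; have [Ak [M pM]] := bK k Kk.
  have pM' := scale_mono sA h'0 (ltW hh) pM; have pb' := scale_mono sA h'0 (ltW hh) pb.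
  have [Akb pkb] := scaleD h'0 Ak Ab pM' pb'.
  by split=> //; exists (M + r).
move=> U f UU Hf.
have /choice[kb Hkb] : forall j, exists kb : (T -> C) * (T -> C),
    [/\ K kb.1, A kb.2, (p (radius m) kb.2 <= r%:E)%E & f j = fun x => kb.1 x + kb.2 x].
  by move=> j; have [k [b H]] := Hf j; exists (k, b).
have Kk j : K (kb j).1 by have [] := Hkb j.
have Ab j : A (kb j).2 by have [] := Hkb j.
have pb j : (p (radius m) (kb j).2 <= r%:E)%E by have [] := Hkb j.
have [g Kg tg] := kK U (fun j => (kb j).1) UU Kk.
have [b [Ab0 pb0 tb]] := scale_compact sA UU h'0 hh Ab pb.
exists (fun x => g x + b x); first by exists g, b.
move=> e e0; have e2 : 0 < e / 2 by rewrite divr_gt0.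
apply: filterS2 (tg _ e2) (tb _ e2) => j /= tj tbj.
have [_ _ _ ->] := Hkb j.
have [Agj [M pM]] := bK _ (Kk j); have [Ag [M' pM']] := bK _ Kg.
have A1 := (scaleB h0 Agj Ag pM pM').1; have A2 := (scaleB h0 (Ab j) Ab0 (pb j) pb0).1.
have [_] := scaleD h'0 A1 A2 (scale_mono sA h'0 (ltW hh) tj) tbj.
rewrite -splitr (_ : (fun x => _) = (fun x => (kb j).1 x + (kb j).2 x - (g x + b x))) //.
by apply/funext => x; ring.
Qed.

(** The radii may be chosen in succession, each depending on the previous sets:
    every step is eventually met in a ball. *)
Lemma union_nbhs0 (K : nat -> set (T -> C)) (r : nat -> R) :
  (forall m, 0 < r m) -> (forall m, compact_disk m (K m)) ->
  (forall m, K m.+1 = add_ball m (r m) (K m)) ->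
  indlim_nbhs0 A p (\bigcup_m K m).
Proof.
move=> r0 cK EK.
have mono m m' : (m <= m')%N -> K m `<=` K m'.
  move=> /subnKC <-; elim: (m' - m)%N => [|d IH]; first by rewrite addn0.
  by rewrite addnS EK; apply: subset_trans IH _; exact: sub_add_ball.
split.
  move=> f g [m _ Kf] [m' _ Kg] c d cd; exists (maxn m m') => //.
  have [_ cc _ _] := cK (maxn m m'); apply: cc cd.
    exact: mono (leq_maxl _ _) _ Kf.
  exact: mono (leq_maxr _ _) _ Kg.
move=> h h0; have [m hm] := radius_small h0.
exists (r m) => // f [Af _] pf; exists m.+1 => //; rewrite EK.
have [K0 _ _ _] := cK m.
exists (fun=> 0), f; split=> //; first exact: (scale_mono sA (radius_gt0 m) hm pf).
by apply/funext => x; rewrite add0r.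
Qed.

(** Perturbing by elements of a compact disk and of balls of radii tending to
    zero gives, along an ultrafilter, a sequence converging in one step. *)
Lemma tends_add (U : set_system nat) (UU : UltraFilter U) m h00 f0 K (k b : nat -> T -> C) :
  compact_disk m K -> 0 < h00 -> step A p h00 f0 ->
  (forall j, K (k j)) -> (forall j, A (b j)) ->
  (forall e : R, 0 < e -> U [set j | (p (radius m) (b j) <= e%:E)%E]) ->
  (forall j, exists M : R, (p (radius m) (b j) <= M%:E)%E) ->
  exists2 g, K g & forall h, 0 < h -> h <= h00 -> h <= radius m ->
    [/\ step A p h (fun x => f0 x + g x),
        (forall j, step A p h (fun x => f0 x + (k j x + b j x))) &
        tends U p h (fun j x => f0 x + (k j x + b j x)) (fun x => f0 x + g x)].
Proof.
move=> [K0 cK bK kK] h000 [Af0 pf0] Kk Ab tb bb.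
have [g Kg tg] := kK U k UU Kk.
exists g => // h h0 hh00 hm.
have [M0 pM0] : exists M : R, (p h f0 <= M%:E)%E.
  have [M pM] : exists M : R, (p h00 f0 <= M%:E)%E.
    move: pf0; case: (p h00 f0) => [M _|pf0|_]; first by exists M.
      by rewrite ltxx in pf0.
    by exists 0; rewrite leNye.
  by exists M; exact: (scale_mono sA h0 _ pM).
have bK' f : K f -> A f /\ exists M : R, (p h f <= M%:E)%E.
  move=> /bK[Af [M pM]]; split=> //; exists M; exact: (scale_mono sA h0 _ pM).
have [Ag [Mg pg]] := bK' _ Kg.
have fin f (M : R) : A f -> (p h f <= M%:E)%E -> step A p h f.
  by move=> Af pf; split=> //; apply: le_lt_trans pf _; exact: ltry.
split.
- have [Afg pfg] := scaleD h0 Af0 Ag pM0 pg; exact: fin pfg.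
- move=> j; have [Ak [Mk pk]] := bK' _ (Kk j); have [Mb pb] := bb j.
  have [A1 p1] := scaleD h0 Ak (Ab j) pk (scale_mono sA h0 hm pb).
  have [A2 p2] := scaleD h0 Af0 A1 pM0 p1; exact: fin p2.
move=> e e0; have e2 : 0 < e / 2 by rewrite divr_gt0.
apply: filterS2 (tg _ e2) (tb _ e2) => j /= tj tbj.
have [Ak [Mk pk]] := bK' _ (Kk j).
have A1 := (scaleB h0 Ak Ag pk pg).1.
have [_] := scaleD h0 A1 (Ab j) (scale_mono sA h0 hm tj) (scale_mono sA h0 hm tbj).
rewrite -splitr (_ : (fun x => _) = (fun x => f0 x + (k j x + b j x) - (f0 x + g x))) //.
by apply/funext => x; ring.
Qed.

End one_scale.

Section two_scales.
Context {T1 T2 : Type}.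
Context {A1 : set (T1 -> C)} {p1 : R -> (T1 -> C) -> \bar R}.
Context {A2 : set (T2 -> C)} {p2 : R -> (T2 -> C) -> \bar R}.
Hypotheses (s1 : silva_scale A1 p1) (s2 : silva_scale A2 p2).
Variable Q : (T1 -> C) -> (T2 -> C) -> Prop.
Hypothesis Q_open : forall (U : set_system nat) h f f0 g g0, UltraFilter U -> 0 < h ->
  step A1 p1 h f0 -> (forall j, step A1 p1 h (f j)) -> tends U p1 h f f0 ->
  step A2 p2 h g0 -> (forall j, step A2 p2 h (g j)) -> tends U p2 h g g0 ->
  Q f0 g0 -> U [set j | Q (f j) (g j)].
Variables (f0 : T1 -> C) (g0 : T2 -> C) (h1 h2 : R).
Hypotheses (h10 : 0 < h1) (h20 : 0 < h2).
Hypotheses (sf0 : step A1 p1 h1 f0) (sg0 : step A2 p2 h2 g0) (Q0 : Q f0 g0).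

Let Qon (K : set (T1 -> C)) (L : set (T2 -> C)) : Prop :=
  forall k l, K k -> L l -> Q (fun x => f0 x + k x) (fun x => g0 x + l x).

Let good m (KL : set (T1 -> C) * set (T2 -> C)) : Prop :=
  [/\ @compact_disk _ A1 p1 m KL.1, @compact_disk _ A2 p2 m KL.2 & Qon KL.1 KL.2].

Let enlarge m (r : R) (KL : set (T1 -> C) * set (T2 -> C)) :=
  (@add_ball _ A1 p1 m r KL.1, @add_ball _ A2 p2 m r KL.2).

(** If no radius works, there are counterexamples with radii [1 / (j + 1)].  Along
    an ultrafilter they converge in some step to a pair of points of the compact
    disks, where [Q] holds, so [Q] holds for some of them. *)
Let enlarge_good m KL : good m KL -> exists r, 0 < r /\ good m.+1 (enlarge m r KL).
Proof.
case: KL => K L [/= cK cL QKL].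
suff [r r0 Qr] : exists2 r : R, 0 < r &
    Qon (@add_ball _ A1 p1 m r K) (@add_ball _ A2 p2 m r L).
  by exists r; split=> //; split=> //; exact: compact_disk_add_ball.
apply: contrapT => nQ.
have H j : exists q : (T1 -> C) * (T1 -> C) * ((T2 -> C) * (T2 -> C)),
    [/\ K q.1.1, L q.2.1,
       A1 q.1.2 /\ (p1 (radius m) q.1.2 <= (radius j)%:E)%E,
       A2 q.2.2 /\ (p2 (radius m) q.2.2 <= (radius j)%:E)%E &
       ~ Q (fun x => f0 x + (q.1.1 x + q.1.2 x)) (fun x => g0 x + (q.2.1 x + q.2.2 x))].
  apply: contrapT => nq; apply: nQ; exists (radius j); first exact: radius_gt0.
  move=> f g [k [b [Kk Ab pb ->]]] [l [d [Ll Ad pd ->]]].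
  by apply: contrapT => nQfg; apply: nq; exists ((k, b), (l, d)).
have [q Hq] := choice H.
have [U [UU /(_ _ _)UN]] := ultraFilterLemma eventually_filter.
have small (T : Type) (p : R -> (T -> C) -> \bar R) (b : nat -> T -> C) :
    (forall j, (p (radius m) (b j) <= (radius j)%:E)%E) ->
    forall e : R, 0 < e -> U [set j | (p (radius m) (b j) <= e%:E)%E].
  move=> pb e e0; apply: UN; have [N rN] := radius_small e0.
  exists N => // j Nj /=; apply: le_trans (pb j) _; rewrite lee_fin; apply: le_trans rN.
  by rewrite lef_pV2 ?posrE // ler_nat ltnS.
have pb1 j : (p1 (radius m) (q j).1.2 <= (radius j)%:E)%E by have [_ _ []] := Hq j.
have pb2 j : (p2 (radius m) (q j).2.2 <= (radius j)%:E)%E by have [_ _ _ []] := Hq j.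
have [||||k Kk tk] := @tends_add _ A1 p1 s1 U UU m h1 f0 K (fun j => (q j).1.1) (fun j => (q j).1.2) cK h10 sf0.
- by move=> j; have [] := Hq j.
- by move=> j; have [_ _ []] := Hq j.
- exact: (small _ p1 _ pb1).
- by move=> j; exists (radius j).
have [||||l Ll tl] := @tends_add _ A2 p2 s2 U UU m h2 g0 L (fun j => (q j).2.1) (fun j => (q j).2.2) cL h20 sg0.
- by move=> j; have [] := Hq j.
- by move=> j; have [_ _ _ []] := Hq j.
- exact: (small _ p2 _ pb2).
- by move=> j; exists (radius j).
pose h := Num.min (Num.min h1 h2) (radius m).
have h0 : 0 < h by rewrite !lt_min h10 h20 radius_gt0.
have hh1 : h <= h1 by rewrite !ge_min lexx.
have hh2 : h <= h2 by rewrite !ge_min lexx !orbT.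
have hm : h <= radius m by rewrite !ge_min lexx orbT.
have [a1 a2 a3] := tk h h0 hh1 hm; have [b1 b2 b3] := tl h h0 hh2 hm.
have QU := Q_open UU h0 a1 a2 a3 b1 b2 b3 (QKL _ _ Kk Ll).
have [j /= Qj] := filter_ex (FF := @ultra_proper _ _ UU) QU.
by have [_ _ _ _] := Hq j; apply.
Qed.

(** An increasing sequence of compact disks is built by adding at each stage a
    ball of the next step, so small that [Q] persists; the union of the
    sequence is a neighbourhood of zero for the inductive limit.  Compactness
    is what makes a positive radius possible although [Q] is only known to be
    open in each step. *)
Lemma silva_open : exists V1 V2, [/\ indlim_nbhs0 A1 p1 V1, indlim_nbhs0 A2 p2 V2 &
  forall k l, V1 k -> V2 l -> Q (fun x => f0 x + k x) (fun x => g0 x + l x)].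
Proof.
have H (z : nat * (set (T1 -> C) * set (T2 -> C))) :
    exists r, 0 < r /\ (good z.1 z.2 -> good z.1.+1 (enlarge z.1 r z.2)).
  have [/enlarge_good[r [r0 gr]]|nz] := pselect (good z.1 z.2); first by exists r.
  by exists 1; split=> // /nz.
have [rho Hrho] := choice H.
pose KL := fix KL m := if m is m'.+1 then enlarge m' (rho (m', KL m')) (KL m')
                       else ([set (fun=> 0 : C)], [set (fun=> 0 : C)]).
have gKL m : good m (KL m).
  elim: m => [|m IH]; last by have [_] := Hrho (m, KL m); exact.
  split; [exact: compact_disk0|exact: compact_disk0|].
  move=> k l Kk Ll; have {Kk} Ek : k = fun=> 0 by exact: Kk.
  have {Ll} El : l = fun=> 0 by exact: Ll.
  have Ef : (fun x => f0 x + k x) = f0 by apply/funext => x; rewrite Ek addr0.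
  have Eg : (fun x => g0 x + l x) = g0 by apply/funext => x; rewrite El addr0.
  by rewrite Ef Eg.
have r0 m : 0 < rho (m, KL m) by have [] := Hrho (m, KL m).
have c1 m : @compact_disk _ A1 p1 m (KL m).1 by have [] := gKL m.
have c2 m : @compact_disk _ A2 p2 m (KL m).2 by have [] := gKL m.
exists (\bigcup_m (KL m).1), (\bigcup_m (KL m).2); split.
- exact: (union_nbhs0 s1 (r := fun m => rho (m, KL m))).
- exact: (union_nbhs0 s2 (r := fun m => rho (m, KL m))).
move=> k l [m _ Kk] [m' _ Ll].
have mono1 : forall m m', (m <= m')%N -> (KL m).1 `<=` (KL m').1.
  move=> i i' /subnKC <-; elim: (i' - i)%N => [|d IH]; first by rewrite addn0.
  by rewrite addnS /=; apply: subset_trans IH _; exact: (sub_add_ball s1).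
have mono2 : forall m m', (m <= m')%N -> (KL m).2 `<=` (KL m').2.
  move=> i i' /subnKC <-; elim: (i' - i)%N => [|d IH]; first by rewrite addn0.
  by rewrite addnS /=; apply: subset_trans IH _; exact: (sub_add_ball s2).
have [_ _ QK] := gKL (maxn m m'); apply: QK.
  exact: mono1 (leq_maxl _ _) _ Kk.
exact: mono2 (leq_maxr _ _) _ Ll.
Qed.

End two_scales.
End scales.

(** * Continuity of the transform *)
Section gelfand_shilov_scale.
Context {R : realType} {n : nat}.
Notation C := R[i].
Notation Omega := (rvint (@envelope R n)).
Implicit Types (phi psi : 'rV[R]_n -> C) (x : 'rV[R]_n) (w : seq 'I_n).

Lemma schwartz_smooth phi : schwartz phi -> csmooth phi.
Proof. by case. Qed.

Lemma rsmooth0 : row_smooth (fun _ : 'rV[R]_n => 0 : R) /\ forall w, 'd_w (fun=> 0 : R) = (fun=> 0) :> ('rV[R]_n -> R).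
Proof.
pose F (w : seq 'I_n) (x : 'rV[R]_n) : R := 0.
have cF w : continuous (F w) by move=> x; exact: cst_continuous.
have dF w i x : is_derive x (@unitv R n i) (F w) (F (i :: w) x) by exact: is_derive_cst.
exact: (rsmooth_jet cF dF).
Qed.

Lemma gs_norm0 (rho1 rho2 h : R) : (gs_norm rho1 rho2 h (fun _ : 'rV[R]_n => 0%R : C) <= 0)%E.
Proof.
apply/gs_normP => x a b; rewrite mderivE.
have [_ E] := rsmooth0.
have E1 : ReF (fun _ : 'rV[R]_n => 0 : C) = fun=> 0 by [].
have E2 : ImF (fun _ : 'rV[R]_n => 0 : C) = fun=> 0 by [].
by rewrite E1 E2 E (_ : Complex 0 0 = 0) // mulr0 normc0 mulr0.
Qed.

Lemma gs_scale (rho1 rho2 : R) : (0 < n)%N -> 0 <= rho1 -> 0 <= rho2 ->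
  silva_scale (@schwartz R n) (@gs_norm R n rho1 rho2).
Proof.
move=> n0 r1 r2; split.
- move=> h c d f g M N h0 /schwartz_smooth sf /schwartz_smooth sg pf pg.
  have pL := gs_norm_clin c d (ltW h0) sf sg pf pg.
  have [sL _] := cpartials_clin c d sf sg.
  by split; [exact: (gs_norm_schwartz h0 sL pL)|exact: pL].
- move=> h h' f M h0 hh; exact: gs_norm_le_mono (ltW h0) hh.
- split=> [|h h0]; last exact: gs_norm0.
  have s0 : csmooth (fun _ : 'rV[R]_n => 0 : C).
    by apply/smooth_onT; split; exact: rsmooth0.1.
  exact: (gs_norm_schwartz ltr01 s0 (gs_norm0 rho1 rho2 1)).
- move=> U h h' r f UU h'0 hh Af pf.
  have sf j : csmooth (f j) by exact: schwartz_smooth.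
  have [g [sg pg tg]] := gs_compact UU n0 h'0 hh r1 r2 sf pf.
  by exists g; split=> //; exact: (gs_norm_schwartz (lt_trans h'0 hh) sg pg).
Qed.

Lemma gs_moment_bound (c : seq 'I_n) (H sigma tau : R) : exists2 K : R, 0 <= K &
  forall (f : 'rV[R]_n -> R) e, row_smooth f -> gs_bound e H sigma tau f ->
    rvintegrable (wmul c f) /\ `|rvint (wmul c f)| <= K * e.
Proof.
pose Y m : R := `|H ^+ (m + size ([::] : seq 'I_n)) * fpow m tau|.
pose K := Y (size c) + Y (2 * n + size c)%N.
have Y0 m : 0 <= Y m by exact: normr_ge0.
have K0 : 0 <= K by exact: addr_ge0.
exists (2 ^+ n * K * Omega); first by rewrite !mulr_ge0 ?exprn_ge0 ?Omega_ge0.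
move=> f e sf bf; have e0 := gs_bound_ge0 bf.
have B m x : `|x| ^+ m * `|f x| <= e * Y m.
  have := bf m [::] x; rewrite rpartials_nil /= fpow0 mulr1 -mulrA => h; apply: le_trans h _.
  by apply: ler_wpM2l => //; exact: ler_norm.
have wle x : `|wmul c f x| <= `|x| ^+ size c * `|f x|.
  by rewrite normrM; apply: ler_wpM2r => //; exact: word_pow_le.
have cw : continuous (wmul c f) by apply: continuous_wmul; exact: rsmooth_continuous sf.
have [||Fi FE] := @rvint_bound R n (wmul c f) (e * K) cw.
- move=> x; apply: le_trans (wle x) _; apply: le_trans (B _ _) _.
  by apply: ler_wpM2l => //; rewrite lerDl.
- move=> x; apply: le_trans (ler_wpM2l _ (wle x)) _; first by rewrite exprn_ge0.
  rewrite mulrA -exprD; apply: le_trans (B _ _) _.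
  by apply: ler_wpM2l => //; rewrite lerDr.
split=> //; apply: le_trans FE _; rewrite le_eqVlt; apply/orP; left; apply/eqP; ring.
Qed.

(** Moments are continuous on every step, so having vanishing moments passes
    to limits. *)
Lemma cmoments0_lim (U : set_system nat) (rho1 rho2 h : R) (f : nat -> 'rV[R]_n -> C) g :
  ProperFilter U -> (0 < n)%N -> 0 < h -> 0 <= rho1 -> 0 <= rho2 ->
  step (@schwartz R n) (gs_norm rho1 rho2) h g ->
  (forall j, step (@schwartz R n) (gs_norm rho1 rho2) h (f j)) ->
  tends U (gs_norm rho1 rho2) h f g -> U [set j | cmoments0 (f j)] -> cmoments0 g.
Proof.
move=> UP n0 h0 r1 r2 [Ag pg] sf tf mf.
have [M M0 pM] := gs_norm_fin (ltW h0) pg.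
have sg := schwartz_smooth Ag.
have [sgr sgi] := (smooth_onT (@unitv R n) g).1 sg.
have [bgr bgi] := gs_norm_gs_bound n0 h0 r1 sgr sgi pM.
suff H c : forall e, 0 < e -> `|rvint (wmul c (ReF g))| <= e /\ `|rvint (wmul c (ImF g))| <= e.
  have Z (z : R) : (forall e, 0 < e -> `|z| <= e) -> z = 0.
    move=> Hz; apply/eqP; rewrite -normr_le0; apply/ler_addgt0Pr => e e0.
    by rewrite add0r; exact: Hz.
  by apply/cmoments0P; split=> c; apply: Z => e e0; have [] := H c e e0.
move=> e e0; have [K K0 HK] := gs_moment_bound c (Num.max 1 h^-1) rho1 rho2.
have d0 : 0 < e / (K + 1) by rewrite divr_gt0 // ltr_wpDl.
have [j [/= tj mj]] := filter_ex (filterI (tf _ d0) mf).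
have [Afj _] := sf j; have sfj := schwartz_smooth Afj.
have [sd _] := cpartials_clin 1 (- 1) sfj sg.
rewrite (_ : (fun x => 1 * f j x + (- 1) * g x) = fun x => f j x - g x) in sd; last first.
  by apply/funext => x; rewrite mul1r mulN1r.
have [sdr sdi] := (smooth_onT (@unitv R n) _).1 sd.
have [bdr bdi] := gs_norm_gs_bound n0 h0 r1 sdr sdi tj.
have [mjr mji] := (cmoments0P _).1 mj.
have step1 (u v d : 'rV[R]_n -> R) : (forall x, d x = u x - v x) -> rvint (wmul c u) = 0 ->
    row_smooth d -> gs_bound (e / (K + 1)) (Num.max 1 h^-1) rho1 rho2 d ->
    row_smooth v -> gs_bound M (Num.max 1 h^-1) rho1 rho2 v -> `|rvint (wmul c v)| <= e.
  move=> dE u0 sdd bd sv bv.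
  have [Id Ed] := HK _ _ sdd bd; have [Iv _] := HK _ _ sv bv.
  have [_ E] := rvintD Id Iv.
  have Eu : (fun x => wmul c d x + wmul c v x) = wmul c u.
    by apply/funext => x; rewrite /wmul dE; ring.
  rewrite Eu u0 in E; have -> : rvint (wmul c v) = - rvint (wmul c d).
    by apply/eqP; rewrite -addr_eq0 addrC -E.
  rewrite normrN; apply: le_trans Ed _; rewrite mulrA ler_pdivrMr ?ltr_wpDl //.
  by rewrite mulrC; apply: ler_wpM2l; rewrite ?(ltW e0) // lerDl.
have Re_sub (z w : C) : complex.Re (z - w) = complex.Re z - complex.Re w by case: z; case: w.
have Im_sub (z w : C) : complex.Im (z - w) = complex.Im z - complex.Im w by case: z; case: w.
split.
  by apply: (step1 (ReF (f j)) (ReF g) _ (fun x => Re_sub _ _) (mjr c) sdr).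
by apply: (step1 (ImF (f j)) (ImF g) _ (fun x => Im_sub _ _) (mji c) sdi).
Qed.

End gelfand_shilov_scale.

Section wave_continuity.
Context {R : realType} {n : nat}.
Notation C := R[i].

Lemma moments0_lin (c d : R) (f g : 'rV[R]_n -> R) : decays f -> decays g ->
  moments0 f -> moments0 g -> moments0 (fun x => c * f x + d * g x).
Proof.
move=> df dg mf mg w.
have [I1 E1] := rvintZ c (decays_integrable (decays_wmul w df)).
have [I2 E2] := rvintZ d (decays_integrable (decays_wmul w dg)).
have [_ E] := rvintD I1 I2.
rewrite (_ : wmul w _ = fun x => c * wmul w f x + d * wmul w g x); last first.
  by apply/funext => x; rewrite /wmul; ring.
by rewrite E E1 E2 mf mg !mulr0 addr0.
Qed.

Lemma cmoments0_lin (c d : R) (f g : 'rV[R]_n -> C) : cschwartz f -> cschwartz g ->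
  cmoments0 f -> cmoments0 g -> cmoments0 (fun x => c%:C * f x + d%:C * g x).
Proof.
move=> [fr fi] [gr gi] /cmoments0P[mfr mfi] /cmoments0P[mgr mgi].
have D := @rschwartz_decays R n.
apply/cmoments0P; rewrite ReF_lin ImF_lin.
by split; apply: moments0_lin => //; exact: D.
Qed.

Variables (rho1 rho2 sigma tau s t tau1 tau2 : R).
Hypotheses (n0 : (0 < n)%N) (sigma0 : 0 <= sigma) (rho10 : 0 <= rho1).
Hypotheses (tau_1 : 1 <= tau) (rho2_1 : 1 <= rho2).
Hypotheses (sigma_s : sigma <= s) (sigma_tau2 : sigma + rho2 - 1 <= tau2).
Hypotheses (tau_t : tau <= t) (rho2_t : rho2 <= t).
Hypotheses (rho1_tau1 : tau + rho1 - 1 <= tau1) (rho_t : tau + rho1 - 1 + rho2 <= t).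
Implicit Types (phi psi : 'rV[R]_n -> C).
Notation p1 := (@gs_norm R n rho1 rho2).
Notation p2 := (@gs_norm R n sigma tau).
Notation S := (@schwartz R n).

Let bound al := wave_bound n0 sigma0 rho10 tau_1 rho2_1 sigma_s sigma_tau2 tau_t rho2_t
  rho1_tau1 rho_t al.

Lemma wave_steps al h psi phi (A B : R) : 0 < h -> S psi -> S phi ->
  (p1 h psi <= A%:E)%E -> (p2 h phi <= B%:E)%E -> cmoments0 psi -> cmoments0 phi ->
  steps (@hs_smooth R n) (@hs_norm R n s t tau1 tau2 al) (wave psi phi).
Proof.
move=> h0 /schwartz_smooth sp /schwartz_smooth sf pA pB mp mf.
have [h' [K [h'0 K0 HK]]] := bound al h0.
exists h'; first exact: h'0.
split.
  exact: (wave_jet (gs_norm_cschwartz n0 h0 rho10 sp pA) (gs_norm_cschwartz n0 h0 sigma0 sf pB)).1.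
by apply: le_lt_trans (HK _ _ _ _ sp sf pA pB mp mf) _; exact: ltry.
Qed.

(** The set of pairs whose transform lies in a given open set; pairs with a
    non-vanishing moment are put in it as well, so that it is defined by a
    condition on all of the ambient spaces. *)
Definition wave_in al (U : set (hs_indlim n s t tau1 tau2 al)) psi phi : Prop :=
  cmoments0 psi -> cmoments0 phi -> exists2 Phi, U Phi & \val Phi = wave psi phi.

Let gs_diff2 q1 q2 h psi psi' (e : R) : 0 < h -> S psi -> S psi' ->
  cschwartz psi -> cschwartz psi' -> cmoments0 psi -> cmoments0 psi' ->
  (gs_norm q1 q2 h (fun x => (psi x - psi' x)%R) <= e%:E)%E ->
  let d := fun x => (2 : R)%:C * psi x + (- 2 : R)%:C * psi' x in
  [/\ csmooth d, (gs_norm q1 q2 h d <= (2 * e)%:E)%E & cmoments0 d].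
Proof.
move=> h0 /schwartz_smooth sp /schwartz_smooth sp' cp cp' mp mp' pd d.
have [sd _] := cpartials_clin (2 : R)%:C (- 2 : R)%:C sp sp'.
have E1 : (fun x => 1 * psi x + (- 1) * psi' x) = (fun x => psi x - psi' x).
  by apply/funext => x; rewrite mul1r mulN1r.
have [sm _] := cpartials_clin 1 (- 1) sp sp'; rewrite E1 in sm.
have pD := gs_norm_clin (2 : R)%:C 0 (ltW h0) sm sm pd pd.
have E2 : (fun x => (2 : R)%:C * (psi x - psi' x) + 0 * (psi x - psi' x)) = d.
  by apply/funext => x; rewrite /d rmorphN /=; ring.
have N2 : normc ((2 : R)%:C) * e + normc (0 : C) * e = 2 * e.
  by rewrite normc0 mul0r addr0 normc_real ger0_norm.
rewrite E2 N2 in pD.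
split; [exact: sd|exact: pD|exact: (cmoments0_lin 2 (- 2) cp cp' mp mp')].
Qed.

Let gs_fin q1 q2 h psi : 0 < h -> step S (gs_norm q1 q2) h psi ->
  exists2 M, 0 <= M & (gs_norm q1 q2 h psi <= M%:E)%E.
Proof. by move=> h0 [_]; exact: gs_norm_fin (ltW h0). Qed.

(** Let the pairs converge and suppose that the conclusion fails.  Then the failing
    pairs have vanishing moments, hence so has the limit, whose transform lies in
    the open set; by bilinearity and the bound on steps, the transforms converge
    in a step of the target, a contradiction. *)
Lemma wave_in_open al (U : set (hs_indlim n s t tau1 tau2 al)) :
  indlim_open U -> forall (F : set_system nat) (h : R)
    (psi : nat -> 'rV[R]_n -> C) psi0 (phi : nat -> 'rV[R]_n -> C) phi0, UltraFilter F -> 0 < h ->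
  step S p1 h psi0 -> (forall j, step S p1 h (psi j)) -> tends F p1 h psi psi0 ->
  step S p2 h phi0 -> (forall j, step S p2 h (phi j)) -> tends F p2 h phi phi0 ->
  wave_in U psi0 phi0 -> F [set j | wave_in U (psi j) (phi j)].
Proof.
move=> oU F h psi psi0 phi phi0 UF h0 sp0 sp tp sf0 sf tf H0.
have [//|nF] := in_ultra_setVsetC [set j | wave_in U (psi j) (phi j)] UF.
exfalso.
have nin P Q : ~ wave_in U P Q -> cmoments0 P /\ cmoments0 Q.
  move=> nw; split; apply: contrapT => nm; apply: nw => mP mQ; first by case: nm.
  by case: nm.
have mp : F [set j | cmoments0 (psi j)] by apply: filterS nF => j /= /nin[].
have mf : F [set j | cmoments0 (phi j)] by apply: filterS nF => j /= /nin[].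
have rho20 : 0 <= rho2 by exact: le_trans rho2_1.
have tau0 : 0 <= tau by exact: le_trans tau_1.
have UP := @ultra_proper _ _ UF.
have mp0 := cmoments0_lim UP n0 h0 rho10 rho20 sp0 sp tp mp.
have mf0 := cmoments0_lim UP n0 h0 sigma0 tau0 sf0 sf tf mf.
have [Phi UPhi EPhi] := H0 mp0 mf0.
have [V [cV nV] VU] := oU _ UPhi.
have [A A0 pA] := gs_fin h0 sp0; have [B B0 pB] := gs_fin h0 sf0.
have [h' [K [h'0 K0 HK]]] := bound al h0.
have [r r0 rV] := nV _ h'0.
(* the factor 2 prepares for the convex combination with weights 1/2 below *)
pose m := K * (2 * (A + (B + 1))) + 1.
have m0 : 0 < m by rewrite ltr_wpDl // mulr_ge0 // mulr_ge0 // !addr_ge0.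
pose e := Num.min 1 (r / m).
have e0 : 0 < e by rewrite lt_min ltr01 divr_gt0.
have [j [/= [tpj tfj] nj]] := filter_ex (filterI (filterI (tp _ e0) (tf _ e0)) nF).
have [mpj mfj] := nin _ _ nj.
have ph := schwartz_smooth (sp j).1; have fh := schwartz_smooth (sf j).1.
have ph0 := schwartz_smooth sp0.1; have fh0 := schwartz_smooth sf0.1.
have [Aj Aj0 pAj] := gs_fin h0 (sp j); have [Bj Bj0 pBj] := gs_fin h0 (sf j).
have cpj := gs_norm_cschwartz n0 h0 rho10 ph pAj; have cfj := gs_norm_cschwartz n0 h0 sigma0 fh pBj.
have cp0 := gs_norm_cschwartz n0 h0 rho10 ph0 pA; have cf0 := gs_norm_cschwartz n0 h0 sigma0 fh0 pB.
have pBj1 : (p2 h (phi j) <= (B + 1)%:E)%E.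
  have e1 : (p2 h (fun x => (phi j x - phi0 x)%R) <= 1%:E)%E.
    by apply: le_trans tfj _; rewrite lee_fin ge_min lexx.
  have [sm _] := cpartials_clin 1 (- 1) fh fh0.
  have E1 : (fun x => 1 * phi j x + (- 1) * phi0 x) = (fun x => phi j x - phi0 x).
    by apply/funext => x; rewrite mul1r mulN1r.
  rewrite E1 in sm.
  have := gs_norm_clin 1 1 (ltW h0) fh0 sm pB e1.
  rewrite (normc_real 1) normr1 !mul1r.
  by rewrite (_ : (fun x => _) = phi j) //; apply/funext => x; ring.
have [sdp pdp mdp] := gs_diff2 h0 (sp j).1 sp0.1 cpj cp0 mpj mp0 tpj.
have [sdf pdf mdf] := gs_diff2 h0 (sf j).1 sf0.1 cfj cf0 mfj mf0 tfj.
have q1 := HK _ _ _ _ sdp fh pdp pBj1 mdp mfj.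
have q2 := HK _ _ _ _ ph0 sdf pA pdf mp0 mdf.
have em : e * m <= r by rewrite -ler_pdivlMr // ge_min lexx orbT.
have r1 : K * (2 * e * (B + 1)) <= r.
  apply: le_trans em; rewrite /m mulrDr mulr1 !mulrDr.
  have : 0 <= e * (K * (2 * A)) by rewrite !mulr_ge0 // ltW.
  move: (ltW e0) => ?; move=> h1.
  rewrite [leLHS](_ : _ = e * (K * (2 * B)) + e * (K * (2 * 1))); last by ring.
  by move: (e * _) (e * _) (e * _) h1 => *; lra.
have r2 : K * (A * (2 * e)) <= r.
  apply: le_trans em; rewrite /m mulrDr mulr1 !mulrDr.
  have h1 : 0 <= e * (K * (2 * B)) by rewrite !mulr_ge0 // ltW.
  have h2 : 0 <= e * (K * (2 * 1)) by rewrite !mulr_ge0 // ltW.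
  rewrite [leLHS](_ : _ = e * (K * (2 * A))); last by ring.
  by move: (ltW e0) h1 h2; move: (e * _) (e * _) (e * _) => *; lra.
pose D1 := wave (fun x => (2 : R)%:C * psi j x + (- 2 : R)%:C * psi0 x) (phi j).
pose D2 := wave psi0 (fun x => (2 : R)%:C * phi j x + (- 2 : R)%:C * phi0 x).
have VD1 : V D1.
  apply: rV; last by apply: le_trans q1 _; rewrite lee_fin.
  split; last by apply: le_lt_trans q1 _; exact: ltry.
  exact: (wave_jet (cschwartz_lin 2 (- 2) cpj cp0) cfj).1.
have VD2 : V D2.
  apply: rV; last by apply: le_trans q2 _; rewrite lee_fin.
  split; last by apply: le_lt_trans q2 _; exact: ltry.
  exact: (wave_jet cp0 (cschwartz_lin 2 (- 2) cfj cf0)).1.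
apply: nj => _ _.
have st : steps (@hs_smooth R n) (@hs_norm R n s t tau1 tau2 al) (wave (psi j) (phi j)).
  exact: wave_steps h0 (sp j).1 (sf j).1 pAj pBj mpj mfj.
exists (SigSub (mem_set st)) => //; apply: VU.
rewrite EPhi /=.
have hh : normc ((2^-1 : R)%:C) + normc ((2^-1 : R)%:C) <= 1.
  have E : (2^-1 : R) + 2^-1 = 1 by field.
  by rewrite normc_real ger0_norm // E.
(* wave psi phi - wave psi0 phi0 = (D1 + D2) / 2, by bilinearity *)
have := cV _ _ VD1 VD2 _ _ hh.
rewrite (_ : (fun x => _) = (fun z => wave (psi j) (phi j) z - wave psi0 phi0 z)) //.
apply/funext => z; rewrite /D1 /D2 wave_linl // wave_linr //.
have -> : (- 2 : R)%:C = - (2 : R)%:C by rewrite rmorphN.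
have V2 : (2^-1 : R)%:C * (2 : R)%:C = 1 by rewrite -rmorphM /= mulVf.
rewrite !mulrDr !mulNr !mulrN !mulrA V2; ring.
Qed.

End wave_continuity.

Section indlim_neighbourhoods.
Context {R : realType} {T : Type} {A : set (T -> R[i])} {p : R -> (T -> R[i]) -> \bar R}.
Hypothesis sA : silva_scale A p.
Notation C := R[i].

Let half_nbhs0 V : indlim_nbhs0 A p V -> indlim_nbhs0 A p [set k | V (fun x => (2 : R)%:C * k x)].
Proof.
move=> [cV nV]; split=> [f g Vf Vg c d cd /=|h h0].
  have := cV _ _ Vf Vg c d cd.
  rewrite (_ : (fun x => _) = (fun x => (2 : R)%:C * (c * f x + d * g x))) //.
  by apply/funext => x; ring.
have [r r0 rV] := nV h h0; exists (r / 2); first by rewrite divr_gt0.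
move=> f [Af _] pf; have [A2 p2] := scale_lin sA (2 : R)%:C 0 h0 Af Af pf pf.
have E : (fun x => (2 : R)%:C * f x + 0 * f x) = fun x => (2 : R)%:C * f x.
  by apply/funext => x; rewrite mul0r addr0.
have N : normc ((2 : R)%:C) * (r / 2) + normc (0 : C) * (r / 2) = r.
  by rewrite normc0 mul0r addr0 normc_real ger0_norm // mulrC divfK.
rewrite E N in A2 p2.
by apply: rV => //; split=> //; apply: le_lt_trans p2 _; exact: ltry.
Qed.

Let half_nbhs0_add V f g : indlim_nbhs0 A p V -> V (fun x => (2 : R)%:C * f x) ->
  V (fun x => (2 : R)%:C * g x) -> V (fun x => f x + g x).
Proof.
move=> [cV _] Vf Vg.
have hh : normc ((2^-1 : R)%:C) + normc ((2^-1 : R)%:C) <= 1.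
  have E : (2^-1 : R) + 2^-1 = 1 by field.
  by rewrite normc_real ger0_norm // E.
have := cV _ _ Vf Vg _ _ hh; rewrite (_ : (fun x => _) = (fun x => f x + g x)) //.
have V2 : (2^-1 : R)%:C * (2 : R)%:C = 1 by rewrite -rmorphM /= mulVf.
by apply/funext => x; rewrite !mulrA V2 !mul1r.
Qed.

(** The basic sets are neighbourhoods in the topology they generate: halving
    provides an open subset. *)
Lemma indlim_nbhs V (f : indlim A p) : indlim_nbhs0 A p V ->
  nbhs f [set g : indlim A p | V (fun x => \val g x - \val f x)].
Proof.
move=> nV; rewrite nbhsE.
exists [set g : indlim A p | exists2 W, indlim_nbhs0 A p W &
    forall g' : indlim A p, W (fun x => \val g' x - \val g x) -> V (fun x => \val g' x - \val f x)].
  split; last by exists V.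
  move=> g [W nW WV]; have nW2 := half_nbhs0 nW; exists [set k | W (fun x => (2 : R)%:C * k x)] => //.
  move=> g' W' /=; exists [set k | W (fun x => (2 : R)%:C * k x)] => // g'' W''; apply: WV.
  have := half_nbhs0_add nW W'' W'.
  rewrite (_ : (fun x => _) = (fun x => \val g'' x - \val g x)) //.
  by apply/funext => x; rewrite addrA subrK.
move=> g [W [cW nW] WV]; apply: WV; have [r r0 rW] := nW 1 ltr01.
have E : (fun x => \val g x - \val g x) = fun=> 0 by apply/funext => x; rewrite subrr.
rewrite E.
have [A0 p0] := scale_zero sA; have p01 := p0 1 ltr01; apply: rW.
  by split=> //; apply: le_lt_trans p01 _; exact: ltry.
by apply: le_trans p01 _; rewrite lee_fin ltW.
Qed.

End indlim_neighbourhoods.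

Section wavelet_map.
Context {R : realType} {n : nat}.
Variables (rho1 rho2 sigma tau s t tau1 tau2 : R).
Hypotheses (n0 : (0 < n)%N) (sigma0 : 0 <= sigma) (rho10 : 0 <= rho1).
Hypotheses (tau_1 : 1 <= tau) (rho2_1 : 1 <= rho2).
Hypotheses (sigma_s : sigma <= s) (sigma_tau2 : sigma + rho2 - 1 <= tau2).
Hypotheses (tau_t : tau <= t) (rho2_t : rho2 <= t).
Hypotheses (rho1_tau1 : tau + rho1 - 1 <= tau1) (rho_t : tau + rho1 - 1 + rho2 <= t).

Let rho20 : 0 <= rho2. Proof. exact: le_trans rho2_1. Qed.
Let tau0 : 0 <= tau. Proof. exact: le_trans tau_1. Qed.

Lemma gs0_moments (q1 q2 : R) (phi : GS0 n q1 q2) : cmoments0 (gs0_fun phi).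
Proof. by move=> m; exact: (set_mem (valP phi) m). Qed.

Lemma gs0_step (q1 q2 : R) (phi : GS0 n q1 q2) :
  exists2 h, 0 < h & step (@schwartz R n) (gs_norm q1 q2) h (gs0_fun phi).
Proof. exact: (set_mem (valP (\val phi))). Qed.

Lemma wave_hs (psi : GS0 n rho1 rho2) (phi : GS0 n sigma tau) :
  @hs_fun R n s t tau1 tau2 (wave (gs0_fun psi) (gs0_fun phi)).
Proof.
move=> al; have [h1 h10 [A1 p1]] := gs0_step psi; have [h2 h20 [A2 p2]] := gs0_step phi.
have [M M0 pM] := gs_norm_fin (ltW h10) p1; have [N N0 pN] := gs_norm_fin (ltW h20) p2.
have h0 : 0 < Num.min h1 h2 by rewrite lt_min h10.
have l1 : Num.min h1 h2 <= h1 by rewrite ge_min lexx.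
have l2 : Num.min h1 h2 <= h2 by rewrite ge_min lexx orbT.
have pM' := gs_norm_le_mono (ltW h0) l1 pM; have pN' := gs_norm_le_mono (ltW h0) l2 pN.
exact: (wave_steps n0 sigma0 rho10 tau_1 rho2_1 sigma_s sigma_tau2 tau_t rho2_t rho1_tau1 rho_t
  al h0 A1 A2 pM' pN' (gs0_moments psi) (gs0_moments phi)).
Qed.

Definition wave_map (z : (GS0 n rho1 rho2 * GS0 n sigma tau)%type) : SH n s t tau1 tau2 :=
  SigSub (mem_set (wave_hs z.1 z.2)).

Lemma gs0_nbhs (q1 q2 : R) V (phi : GS0 n q1 q2) : 0 <= q1 -> 0 <= q2 ->
  indlim_nbhs0 (@schwartz R n) (gs_norm q1 q2) V ->
  nbhs phi [set psi : GS0 n q1 q2 | V (fun x => gs0_fun psi x - gs0_fun phi x)].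
Proof.
move=> q10 q20 nV.
have N := indlim_nbhs (gs_scale n0 q10 q20) (\val phi) nV.
have Cv := @initial_continuous _ (@GS R n q1 q2) (set_val : GS0 n q1 q2 -> @GS R n q1 q2).
exact: (Cv phi _ N).
Qed.

Lemma wave_map_continuous : continuous wave_map.
Proof.
apply: (@continuous_comp_initial _ _ _ (@hs_incl R n s t tau1 tau2) wave_map) => z0.
apply/cvg_sup => al; move: z0.
apply/(@continuousP _ (initial_topology (fun f : prod_topology (hs_indlim n s t tau1 tau2) => f al))).
move=> _ [U oU <-]; rewrite openE => -[psi0 phi0] U0.
have [h1 h10 s1] := gs0_step psi0; have [h2 h20 s2] := gs0_step phi0.
have Q0 : wave_in (al := al) U (gs0_fun psi0) (gs0_fun phi0) by move=> _ _; exists (hs_incl (wave_map (psi0, phi0)) al).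
have Qo := wave_in_open n0 sigma0 rho10 tau_1 rho2_1 sigma_s sigma_tau2 tau_t rho2_t rho1_tau1 rho_t oU.
have [V1 [V2 [n1 n2 VQ]]] := silva_open (gs_scale n0 rho10 rho20) (gs_scale n0 sigma0 tau0) Qo h10 h20 s1 s2 Q0.
exists ([set psi | V1 (fun x => gs0_fun psi x - gs0_fun psi0 x)],
        [set phi | V2 (fun x => gs0_fun phi x - gs0_fun phi0 x)]).
  by split; exact: gs0_nbhs.
move=> [psi phi] /= [v1 v2]; have := VQ _ _ v1 v2.
have E (f g : 'rV[R]_n -> R[i]) : (fun x => g x + (f x - g x)) = f.
  by apply/funext => x; rewrite addrC subrK.
rewrite !E => /(_ (gs0_moments psi) (gs0_moments phi))[Phi UPhi EPhi].
by rewrite (_ : hs_incl _ al = Phi) //; apply/val_inj; rewrite EPhi.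
Qed.

End wavelet_map.

Theorem theorem1 (R : realType) (n : nat) (rho1 rho2 s t tau1 tau2 : R)
    (hn : (0 < n)%N) (hrho1 : 0 < rho1) (hrho2 : 1 < rho2) (hs : 0 < s)
    (ht : rho1 + rho2 < t) (htau1 : rho1 < tau1) (htau2 : rho2 - 1 < tau2) :
  exists W : (GS0 n rho1 rho2 *
              GS0 n (Num.min s (tau2 - rho2 + 1))%R
                    (1 - rho1 + Num.min (t - rho2) tau1)%R)%type ->
             SH n s t tau1 tau2,
    (forall psi phi (b : 'rV[R]_n) (a : R), 0 < a ->
       sh_fun (W (psi, phi)) (b, a) = wavelet (gs0_fun psi) (gs0_fun phi) b a) /\
    continuous W.
Proof.
set sigma := Num.min s _; set m := Num.min (t - rho2) tau1; set tau := 1 - rho1 + m.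
have sigma_s : sigma <= s by rewrite ge_min lexx.
have sigma_t : sigma <= tau2 - rho2 + 1 by rewrite ge_min lexx orbT.
have sigma0 : 0 < sigma by rewrite lt_min hs; move: htau2; clear; lra.
have m_t : m <= t - rho2 by rewrite ge_min lexx.
have m_tau1 : m <= tau1 by rewrite ge_min lexx orbT.
have rho1_m : rho1 < m by rewrite lt_min htau1 andbT; move: ht; clear; lra.
have c1 : 1 <= tau by rewrite /tau; move: rho1_m; clear; lra.
have c2 : sigma + rho2 - 1 <= tau2 by move: sigma_t; clear; lra.
have c3 : tau <= t by rewrite /tau; move: m_t hrho1 hrho2; clear; lra.
have c4 : rho2 <= t by move: ht hrho1; clear; lra.
have c5 : tau + rho1 - 1 <= tau1 by rewrite /tau; move: m_tau1; clear; lra.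
have c6 : tau + rho1 - 1 + rho2 <= t by rewrite /tau; move: m_t; clear; lra.
exists (wave_map hn (ltW sigma0) (ltW hrho1) c1 (ltW hrho2) sigma_s c2 c3 c4 c5 c6); split.
  by move=> psi phi b a a0; rewrite /sh_fun /= /wave /= a0.
exact: wave_map_continuous.
Qed.
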